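(* Let $p\geq 3$ be an integer and $0<\beta<\beta_p$. Then, as $N\to\infty$, $$N^{p/2}\left(F_N(\beta)-\frac{\beta^2}{2}\right)\longrightarrow \mathcal N\left(0,\frac{\beta^4\,p!}{2}\right)\quad\text{in distribution.}$$
   Context: For integers $N\ge p$, let $I_N=\{(i_1,\dots,i_p)\in\{1,\dots,N\}^p: i_1<\dots<i_p\}$ and let $(J_A)_{A\in I_N}$ be independent standard normal random variables (with law $\mathbb P$ and expectation $\mathbb E$). For $\sigma\in S_N=\{-1,+1\}^N$ and $A=(i_1,\dots,i_p)$ put $\sigma_A=\sigma_{i_1}\cdots\sigma_{i_p}$. The Hamiltonian is $H_N(\sigma)=-\sqrt N\,X_\sigma$ with $X_\sigma=\binom Np^{-1/2}\sum_{A\in I_N}J_A\sigma_A$. The partition function is $Z_N(\beta)=2^{-N}\sum_{\sigma\in S_N}e^{-\beta H_N(\sigma)}$ and $F_N(\beta)=\frac1N\ln Z_N(\beta)$. For $m\in(0,1)$ let $\phi(m)=\frac{1-m}{2}\ln(1-m)+\frac{1+m}{2}\ln(1+m)$; for $p\ge3$, $\beta_p>0$ is defined by $\beta_p^2=\inf_{0<m<1}(1+m^{-p})\phi(m)$. $\mathcal N(\mu,v)$ denotes the normal law with mean $\mu$ and variance $v$. *)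

(* Defs.v *)
From HB Require Import structures.
From mathcomp Require Import all_boot all_order all_algebra.
From mathcomp Require Import all_classical all_reals all_analysis.
From mathcomp Require Import measurable_realfun.

Set Implicit Arguments.
Unset Strict Implicit.
Unset Printing Implicit Defensive.
Import Order.TTheory GRing.Theory Num.Theory.
Import numFieldNormedType.Exports.
Local Open Scope classical_set_scope.
Local Open Scope ring_scope.

Section probability_notions.
Context {R : realType}.

Definition mutually_independent d (T : measurableType d) (P : probability T R)
    (I : finType) (X : I -> {RV P >-> R}) : Prop :=
  forall (D : {set I}) (B : I -> set R),
    (forall i, i \in D -> measurable (B i)) ->
    P (\bigcap_(i in [set` D]) (X i @^-1` B i))
    = (\prod_(i in D) P (X i @^-1` B i))%E.

(* Measures of the library are functions on all sets, with arbitrary values on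
   non-measurable ones, so equality of laws is only required on Borel sets. *)
Definition has_law d (T : measurableType d) (P : probability T R)
    (X : {RV P >-> R}) (mu : probability (measurableTypeR R) R) : Prop :=
  forall B : set R, measurable B -> distribution P X B = mu B.

(* The n-th variable may live on its own probability space. *)
Definition cvg_in_distribution (d : nat -> measure_display)
    (T : forall n, measurableType (d n)) (P : forall n, probability (T n) R)
    (X : forall n, {RV (P n) >-> R})
    (mu : probability (measurableTypeR R) R) : Prop :=
  forall f : R -> R, continuous f -> (exists M : R, forall x, `|f x| <= M) ->
    ('E_(P n)[f \o X n])%E @[n --> \oo] --> (\int[mu]_x (f x)%:E)%E.

(* [normal_prob] is parametrised by the standard deviation, and is a junk value
   (uniform law) at 0: only meant for [0 < var]. *)
Definition gaussian (mean var : R) : probability (measurableTypeR R) R :=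
  normal_prob mean (Num.sqrt var).

End probability_notions.

Arguments mutually_independent {R d T} P {I} X.
Arguments has_law {R d T} P X mu.
Arguments cvg_in_distribution {R d T} P X mu.

Definition multi_index (N p : nat) : finType :=
  {A : p.-tuple 'I_N | sorted ltn (map val A)}.

(* [true] stands for the spin -1 and [false] for the spin +1. *)
Definition config (N : nat) : finType := {ffun 'I_N -> bool}.

Section pspin.
Context {R : realType} {d : measure_display} {T : measurableType d}.
Context {P : probability T R}.
Variables (N p : nat) (J : multi_index N p -> {RV P >-> R}).

Definition spin (s : config N) (i : 'I_N) : R := (-1) ^+ s i.

Definition spin_prod (s : config N) (A : multi_index N p) : R :=
  \prod_(k < p) spin s (tnth (val A) k).

Definition gauss_field (s : config N) (w : T) : R :=
  (Num.sqrt 'C(N, p)%:R)^-1 * \sum_(A : multi_index N p) J A w * spin_prod s A.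

Definition hamiltonian (s : config N) (w : T) : R :=
  - Num.sqrt N%:R * gauss_field s w.

Definition partition_function (beta : R) (w : T) : R :=
  2 ^- N * \sum_(s : config N) expR (- beta * hamiltonian s w).

Definition free_energy (beta : R) (w : T) : R :=
  N%:R^-1 * ln (partition_function beta w).

Definition scaled_fluctuation (beta : R) (w : T) : R :=
  N%:R `^ (p%:R / 2) * (free_energy beta w - beta ^+ 2 / 2).

Lemma measurable_scaled_fluctuation (beta : R) :
  measurable_fun setT (scaled_fluctuation beta).
Proof.
apply: measurable_funM; first exact: measurable_cst.
apply: measurable_funB; last exact: measurable_cst.
apply: measurable_funM; first exact: measurable_cst.
apply: (measurableT_comp (@measurable_ln R)).
apply: measurable_funM; first exact: measurable_cst.
apply: measurable_sum => s.
apply: (measurableT_comp (@measurable_expR R)).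
apply: measurable_funM; first exact: measurable_cst.
apply: measurable_funM; first exact: measurable_cst.
apply: measurable_funM; first exact: measurable_cst.
apply: measurable_sum => A.
by apply: measurable_funM; [exact: measurable_funPT | exact: measurable_cst].
Qed.

HB.instance Definition _ (beta : R) := isMeasurableFun.Build _ _ _ _
  (scaled_fluctuation beta) (measurable_scaled_fluctuation beta).

End pspin.

Section critical_beta.
Context {R : realType}.

Definition phi (m : R) : R :=
  (1 - m) / 2 * ln (1 - m) + (1 + m) / 2 * ln (1 + m).

Definition critical_beta (p : nat) : R :=
  Num.sqrt (inf [set (1 + m ^- p) * phi m | m in `]0, 1[]).

End critical_beta.

(* Main.v *)
Require Import Defs.
From HB Require Import structures.
From mathcomp Require Import all_boot all_order all_algebra.
From mathcomp Require Import all_classical all_reals all_analysis.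
From mathcomp Require Import measurable_realfun ring lra.

Set Implicit Arguments.
Unset Strict Implicit.
Unset Printing Implicit Defensive.
Import Order.TTheory GRing.Theory Num.Theory.
Import numFieldNormedType.Exports.
Local Open Scope classical_set_scope.
Local Open Scope ring_scope.

(** Write [C] for the binomial coefficient of [N] and [p], [U] for the partition function
    divided by its mean [expR (N * beta ^+ 2 / 2)], and [a] for [N ^ (p / 2 - 1)]. The
    scaled fluctuation of the free energy is [a * ln U], and the proof shows that
    [a * (U - 1)] is asymptotically a normalised sum of independent variables.

    Leading fluctuation. Expand the mean of the exponentials over the configurations in
    Hermite polynomials of the couplings. The terms of first order vanish, and so do the
    products of two distinct couplings, because distinct monomials in the spins are
    orthogonal; what remains at second order is [chi2_part],
    [Q = beta ^+ 2 * N / (2 * C) * \sum_A (J A ^+ 2 - 1)]. Its variance [chi2_var] is of order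
    [N ^ (2 - p)], which explains the scaling, and [chi2_stein] is the central limit
    theorem for it. That theorem is obtained from Stein's equation: integration by parts in
    each coupling compares the sum with a normal variable, with an error bound uniform over
    all families of independent standard normal variables of a given size.

    Second moment. Since [U] and [Q] have covariance [chi2_var] as well, the squared
    distance from [U] to [1 + Q] is [E (U ^+ 2) - 1 - chi2_var]. Now [E (U ^+ 2)] is the mean
    of [expR (N * beta ^+ 2 * cov t)] over the products [t] of two configurations. At small
    overlap a Taylor expansion gives [1 + chi2_var] up to a relative error [N ^ (- 1 / 2)]
    ([sum_small]). At large overlap the exponent has to be compared with the entropy
    [N * phi x] of the overlap [x], and it is too large when [beta] is close to its
    critical value. The configurations whose energy exceeds [(beta + eps) * N] are therefore
    removed from [U]. They carry an exponentially small part of its mean, and after their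
    removal a pair with correlation [r] costs only [N * beta ^+ 2 * r / (1 + r)], up to
    [eps], by an exponential Chebyshev inequality. As [r] is close to [x ^+ p], the condition
    [beta < critical_beta p] says exactly that the entropy wins ([critical_beta_lt],
    [sum_large]).

    Assembly. Computing the moments of the truncated partition function is avoided:
    [test_function_le] bounds the effect on a bounded continuous test function of replacing
    [a * ln U] by the normalised sum, pointwise, by quantities whose means are explicit
    ([hasE_trunc_sqr_bound], [hasE_tail_bound]). Taking expectations leaves only errors
    that tend to zero. *)

(** * Integrals with a prescribed value *)

(** Integrability and value travel together, so that expectations can be
    computed by linearity without side conditions. *)
Definition hasE {d} {T : measurableType d} {R : realType}
    (mu : {measure set T -> \bar R}) (f : T -> R) (e : R) : Prop :=
  mu.-integrable setT (EFin \o f) /\ (\int[mu]_x (f x)%:E = e%:E)%E.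

Section has_expectation.
Context d (T : measurableType d) (R : realType).
Variable mu : {measure set T -> \bar R}.
Implicit Types (f g : T -> R) (a b : R).

Lemma hasE_integrable f :
  mu.-integrable setT (EFin \o f) -> hasE mu f (\int[mu]_x f x).
Proof. by move=> fi; split=> //; rewrite fineK//; exact: integrable_fin_num. Qed.

Lemma hasE_eq f g a b :
  hasE mu f a -> (forall x, g x = f x) -> b = a -> hasE mu g b.
Proof. by move=> fa fg ->; rewrite (funext fg). Qed.

Lemma hasE_unique f a b : hasE mu f a -> hasE mu f b -> a = b.
Proof. by move=> [_ fa] [_]; rewrite fa => -[]. Qed.

Lemma hasE_ge0 f a : measurable_fun setT f -> (forall x, 0 <= f x) ->
  (\int[mu]_x (f x)%:E = a%:E)%E -> hasE mu f a.
Proof.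
move=> mf f0 fa; split=> //; apply/integrableP; split.
  exact/measurable_EFinP.
under eq_integral => x _ do rewrite /= ger0_norm//.
by rewrite fa ltry.
Qed.

Lemma hasED f g a b :
  hasE mu f a -> hasE mu g b -> hasE mu (fun x => f x + g x) (a + b).
Proof.
move=> [fi fa] [gi gb]; split.
  by rewrite (_ : EFin \o _ = (EFin \o f) \+ (EFin \o g))%E//; exact: integrableD.
under eq_integral do rewrite EFinD.
by rewrite integralD// fa gb.
Qed.

Lemma hasEZ c f a : hasE mu f a -> hasE mu (fun x => c * f x) (c * a).
Proof.
move=> [fi fa]; split.
  have := integrableZl measurableT c fi.
  by apply: eq_integrable => // x _; rewrite /= EFinM.
under eq_integral do rewrite EFinM.
by rewrite integralZl// fa.
Qed.

Lemma hasEN f a : hasE mu f a -> hasE mu (fun x => - f x) (- a).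
Proof.
move=> /(hasEZ (-1)); rewrite mulN1r.
by under [X in hasE mu X]eq_fun do rewrite mulN1r.
Qed.

Lemma hasEB f g a b :
  hasE mu f a -> hasE mu g b -> hasE mu (fun x => f x - g x) (a - b).
Proof. by move=> fa /hasEN gb; exact: hasED. Qed.

Lemma hasE0 : hasE mu (fun=> 0) 0.
Proof.
split; last by rewrite integral0.
exact: (@integrable0 _ _ _ mu setT).
Qed.

Lemma hasE_sum (I : Type) (r : seq I) (Q : pred I) (F : I -> T -> R) (e : I -> R) :
  (forall i, Q i -> hasE mu (F i) (e i)) ->
  hasE mu (fun x => \sum_(i <- r | Q i) F i x) (\sum_(i <- r | Q i) e i).
Proof.
move=> H; elim: r => [|i r IH].
  by rewrite big_nil; under [X in hasE mu X]eq_fun do rewrite big_nil; exact: hasE0.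
rewrite big_cons; under [X in hasE mu X]eq_fun do rewrite big_cons.
by case: ifPn => // Qi; apply: hasED => //; exact: H.
Qed.

Lemma hasE_le f g a b : hasE mu f a -> hasE mu g b ->
  (forall x, f x <= g x) -> a <= b.
Proof.
move=> [fi fa] [gi gb] fg; rewrite -lee_fin -fa -gb.
by apply: le_integral => // x _ /=; rewrite lee_fin.
Qed.

Lemma hasE_dominated f g b : measurable_fun setT f -> hasE mu g b ->
  (forall x, `|f x| <= g x) -> hasE mu f (\int[mu]_x f x).
Proof.
move=> mf [gi _] fg; apply: hasE_integrable.
apply: le_integrable gi => //; first exact/measurable_EFinP.
by move=> x _; rewrite /= lee_fin (le_trans (fg x)) ?ler_norm.
Qed.

End has_expectation.

Lemma hasE_cst d (T : measurableType d) (R : realType) (P : probability T R) c :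
  hasE P (fun=> c) c.
Proof.
split; last by rewrite integral_cst// [X in (_ * X)%E]probability_setT mule1.
exact: finite_measure_integrable_cst.
Qed.

(** * The normal law *)

Section normal_density.
Context {R : realType}.
Variables (m s : R).
Local Notation mu := (@lebesgue_measure R).

Lemma ge0_integral_normal (f : R -> R) :
  measurable_fun setT f -> (forall x, 0 <= f x) ->
  (\int[normal_prob m s]_x (f x)%:E = \int[mu]_x (f x * normal_pdf m s x)%:E)%E.
Proof.
move=> mf f0.
have dom := normal_prob_dominates m s.
rewrite -(@Radon_Nikodym_SigmaFinite.change_of_variables _ _ _
  (normal_prob m s) mu dom (EFin \o f) setT)//; last exact/measurable_EFinP.
apply: ae_eq_integral => //.
- apply: emeasurable_funM; first exact/measurable_EFinP.
  exact: measurable_int (Radon_Nikodym_SigmaFinite.f_integrable dom).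
- apply/measurable_EFinP/measurable_funM => //; exact: measurable_normal_pdf.
- rewrite (_ : (fun x => (f x * normal_pdf m s x)%:E) =
               (fun x => (f x)%:E * (normal_pdf m s x)%:E)%E)//.
  apply: ae_eqe_mul2l; apply: integral_ae_eq => //.
  + exact: Radon_Nikodym_SigmaFinite.f_integrable.
  + by apply/measurable_EFinP; exact: measurable_normal_pdf.
  + by move=> E _ mE; rewrite -Radon_Nikodym_SigmaFinite.f_integral.
Qed.

Lemma hasE_normalP (f : R -> R) e : measurable_fun setT f ->
  hasE (normal_prob m s) f e <-> hasE mu (fun x => f x * normal_pdf m s x) e.
Proof.
move=> mf.
have mp : measurable_fun setT (normal_pdf m s) by exact: measurable_normal_pdf.
have mfp : measurable_fun setT (fun x => f x * normal_pdf m s x).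
  exact: measurable_funM.
have abs_eq : (\int[normal_prob m s]_x `|(f x)%:E| =
               \int[mu]_x `|(f x * normal_pdf m s x)%:E|)%E.
  under eq_integral do rewrite abse_EFin.
  rewrite ge0_integral_normal//; last exact: measurableT_comp.
  apply: eq_integral => x _.
  by rewrite abse_EFin normrM (ger0_norm (normal_pdf_ge0 _ _ _)).
have int_eq : (normal_prob m s).-integrable setT (EFin \o f) <->
              mu.-integrable setT (EFin \o (fun x => f x * normal_pdf m s x)).
  by split => /integrableP[_ fi]; apply/integrableP; split;
    by [exact/measurable_EFinP|rewrite /= ?abs_eq// -abs_eq].
pose fp x := Num.max (f x) 0; pose fn x := Num.max (- f x) 0.
have mfpos : measurable_fun setT fp by exact: measurable_maxr.
have mfneg : measurable_fun setT fn.
  by apply: measurable_maxr => //; exact: measurableT_comp.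
have fp0 x : 0 <= fp x by rewrite le_max lexx orbT.
have fn0 x : 0 <= fn x by rewrite le_max lexx orbT.
have fE x : f x = fp x - fn x.
  rewrite /fp /fn; case: (leP 0 (f x)) => h.
    by rewrite max_r ?oppr_le0// subr0.
  by rewrite max_l ?oppr_ge0 ?ltW// sub0r opprK.
have fpn x : fp x <= `|f x| by rewrite ge_max ler_norm normr_ge0.
have fnn x : fn x <= `|f x| by rewrite ge_max -normrN ler_norm normr_ge0.
suff eq : (normal_prob m s).-integrable setT (EFin \o f) ->
    (\int[normal_prob m s]_x (f x)%:E =
     \int[mu]_x (f x * normal_pdf m s x)%:E)%E.
  split=> -[fi fe]; split; try exact/int_eq.
  - by rewrite -eq.
  - by rewrite eq//; exact/int_eq.
move=> fi; have fip := int_eq.1 fi.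
have ip : (normal_prob m s).-integrable setT (EFin \o fp).
  apply: le_integrable fi => //; first exact/measurable_EFinP.
  by move=> x _; rewrite /= lee_fin ger0_norm.
have ineg : (normal_prob m s).-integrable setT (EFin \o fn).
  apply: le_integrable fi => //; first exact/measurable_EFinP.
  by move=> x _; rewrite /= lee_fin ger0_norm.
have ip' : mu.-integrable setT (EFin \o (fun x => fp x * normal_pdf m s x)).
  apply: le_integrable fip => //; first exact/measurable_EFinP/measurable_funM.
  move=> x _; rewrite /= lee_fin !normrM ler_wpM2r// ger0_norm//.
have in' : mu.-integrable setT (EFin \o (fun x => fn x * normal_pdf m s x)).
  apply: le_integrable fip => //; first exact/measurable_EFinP/measurable_funM.
  move=> x _; rewrite /= lee_fin !normrM ler_wpM2r// ger0_norm//.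
under eq_integral do rewrite fE EFinB.
under [RHS]eq_integral do rewrite fE mulrBl EFinB.
by rewrite !integralB// !ge0_integral_normal.
Qed.

End normal_density.

Section exponential_growth.
Context {R : realType}.
Implicit Types (f g : R -> R) (a c x : R).

(** Functions of at most exponential growth are integrable against every
    Gaussian density, and form an algebra. *)
Definition exp_growth f : Prop :=
  exists a K, forall x, `|f x| <= K * (expR (a * x) + expR (- (a * x))).

Lemma exp_growth_expR c : exp_growth (fun x => expR (c * x)).
Proof.
exists c, 1 => x; rewrite mul1r ger0_norm ?expR_ge0//.
by rewrite lerDl expR_ge0.
Qed.

Lemma exp_growth_le f g : (forall x, `|f x| <= `|g x|) -> exp_growth g -> exp_growth f.
Proof. by move=> fg [a [K gK]]; exists a, K => x; exact: le_trans (gK x). Qed.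

Let cosh_mono a b x : `|a| <= b ->
  expR (a * x) + expR (- (a * x)) <= expR (b * x) + expR (- (b * x)).
Proof.
move=> ab.
have sym u : expR u + expR (- u) = expR `|u| + expR (- `|u| : R).
  by case: (leP 0 u) => h; [rewrite ger0_norm|rewrite ltr0_norm// opprK addrC].
rewrite sym [leRHS]sym !normrM (ger0_norm (le_trans (normr_ge0 a) ab)).
set u := `|a| * _; set v := b * _.
have u0 : 0 <= u by rewrite mulr_ge0.
have uv : u <= v by rewrite ler_wpM2r.
have e1 : expR u >= 1 by rewrite -expR0 ler_expR.
have e2 : expR u <= expR v by rewrite ler_expR.
rewrite !expRN -subr_ge0.
have u0' := expR_gt0 u; have v0' := expR_gt0 v.
rewrite (_ : _ - _ = (expR v - expR u) * (1 - (expR u * expR v)^-1)); last first.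
  by field; rewrite !gt_eqF.
rewrite mulr_ge0 ?subr_ge0// invf_le1 ?mulr_gt0//.
by rewrite -[1]mulr1 ler_pM// (le_trans e1).
Qed.

Lemma exp_growthE f : exp_growth f -> exists a K, [/\ 0 <= a, 0 <= K &
  forall x, `|f x| <= K * (expR (a * x) + expR (- (a * x)))].
Proof.
move=> [a [K fK]]; exists `|a|, `|K|; split => // x.
apply: le_trans (fK x) _.
apply: (@le_trans _ _ (`|K| * (expR (a * x) + expR (- (a * x))))).
  by rewrite ler_wpM2r ?ler_norm// addr_ge0 ?expR_ge0.
by rewrite ler_wpM2l// cosh_mono.
Qed.

Lemma exp_growthM f g : exp_growth f -> exp_growth g -> exp_growth (fun x => f x * g x).
Proof.
move=> /exp_growthE[a [K [a0 K0 fK]]] /exp_growthE[b [L [b0 L0 gL]]].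
exists (a + b), (2 * K * L) => x; rewrite normrM.
apply: le_trans (ler_pM _ _ (fK x) (gL x)) _ => //.
rewrite mulrACA -mulrA -mulrA [2 * _]mulrC -mulrA -mulrA.
rewrite ler_wpM2l// ler_wpM2l//.
rewrite mulrDr !mulrDl -!expRD.
have := @cosh_mono (a - b) (a + b) x.
rewrite ler_norml opprD lerD2r lerD2l ge0_cp// ge0_cp// => /(_ isT).
rewrite -[in X in _ -> X](mulNr) mulrBl !mulrDl !opprD !opprK.
rewrite ?mulNr; set A := a * x; set B := b * x.
lra.
Qed.

Lemma exp_growthD f g : exp_growth f -> exp_growth g -> exp_growth (fun x => f x + g x).
Proof.
move=> /exp_growthE[a [K [a0 K0 fK]]] /exp_growthE[b [L [b0 L0 gL]]].
exists (a + b), (K + L) => x.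
apply: le_trans (ler_normD _ _) _; rewrite mulrDl lerD//.
- apply: le_trans (fK x) _; rewrite ler_wpM2l// cosh_mono// ger0_norm//.
  by rewrite lerDl.
- apply: le_trans (gL x) _; rewrite ler_wpM2l// cosh_mono// ger0_norm//.
  by rewrite lerDr.
Qed.

Lemma exp_growth_cst c : exp_growth (fun=> c).
Proof.
exists 0, `|c| => x; rewrite mul0r oppr0 expR0.
by rewrite mulrDr mulr1 lerDl.
Qed.

Lemma exp_growth_bounded f c : (forall x, `|f x| <= c) -> exp_growth f.
Proof.
move=> fc; apply: (@exp_growth_le _ (fun=> c)); last exact: exp_growth_cst.
by move=> x; rewrite (le_trans (fc x))// ler_norm.
Qed.

Lemma exp_growth_id : exp_growth (fun x => x).
Proof.
exists 1, 1 => x; rewrite !mul1r ler_norml.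
have h1 := expR_ge1Dx x; have h2 := expR_ge1Dx (- x).
have := expR_ge0 x; have := expR_ge0 (- x); lra.
Qed.

Lemma exp_growthX n : exp_growth (fun x => x ^+ n).
Proof.
elim: n => [|n IH]; first by under eq_fun do rewrite expr0; exact: exp_growth_cst.
by under eq_fun do rewrite exprS; apply: exp_growthM => //; exact: exp_growth_id.
Qed.

End exponential_growth.

Section standard_normal.
Context {R : realType}.
Local Notation mu := (@lebesgue_measure R).
Local Notation gamma := (normal_prob (0 : R) 1).
Local Notation pdf a := (normal_pdf (a : R) 1).
Implicit Types (f g : R -> R) (a c x : R).

Lemma expR_normal_pdf c x :
  expR (c * x) * pdf 0 x = expR (c ^+ 2 / 2) * pdf c x.
Proof.
rewrite !normal_pdfE ?oner_neq0// /normal_fun mulrCA [RHS]mulrCA; congr (_ * _).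
by rewrite -!expRD; congr expR; field.
Qed.

(** Multiplying by an exponential translates the density, which gives the
    moment generating function. *)
Lemma hasE_normal_expR c : hasE gamma (fun x => expR (c * x)) (expR (c ^+ 2 / 2)).
Proof.
have m1 : measurable_fun setT (fun x : R => expR (c * x)).
  by apply: measurableT_comp => //; exact: measurable_funM.
apply/hasE_normalP => //.
under eq_fun do rewrite expR_normal_pdf.
rewrite -[X in hasE _ _ X]mulr1; apply: hasEZ.
by split; [exact: integrable_normal_pdf|exact: integral_normal_pdf].
Qed.

Lemma hasE_exp_growth f : measurable_fun setT f -> exp_growth f ->
  hasE gamma f (\int[gamma]_x f x).
Proof.
move=> mf [a [K fK]].
apply: (@hasE_dominated _ _ _ gamma f _
  (K * (expR (a ^+ 2 / 2) + expR ((- a) ^+ 2 / 2))) mf _ fK).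
apply: hasEZ; apply: hasED; first exact: hasE_normal_expR.
under eq_fun do rewrite -mulNr; exact: hasE_normal_expR.
Qed.

Lemma normal_pdf_opp a x : pdf a (- x) = pdf (- a) x.
Proof.
rewrite !normal_pdfE ?oner_neq0// /normal_fun; congr (_ * expR _).
by rewrite -(sqrrN (- x - a)) opprD !opprK.
Qed.

Lemma cvg_normal_pdf a : pdf a n%:R @[n --> \oo] --> 0.
Proof.
have -> : (fun n => pdf a n%:R) =
    (fun n => normal_peak 1 * (gauss_fun \o (fun x => (x - a) / Num.sqrt 2)) n%:R).
  apply/funext => n; rewrite normal_pdfE ?oner_neq0//; congr (_ * expR _).
  by rewrite /= exprMn exprVn sqr_sqrtr// expr1n mulNr.
rewrite -[X in _ --> X](mulr0 (normal_peak 1)).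
apply: cvgM; first exact: cvg_cst.
apply: (cvg_comp (fun n : nat => (n%:R : R))
  (gauss_fun \o (fun x => (x - a) / Num.sqrt 2))); first exact: cvgr_idn.
apply: (cvg_comp (fun x : R => (x - a) / Num.sqrt 2) gauss_fun);
  last exact: cvg_gauss_fun.
apply: gt0_cvgMly; first by rewrite invr_gt0 sqrtr_gt0.
exact: cvg_addrr.
Qed.

Lemma cvg_exp_growth_pdf f (e : R) : (e == 1) || (e == -1) -> exp_growth f ->
  (f (e * n%:R) * pdf 0 (e * n%:R)) @[n --> \oo] --> 0.
Proof.
move=> e1 [a [K fK]].
pose u (n : nat) := K * (expR (a ^+ 2 / 2) * pdf a (e * n%:R)
  + expR (a ^+ 2 / 2) * pdf (- a) (e * n%:R)).
have u0 : u n @[n --> \oo] --> 0.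
  rewrite -(mulr0 K) -[X in K * X]addr0; apply: cvgM; first exact: cvg_cst.
  rewrite -[in X in _ --> X](mulr0 (expR (a ^+ 2 / 2))).
  by case/orP: e1 => /eqP ->; apply: cvgD; (apply: cvgM; first exact: cvg_cst);
    under eq_fun do rewrite ?mul1r ?mulN1r ?normal_pdf_opp ?opprK;
    exact: cvg_normal_pdf.
have fu n : `|f (e * n%:R) * pdf 0 (e * n%:R)| <= u n.
  rewrite normrM (ger0_norm (normal_pdf_ge0 _ _ _)).
  apply: (le_trans (ler_wpM2r (normal_pdf_ge0 _ _ _) (fK _))).
  have eN : expR (- a * (e * n%:R)) * pdf 0 (e * n%:R) =
      expR (a ^+ 2 / 2) * pdf (- a) (e * n%:R) by rewrite expR_normal_pdf sqrrN.
  by rewrite /u -mulrA mulrDl -mulNr expR_normal_pdf eN lexx.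
apply/norm_cvg0P.
apply: (@squeeze_cvgr _ _ _ _ (fun=> 0) u) => //; last exact: cvg_cst.
by near=> n; rewrite normr_ge0 fu.
Unshelve. all: by end_near.
Qed.

Lemma continuous_normal_pdf01 : continuous (pdf 0).
Proof. by apply: continuous_normal_pdf; rewrite oner_neq0. Qed.

Lemma is_derive_normal_pdf x : is_derive x 1 (pdf 0) (- x * pdf 0 x).
Proof.
have -> : pdf 0 = (fun x => normal_peak 1 * expR (- x ^+ 2 / 2)).
  apply/funext => y; rewrite normal_pdfE ?oner_neq0// /normal_fun; congr (_ * expR _).
  by rewrite subr0 expr1n.
have h : is_derive x 1 (fun y : R => - y ^+ 2 / 2) (- x).
  by apply: is_derive_eq; rewrite /GRing.scale /=; field.
have he : is_derive x 1 (fun y : R => expR (- y ^+ 2 / 2)) (expR (- x ^+ 2 / 2) * - x).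
  exact: (is_derive1_comp (f := expR)).
have := is_deriveM (is_derive_cst (normal_peak (1 : R)) x 1) he.
move=> h2; apply: is_derive_eq; rewrite /GRing.scale /=; ring.
Qed.

(** Integration by parts against the density, whose logarithmic derivative is
    [- x]; the boundary terms vanish by the growth condition. *)
Lemma normal_integration_by_parts g g' :
  (forall x, is_derive x 1 g (g' x)) -> continuous g' ->
  exp_growth g -> exp_growth g' ->
  exists e, hasE gamma (fun x => x * g x) e /\ hasE gamma g' e.
Proof.
move=> dg cg' eg eg'.
have cg : continuous g.
  by move=> x; apply: differentiable_continuous; apply/derivable1_diffP; case: (dg x).
have mg : measurable_fun setT g by exact: continuous_measurable_fun.
have mg' : measurable_fun setT g' by exact: continuous_measurable_fun.
have mxg : measurable_fun setT (fun x => x * g x) by exact: measurable_funM.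
have hg' := hasE_exp_growth mg' eg'.
have hxg := hasE_exp_growth mxg (exp_growthM exp_growth_id eg).
pose k x := (g' x - x * g x) * pdf 0 x.
have mk : measurable_fun setT (fun x => g' x - x * g x) by exact: measurable_funB.
have hk := (hasE_normalP 0 1 _ mk).1 (hasEB hg' hxg).
set I := _ - _ in hk.
have ck : continuous k.
  move=> x; apply: cvgM; last exact: continuous_normal_pdf01.
  by apply: cvgB; [exact: cg'|apply: cvgM; [exact: cvg_id|exact: cg]].
pose G x := g x * pdf 0 x.
have dG x : is_derive x 1 G (k x).
  have := is_deriveM (dg x) (is_derive_normal_pdf x).
  by move/is_derive_eq; apply; rewrite /k /GRing.scale /=; ring.
have cG : continuous G.
  by move=> x; apply: differentiable_continuous; apply/derivable1_diffP; case: (dG x).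
have FTC n : (\int[mu]_(x in `[(- n.+1%:R)%R, n.+1%:R]) (k x)%:E
    = (G n.+1%:R)%:E - (G (- n.+1%:R))%:E)%E.
  apply: continuous_FTC2.
  - by rewrite gtrN// ltr0n.
  - exact: continuous_subspaceT.
  - split.
    + by move=> x _; case: (dG x).
    + exact/cvg_at_right_filter/cG.
    + exact/cvg_at_left_filter/cG.
  - by move=> x _; rewrite derive1E; case: (dG x).
have lim0 : (\int[mu]_(x in `[(- n.+1%:R)%R, n.+1%:R]) (k x)%:E)%E @[n --> \oo] --> 0%E.
  under eq_fun do rewrite FTC -EFinB.
  apply: cvg_EFin; first by apply: nearW.
  rewrite /= -[X in _ --> X](subr0 0); apply: cvgB.
  - have : (g (1 * n%:R) * pdf 0 (1 * n%:R)) @[n --> \oo] --> 0.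
      by apply: cvg_exp_growth_pdf => //; rewrite eqxx.
    by rewrite -cvg_shiftS; under eq_fun do rewrite mul1r.
  - have : (g (-1 * n%:R) * pdf 0 (-1 * n%:R)) @[n --> \oo] --> 0.
      by apply: cvg_exp_growth_pdf => //; rewrite eqxx orbT.
    by rewrite -cvg_shiftS; under eq_fun do rewrite mulN1r.
have limI : (\int[mu]_(x in `[(- n.+1%:R)%R, n.+1%:R]) (k x)%:E)%E @[n --> \oo] --> I%:E.
  have [ik <-] := hk.
  pose kn n := (EFin \o k) \_ `[(- n.+1%:R)%R, (n.+1%:R : R)].
  under eq_fun do rewrite integral_mkcond.
  have knE n x : (n.+1%:R >= `|x|)%R -> kn n x = (k x)%:E.
    by move=> h; rewrite /kn patchE mem_set//= in_itv/= -ler_norml.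
  have kn_le n x : (`|kn n x| <= `|k x|%:E)%E.
    rewrite /kn patchE; case: ifPn => _ //=.
    by rewrite normr0 lee_fin.
  have := @dominated_convergence _ _ _ mu setT measurableT kn (EFin \o k)
    (fun x => `|k x|%:E).
  case.
  - move=> n; apply/measurable_restrict => //.
    apply: measurable_funTS; exact: measurable_int ik.
  - exact: measurable_int ik.
  - apply/aeW => x _; apply: cvg_near_cst.
    near=> n; apply: knE.
    rewrite (@le_trans _ _ n%:R) ?ler_nat//.
    by near: n; exact: nbhs_infty_ger.
  - exact: integrable_abse ik.
  - by apply/aeW => x n _; exact: kn_le.
  - by move=> _ _; exact.
have [I0] : I%:E = 0%E by exact: cvg_unique limI lim0.
exists (\int[gamma]_x g' x); split => //.
by move: I0 => /eqP; rewrite subr_eq0 => /eqP ->.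
Unshelve. all: by end_near.
Qed.

Lemma hasE_ibp_eq g g' b :
  (forall x, is_derive x 1 g (g' x)) -> continuous g' ->
  exp_growth g -> exp_growth g' -> hasE gamma g' b -> hasE gamma (fun x => x * g x) b.
Proof.
move=> dg cg' eg eg' hb.
have [e [h1 h2]] := normal_integration_by_parts dg cg' eg eg'.
by rewrite (hasE_unique hb h2).
Qed.

Lemma hasE_normal_sqr : hasE gamma (fun x => x ^+ 2) 1.
Proof.
under eq_fun do rewrite expr2.
apply: (@hasE_ibp_eq (fun x => x) (fun=> 1)).
- by move=> x; exact: cvg_cst.
- exact: exp_growth_id.
- exact: exp_growth_cst.
- exact: hasE_cst.
Qed.

Lemma hasE_normal_pow4 : hasE gamma (fun x => x ^+ 4) 3.
Proof.
under eq_fun do rewrite exprS.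
apply: (@hasE_ibp_eq (fun x => x ^+ 3) (fun x => 3 * x ^+ 2)).
- by move=> x; apply: is_derive_eq; rewrite /GRing.scale /=; ring.
- by move=> x; apply: cvgM; [exact: cvg_cst|exact: exprn_continuous].
- exact: exp_growthX.
- by apply: exp_growthM; [exact: exp_growth_cst|exact: exp_growthX].
- by rewrite -[X in hasE _ _ X]mulr1; apply: hasEZ; exact: hasE_normal_sqr.
Qed.

Let is_derive_expRM c x : is_derive x 1 (fun x => expR (c * x)) (c * expR (c * x)).
Proof.
have h : is_derive x 1 (fun y => c * y) c.
  by apply: is_derive_eq; rewrite /GRing.scale /= ?mulr1.
have : is_derive x 1 (fun y : R => expR (c * y)) (expR (c * x) * c).
  exact: (is_derive1_comp (f := expR)).
by rewrite mulrC.
Qed.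

Let continuous_expRM c : continuous (fun x : R => expR (c * x)).
Proof.
move=> x; apply: (cvg_comp (fun x => c * x) expR); last exact: continuous_expR.
by apply: cvgM; [exact: cvg_cst|exact: cvg_id].
Qed.

Lemma hasE_normal_sqr_expR c : hasE gamma (fun x => x ^+ 2 * expR (c * x))
  ((1 + c ^+ 2) * expR (c ^+ 2 / 2)).
Proof.
have h1 : hasE gamma (fun x => x * expR (c * x)) (c * expR (c ^+ 2 / 2)).
  apply: (@hasE_ibp_eq (fun x => expR (c * x)) (fun x => c * expR (c * x))).
  - exact: is_derive_expRM.
  - by move=> x; apply: cvgM; [exact: cvg_cst|exact: continuous_expRM].
  - exact: exp_growth_expR.
  - by apply: exp_growthM; [exact: exp_growth_cst|exact: exp_growth_expR].
  - by apply: hasEZ; exact: hasE_normal_expR.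
under eq_fun do rewrite expr2 -mulrA.
apply: (@hasE_ibp_eq (fun x => x * expR (c * x))
  (fun x => expR (c * x) + c * (x * expR (c * x)))).
- move=> x; have := is_deriveM (is_derive_id x 1) (is_derive_expRM c x).
  by move=> h; apply: is_derive_eq; rewrite /GRing.scale /=; ring.
- move=> x; apply: cvgD; first exact: continuous_expRM.
  apply: cvgM; first exact: cvg_cst.
  by apply: cvgM; [exact: cvg_id|exact: continuous_expRM].
- by apply: exp_growthM; [exact: exp_growth_id|exact: exp_growth_expR].
- apply: exp_growthD; first exact: exp_growth_expR.
  apply: exp_growthM; first exact: exp_growth_cst.
  by apply: exp_growthM; [exact: exp_growth_id|exact: exp_growth_expR].
- rewrite (_ : _ * _ = expR (c ^+ 2 / 2) + c * (c * expR (c ^+ 2 / 2))); last ring.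
  apply: hasED; first exact: hasE_normal_expR.
  exact: hasEZ.
Qed.

(** Second order form of the integration by parts, for the Hermite
    polynomial [x ^+ 2 - 1]. *)
Lemma hermite2_integration_by_parts f f' a :
  (forall x, is_derive x 1 f (f' x)) -> continuous f' ->
  (forall x, `|f x| <= a) -> exp_growth f' ->
  exists e, hasE gamma (fun x => (x ^+ 2 - 1) * f x) e /\
            hasE gamma (fun x => x * f' x) e.
Proof.
move=> df cf' fa ef'.
have cf : continuous f.
  by move=> x; apply: differentiable_continuous; apply/derivable1_diffP; case: (df x).
have ef := exp_growth_bounded fa.
have hf := hasE_exp_growth (continuous_measurable_fun cf) ef.
have hxf' : hasE gamma (fun x => x * f' x) (\int[gamma]_x (x * f' x)).
  apply: hasE_exp_growth.
    by apply: measurable_funM => //; exact: continuous_measurable_fun.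
  by apply: exp_growthM => //; exact: exp_growth_id.
have [|||| e [h1 h2]] := @normal_integration_by_parts
    (fun x => x * f x) (fun x => f x + x * f' x).
- move=> x; have := is_deriveM (is_derive_id x 1) (df x).
  by move=> h; apply: is_derive_eq; rewrite /GRing.scale /=; ring.
- move=> x; apply: cvgD; first exact: cf.
  by apply: cvgM; [exact: cvg_id|exact: cf'].
- by apply: exp_growthM => //; exact: exp_growth_id.
- apply: exp_growthD => //.
  by apply: exp_growthM => //; exact: exp_growth_id.
have eE := hasE_unique h2 (hasED hf hxf').
exists (\int[gamma]_x (x * f' x)); split => //.
rewrite (_ : \int[gamma]_x _ = e - (\int[gamma]_x f x)); last by rewrite eE addrC addKr.
have := hasEB h1 hf.
by under eq_fun do rewrite mulrA -expr2 -[X in _ - X]mul1r -mulrBl.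
Qed.

End standard_normal.

(** * Independence *)

Definition mkRV d (T : measurableType d) (R : realType) (P : probability T R)
  (f : T -> R) (mf : measurable_fun setT f) : {RV P >-> R} :=
  HB.pack f (isMeasurableFun.Build _ _ _ _ f mf).

Definition mkRV2 d (T : measurableType d) (R : realType) (P : probability T R)
  (f : T -> R * R) (mf : measurable_fun setT f) : {RV P >-> (R * R)%type} :=
  HB.pack f (isMeasurableFun.Build _ _ _ _ f mf).

Section independence.
Context d (T : measurableType d) (R : realType) (P : probability T R).
Variables (I : finType) (J : I -> {RV P >-> R}).
Hypothesis J_indep : mutually_independent P J.
Implicit Types (s : seq I) (E : {set I}) (V : {RV P >-> R}) (B : I -> set R).

Let cyl E B : set T := \bigcap_(i in [set` E]) (J i @^-1` B i).

(** [V] behaves as a random variable built from the [J i], [i] in [s]: it is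
    independent of every event on the remaining variables. *)
Definition indep_outside V s : Prop :=
  forall E B (C : set R), {in E, forall i, i \notin s} ->
    (forall i, measurable (B i)) -> measurable C ->
    P (V @^-1` C `&` cyl E B) = (P (V @^-1` C) * P (cyl E B))%E.

Let mpre V (C : set R) : measurable C -> measurable (V @^-1` C).
Proof. by move=> mC; rewrite -[X in measurable X]setTI; exact: measurable_funPT. Qed.

Let mcyl E B : (forall i, measurable (B i)) -> measurable (cyl E B).
Proof.
move=> mB; apply: fin_bigcap_measurable => // i _; exact: mpre.
Qed.

Let cylU1 E a B : a \notin E -> (forall i, measurable (B i)) ->
  P (cyl (a |: E)%SET B) = (P (J a @^-1` B a) * P (cyl E B))%E.
Proof.
move=> aE mB; by rewrite /cyl !J_indep// big_setU1.
Qed.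

Lemma indep_outside_cst (c : R) s : indep_outside (cst c) s.
Proof.
move=> E B C _ mB mC; rewrite preimage_cst.
by case: ifP => _; rewrite ?setTI ?probability_setT ?mul1e// set0I measure0 mul0e.
Qed.

Lemma measurable_joint V a : measurable_fun setT (fun w => (V w, J a w)).
Proof. exact: measurable_fun_pair. Qed.

Definition joint V a : {RV P >-> (R * R)%type} := mkRV2 P (measurable_joint V a).

(** Once normalised by the probability of the cylinder, both sides are measures in
    [S]; they agree on rectangles because [J a] can be moved into the cylinder. *)
Lemma joint_cyl V s a : indep_outside V s -> a \notin s ->
  forall E B (S : set (R * R)), {in E, forall i, i \notin a :: s} ->
  (forall i, measurable (B i)) -> measurable S ->
  P (joint V a @^-1` S `&` cyl E B) =
  ((distribution P V \x distribution P (J a)) S * P (cyl E B))%E.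
Proof.
move=> Vs as_ E B S Es mB mS.
have [c0|c0] := eqVneq (P (cyl E B)) 0%E.
  rewrite c0 mule0; apply/eqP; rewrite eq_le measure_ge0 andbT -c0.
  apply: le_measure => //; rewrite ?inE; [|exact: mcyl].
  apply: measurableI; last exact: mcyl.
  by rewrite -[X in measurable X]setTI; apply: measurable_joint.
have fc : P (cyl E B) \is a fin_num by exact: fin_num_measure (mcyl _ mB).
set c := fine (P (cyl E B)).
have c_gt0 : 0 < c by rewrite fine_gt0// lt0e c0 measure_ge0 ltey_eq fc.
have ci : 0 <= c^-1 by rewrite invr_ge0 ltW.
have mj : measurable_fun setT (joint V a) by exact: measurable_joint.
have [m' m'E] : exists m' : {measure set (R * R) -> \bar R}, forall A,
    m' A = (c^-1%:E * P (joint V a @^-1` A `&` cyl E B))%E.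
  pose m1 := measure_function_pushforward__canonical__measure_function_Measure
    (mrestr P (mcyl E mB)) mj.
  by exists (mscale (NngNum ci) m1).
have -> : ((distribution P V \x distribution P (J a)) S = m' S)%E.
  have uniq_ := @product_measure_unique _ _ _ _ R (distribution P V)
    (distribution P (J a)) m'.
  apply: uniq_ => // A C mA mC.
  rewrite m'E.
  pose B' i := if i == a then C else B i.
  have mB' i : measurable (B' i) by rewrite /B'; case: ifP.
  have aE : a \notin E by apply/negP => /Es; rewrite inE eqxx.
  have -> : (fun w => (V w, J a w)) @^-1` (A `*` C) `&` cyl E B =
      V @^-1` A `&` cyl (a |: E)%SET B'.
    apply/seteqP; split=> w.
    - move=> [[/= VA JC] cw]; split => // i /=; rewrite !inE => /orP[/eqP ->|iE].
        by rewrite /B' eqxx.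
      rewrite /B'; case: eqP => [ia|_]; first by rewrite -ia iE in aE.
      exact: cw.
    - move=> [/= VA cw]; split; first split => //=.
        by have := cw a; rewrite /B' /= eqxx !inE eqxx => /(_ isT).
      move=> i /= iE; have := cw i; rewrite /= !inE iE orbT => /(_ isT).
      by rewrite /B'; case: eqP => // ia; rewrite -ia iE in aE.
  rewrite Vs//; last first.
    by move=> i; rewrite !inE => /orP[/eqP ->//|/Es]; rewrite inE negb_or => /andP[].
  rewrite cylU1// /B' eqxx.
  have -> : cyl E B' = cyl E B.
    apply: eq_bigcapr => i /= iE; rewrite /B'; case: (eqVneq i a) => // ia.
    by rewrite -ia iE in aE.
  rewrite (muleA (P (V @^-1` A))) muleCA -(fineK fc) -/c -EFinM.
  by rewrite mulVf ?gt_eqF// mule1.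
rewrite m'E -(fineK fc) -/c muleAC -EFinM.
by rewrite mulVf ?gt_eqF// mul1e.
Qed.

Lemma joint_law V s a : indep_outside V s -> a \notin s ->
  forall S, measurable S ->
  distribution P (joint V a) S = (distribution P V \x distribution P (J a))%E S.
Proof.
move=> Vs as_ S mS.
have cyl0 : cyl (finset.set0 : {set I}) (fun=> setT) = setT.
  by apply/seteqP; split=> // w _ i; rewrite /= inE.
have := joint_cyl Vs as_ (E := finset.set0) (B := fun=> setT) _ _ mS.
rewrite cyl0 setIT probability_setT mule1; apply => //.
by move=> i; rewrite finset.in_set0.
Qed.

Lemma indep_outside_step V s a (F : R * R -> R) (V' : {RV P >-> R}) :
  indep_outside V s -> a \notin s -> measurable_fun setT F ->
  (forall w, V' w = F (V w, J a w)) -> indep_outside V' (a :: s).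
Proof.
move=> Vs as_ mF V'E E B C Es mB mC.
have mS : measurable (F @^-1` C) by rewrite -[X in measurable X]setTI; exact: mF.
have -> : V' @^-1` C = joint V a @^-1` (F @^-1` C).
  by apply/seteqP; split=> w /=; rewrite V'E.
rewrite (joint_cyl Vs)//; congr (_ * _)%E.
by rewrite -(joint_law Vs as_).
Qed.

Section fold.
Variables (op : R -> R -> R) (idx : R) (f : I -> R -> R).
Hypothesis mop : measurable_fun setT (fun z : R * R => op z.1 z.2).
Hypothesis mf : forall i, measurable_fun setT (f i).

Lemma measurable_fold s :
  measurable_fun setT (fun w => \big[op/idx]_(i <- s) f i (J i w)).
Proof.
elim: s => [|a s IH]; first by under eq_fun do rewrite big_nil; exact: measurable_cst.
under eq_fun do rewrite big_cons.
apply: (measurableT_comp mop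
  (g := fun w => (f a (J a w), \big[op/idx]_(i <- s) f i (J i w)))).
by apply: measurable_fun_pair => //; exact: measurableT_comp.
Qed.

Definition fold_rv s : {RV P >-> R} := mkRV P (measurable_fold s).

Lemma indep_outside_fold s : uniq s -> indep_outside (fold_rv s) s.
Proof.
elim: s => [_|a s IH /= /andP[as_ us]].
  move=> E B C Es mB mC.
  rewrite (_ : fold_rv [::] @^-1` C = cst idx @^-1` C).
    exact: (indep_outside_cst idx Es mB mC).
  by apply/seteqP; split=> w /=; rewrite big_nil.
apply: (indep_outside_step (F := fun z => op (f a z.2) z.1) (IH us) as_).
  apply: (measurableT_comp mop (g := fun z : R * R => (f a z.2, z.1))).
  apply: measurable_fun_pair; last exact: measurable_fst.
  by apply: measurableT_comp => //; exact: measurable_snd.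
by move=> w; rewrite /= big_cons.
Qed.

End fold.

Lemma ge0_integral_joint V s a (F : R * R -> R) : indep_outside V s -> a \notin s ->
  measurable_fun setT F -> (forall z, 0 <= F z) ->
  (\int[P]_w (F (V w, J a w))%:E =
   \int[P]_w \int[P]_w' (F (V w, J a w'))%:E)%E.
Proof.
move=> Vs as_ mF F0.
have mEF : measurable_fun setT (EFin \o F) by exact/measurable_EFinP.
transitivity (\int[distribution P (joint V a)]_z (F z)%:E)%E.
  by rewrite ge0_integral_distribution// => z; rewrite lee_fin.
rewrite (eq_measure_integral (distribution P V \x distribution P (J a))%E); last first.
  by move=> A mA _; exact: joint_law Vs as_ _ mA.
rewrite fubini_tonelli1//.
rewrite ge0_integral_distribution; last 2 first.
- apply: measurable_fun_fubini_tonelli_F => // z; by rewrite lee_fin.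
- by move=> x; apply: integral_ge0 => y _; rewrite lee_fin.
apply: eq_integral => w _ /=.
rewrite /fubini_F ge0_integral_distribution//; last by move=> y; rewrite lee_fin.
by apply/measurable_EFinP; exact: measurable_fun_pair2.
Qed.

Lemma hasE_prod (f : I -> R -> R) (e : I -> R) s : uniq s ->
  (forall i, measurable_fun setT (f i)) -> (forall i x, 0 <= f i x) ->
  (forall i, hasE P (fun w => f i (J i w)) (e i)) ->
  hasE P (fun w => \prod_(i <- s) f i (J i w)) (\prod_(i <- s) e i).
Proof.
move=> us mf f0 fe.
have mop : measurable_fun setT (fun z : R * R => z.1 * z.2).
  exact: measurable_funM.
elim: s us => [_|a s IH /= /andP[as_ us]].
  by rewrite big_nil; under eq_fun do rewrite big_nil; exact: hasE_cst.
have e0 i : 0 <= e i by apply: (hasE_le (hasE0 P) (fe i)).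
apply: hasE_ge0.
- exact: measurable_fold mop mf _.
- by move=> w; apply: prodr_ge0.
- pose V := fold_rv 1 mop mf s.
  have VE w : V w = \prod_(i <- s) f i (J i w) by [].
  have V0 w : 0 <= V w by rewrite VE; apply: prodr_ge0.
  transitivity (\int[P]_w (`|V w| * f a (J a w))%:E)%E.
    by apply: eq_integral => w _; rewrite big_cons -VE ger0_norm// mulrC.
  rewrite (ge0_integral_joint (F := fun z => `|z.1| * f a z.2)
    (indep_outside_fold 1 mop mf us) as_); last 2 first.
  + apply: measurable_funM; first exact: measurableT_comp.
    by apply: measurableT_comp => //; exact: measurable_snd.
  + by move=> z; rewrite mulr_ge0.
  have [_ IHe] := IH us; rewrite big_cons mulrC EFinM -IHe.
  rewrite muleC -ge0_integralZl//; last 3 first.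
  + by apply/measurable_EFinP; exact: measurable_fold mop mf _.
  + by move=> w _; rewrite lee_fin prodr_ge0.
  + by rewrite lee_fin.
  apply: eq_integral => w _.
  by rewrite (hasEZ `|V w| (fe a)).2 (ger0_norm (V0 w)) mulrC EFinM.
Qed.

(** Fubini in the form needed for an integration by parts with respect to a
    single coordinate. *)
Lemma hasE_joint V s a (g1 g2 : R * R -> R) (k : R -> R) b :
  indep_outside V s -> a \notin s ->
  measurable_fun setT g1 -> measurable_fun setT g2 -> measurable_fun setT k ->
  (forall z, `|g1 z| <= k z.2) -> (forall z, `|g2 z| <= k z.2) ->
  hasE P (fun w => k (J a w)) b ->
  (forall v, exists e, hasE P (fun w => g1 (v, J a w)) e /\
                       hasE P (fun w => g2 (v, J a w)) e) ->
  exists e, hasE P (fun w => g1 (V w, J a w)) e /\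
            hasE P (fun w => g2 (V w, J a w)) e.
Proof.
move=> Vs as_ mg1 mg2 mk g1k g2k hk H.
pose L := (distribution P V \x distribution P (J a))%E.
have main (g : R * R -> R) : measurable_fun setT g -> (forall z, `|g z| <= k z.2) ->
    hasE P (fun w => g (V w, J a w)) (\int[P]_w g (V w, J a w)) /\
    (\int[P]_w (g (V w, J a w))%:E =
     \int[distribution P V]_v \int[P]_w (g (v, J a w))%:E)%E.
  move=> mg gk.
  have mgV : measurable_fun setT (fun w => g (V w, J a w)).
    exact: (measurableT_comp mg (measurable_joint V a)).
  have hg := hasE_dominated mgV hk (fun w => gk (V w, J a w)).
  split => //.
  have mEg : measurable_fun setT (EFin \o g) by exact/measurable_EFinP.
  have ig : (distribution P (joint V a)).-integrable setT (EFin \o g).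
    by apply: integrable_pushforward => //; case: hg.
  transitivity (\int[distribution P (joint V a)]_z (g z)%:E)%E.
    by rewrite integral_distribution//; case: hg.
  have eqL A : measurable A -> A `<=` setT -> distribution P (joint V a) A = L A.
    by move=> mA _; exact: joint_law Vs as_ _ mA.
  have iL : L.-integrable setT (EFin \o g).
    apply/integrableP; split => //.
    rewrite -(@eq_measure_integral _ _ _ _ L (distribution P (joint V a)))//.
    by case/integrableP : ig.
  rewrite (eq_measure_integral L)// -integral12_prod_meas1//.
  apply: eq_integral => v _; rewrite /fubini_F integral_distribution//.
  - apply/measurable_EFinP; exact: measurable_fun_pair2.
  - case: (hasE_dominated _ hk (fun w => gk (v, J a w))) => //.
    exact: (measurableT_comp (measurable_fun_pair2 v mg)).
have [h1 e1] := main _ mg1 g1k; have [h2 e2] := main _ mg2 g2k.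
exists (\int[P]_w g1 (V w, J a w)); split => //.
rewrite (_ : \int[P]_w _ = \int[P]_w g2 (V w, J a w))//.
rewrite /Rintegral e1 e2; congr fine; apply: eq_integral => v _.
by have [e [[_ ->] [_ ->]]] := H v.
Qed.

End independence.

(** * Families of independent standard normal variables *)

Section gaussian_family.
Context d (T : measurableType d) (R : realType) (P : probability T R).

Lemma hasE_law (X : {RV P >-> R}) (nu : probability (measurableTypeR R) R)
    (f : R -> R) e : has_law P X nu -> measurable_fun setT f ->
  hasE nu f e -> hasE P (fun w => f (X w)) e.
Proof.
move=> XJ mf [fi fe].
have mfX : measurable_fun setT (fun w => f (X w)) by exact: measurableT_comp.
(* [measurableTypeR R] and [R] carry the same measurable sets under two names. *)
pose X0 : T -> measurableTypeR R := X.
have mX0 : measurable_fun setT X0 by exact: measurable_funPT X.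
pose X' : {mfun T >-> measurableTypeR R} :=
  HB.pack X0 (isMeasurableFun.Build _ _ _ _ X0 mX0).
have eqnu (g : R -> \bar R) :
    (\int[distribution P X']_x g x = \int[nu]_x g x)%E.
  by apply: eq_measure_integral => A mA _; exact: XJ.
have mEf : measurable_fun setT (EFin \o f) by exact/measurable_EFinP.
have i1 : P.-integrable setT (EFin \o (fun w => f (X w))).
  apply/integrableP; split; first exact/measurable_EFinP.
  rewrite (_ : integral _ _ _ = \int[distribution P X']_x `|(f x)%:E|)%E.
    by rewrite eqnu; case/integrableP : fi.
  rewrite ge0_integral_distribution//.
  exact: measurableT_comp.
split => //.
by rewrite -fe -eqnu integral_distribution.
Qed.

Variables (I : finType) (J : I -> {RV P >-> R}).
Hypothesis J_indep : mutually_independent P J.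
Hypothesis J_law : forall i, has_law P (J i) (gaussian 0 1).

Lemma hasE_gauss f e i : measurable_fun setT f ->
  hasE (normal_prob (0 : R) 1) f e -> hasE P (fun w => f (J i w)) e.
Proof.
move=> mf fe; apply: hasE_law (J_law i) mf _.
by rewrite /gaussian sqrtr1.
Qed.

Lemma hasE_chi2_cov i j :
  hasE P (fun w => (J i w ^+ 2 - 1) * (J j w ^+ 2 - 1)) (if i == j then 2 else 0).
Proof.
have m2 k : measurable_fun setT (fun x : R => x ^+ k) by exact: measurable_funX.
have h2 k := hasE_gauss k (m2 2%N) (@hasE_normal_sqr R).
have h1 := hasE_cst P (1 : R).
have [<-|ij] := eqVneq i j.
  have h4 := hasE_gauss i (m2 4%N) (@hasE_normal_pow4 R).
  have := hasED (hasED h4 (hasEZ (-2) (h2 i))) h1.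
  by move/hasE_eq; apply=> [w|]; ring.
have hij : hasE P (fun w => J i w ^+ 2 * J j w ^+ 2) 1.
  have u : uniq [:: i; j] by rewrite /= inE ij.
  have := hasE_prod J_indep u (fun k => m2 2%N) (fun k x => sqr_ge0 x) h2.
  rewrite !big_cons big_nil !mulr1.
  by under eq_fun do rewrite !big_cons big_nil mulr1.
have := hasED (hasEB (hasEB hij (h2 i)) (h2 j)) h1.
by move/hasE_eq; apply=> [w|]; ring.
Qed.

Lemma hasE_chi2_sqr :
  hasE P (fun w => (\sum_i (J i w ^+ 2 - 1)) ^+ 2) (2 * #|I|%:R).
Proof.
under eq_fun do rewrite expr2 mulr_suml.
under eq_fun do under eq_bigr do rewrite mulr_sumr.
have -> : 2 * #|I|%:R = \sum_(i : I) \sum_j (if i == j then 2 else 0 : R); last first.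
  by apply: hasE_sum => i _; apply: hasE_sum => j _; exact: hasE_chi2_cov.
transitivity (\sum_(i : I) (2 : R)); first by rewrite sumr_const mulr_natr.
apply: eq_bigr => i _; rewrite (bigD1 i)//= eqxx big1 ?addr0// => j.
by rewrite eq_sym => /negPf ->.
Qed.

Lemma hasE_expR_sum (c : I -> R) :
  hasE P (fun w => expR (\sum_i c i * J i w)) (expR (\sum_i c i ^+ 2 / 2)).
Proof.
under eq_fun do rewrite expR_sum.
rewrite expR_sum.
have := @hasE_prod _ _ _ P I J J_indep (fun i x => expR (c i * x))
  (fun i => expR (c i ^+ 2 / 2)) (index_enum I) (index_enum_uniq I).
have m1 i : measurable_fun setT (fun x : R => expR (c i * x)).
  by apply: measurableT_comp => //; exact: measurable_funM.
apply => //.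
by move=> i; apply: (hasE_gauss (f := fun x => expR (c i * x)));
  [exact: m1|exact: hasE_normal_expR].
Qed.

(** Second derivative, in one direction, of the joint moment generating function. *)
Lemma hasE_expR_sum_sqr (c : I -> R) a :
  hasE P (fun w => expR (\sum_i c i * J i w) * J a w ^+ 2)
    (expR (\sum_i c i ^+ 2 / 2) * (1 + c a ^+ 2)).
Proof.
pose f i x := (if i == a then x ^+ 2 else 1) * expR (c i * x).
pose e i := (if i == a then 1 + c a ^+ 2 else 1) * expR (c i ^+ 2 / 2).
have m1 i : measurable_fun setT (fun x : R => expR (c i * x)).
  by apply: measurableT_comp => //; exact: measurable_funM.
have m2 i : measurable_fun setT (fun x : R => if i == a then x ^+ 2 else 1 : R).
  by case: eqP => // _; exact: measurable_funX.
have mf i : measurable_fun setT (f i) by exact: measurable_funM.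
have fe i : hasE P (fun w => f i (J i w)) (e i).
  apply: (hasE_gauss (f := f i)) => //; rewrite /f /e.
    exact: mf.
  case: eqP => [->|_]; first exact: hasE_normal_sqr_expR.
  by under eq_fun do rewrite mul1r; rewrite mul1r; exact: hasE_normal_expR.
have f0 i x : 0 <= f i x.
  by rewrite /f mulr_ge0 ?expR_ge0//; case: ifP => // _; exact: sqr_ge0.
have := hasE_prod J_indep (index_enum_uniq I) mf f0 fe.
have prodif (u : R) : \prod_i (if i == a then u else 1) = u.
  by rewrite (bigD1 a)//= eqxx big1 ?mulr1// => i /negPf ->.
have prodJ w : \prod_i (if i == a then J i w ^+ 2 else 1) = J a w ^+ 2.
  by rewrite (bigD1 a)//= eqxx big1 ?mulr1// => i /negPf ->.
move/hasE_eq; apply => [w|].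
  by rewrite big_split /= prodJ -expR_sum mulrC.
by rewrite big_split /= prodif -expR_sum mulrC.
Qed.

End gaussian_family.

(** * Stein's equation for the normal law *)

Section stein_equation.
Variables (R : realType) (s : R) (f : R -> R) (M : R).
Hypothesis s_gt0 : 0 < s.
Hypothesis cf : continuous f.
Hypothesis f_le : forall x, `|f x| <= M.
Local Notation mu := (@lebesgue_measure R).
Local Notation pdf := (normal_pdf (0 : R) s).
Let s_neq0 : s != 0. Proof. by rewrite gt_eqF. Qed.

Let pdf_gt0 x : 0 < pdf x.
Proof. by rewrite normal_pdfE// mulr_gt0 ?normal_peak_gt0 ?expR_gt0. Qed.

Let pdfE x : pdf x = normal_peak s * expR (- (s ^- 2 / 2) * x ^+ 2).
Proof.
rewrite normal_pdfE// /normal_fun; congr (_ * expR _).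
by rewrite subr0 -mulr_natr; field.
Qed.

Let cpdf : continuous pdf. Proof. exact: continuous_normal_pdf. Qed.

Let dpdf (x : R) : is_derive x 1 pdf (- (x / s ^+ 2) * pdf x).
Proof.
have -> : pdf = (fun x => normal_peak s * expR (- (s ^- 2 / 2) * x ^+ 2)).
  by apply/funext => y; exact: pdfE.
have h : is_derive x 1 (fun y : R => - (s ^- 2 / 2) * y ^+ 2) (- (x / s ^+ 2)).
  by apply: is_derive_eq; rewrite /GRing.scale /=; field.
have he : is_derive x 1 (fun y : R => expR (- (s ^- 2 / 2) * y ^+ 2))
    (expR (- (s ^- 2 / 2) * x ^+ 2) * - (x / s ^+ 2)).
  exact: (is_derive1_comp (f := expR)).
have := is_deriveM (is_derive_cst (normal_peak s) x 1) he.
by move=> h2; apply: is_derive_eq; rewrite /GRing.scale /=; ring.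
Qed.

Let mean : R := \int[normal_prob 0 s]_x f x.
Let ft x : R := f x - mean.
Let k x : R := ft x * pdf x.

Let mf : measurable_fun setT f. Proof. exact: continuous_measurable_fun. Qed.

Let hf : hasE (normal_prob (0 : R) s) f mean.
Proof. exact: (@hasE_dominated _ _ _ (normal_prob (0 : R) s) f _ M mf (hasE_cst _ M) f_le). Qed.

Let mean_le : `|mean| <= M.
Proof.
rewrite ler_norml; apply/andP; split.
- apply: hasE_le (hasE_cst (normal_prob (0 : R) s) (- M)) hf _ => x.
  by have := f_le x; rewrite ler_norml => /andP[].
- apply: hasE_le hf (hasE_cst _ M) _ => x; exact: le_trans (ler_norm _) (f_le x).
Qed.

Let ft_le x : `|ft x| <= M + M.
Proof. by rewrite (le_trans (ler_normB _ _))// lerD. Qed.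

Let cft : continuous ft.
Proof. by move=> x; apply: cvgB; [exact: cf|exact: cvg_cst]. Qed.

Let ck : continuous k.
Proof. by move=> x; apply: cvgM; [exact: cft|exact: cpdf]. Qed.

Let hk : hasE mu k 0.
Proof.
have := hasEB hf (hasE_cst (normal_prob (0 : R) s) mean).
rewrite subrr => /(hasE_normalP 0 s); apply.
by apply: measurable_funB.
Qed.

Let hpdf : hasE mu pdf 1.
Proof. by split; [exact: integrable_normal_pdf|exact: integral_normal_pdf]. Qed.

Let ik (A : set R) : measurable A -> mu.-integrable A (EFin \o k).
Proof. by move=> mA; apply: integrableS (proj1 hk) => //. Qed.

Let ipdf (A : set R) : measurable A -> mu.-integrable A (EFin \o pdf).
Proof. by move=> mA; apply: integrableS (proj1 hpdf) => //. Qed.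

Let I (x : R) : R := \int[mu]_(t in `]-oo, x]) k t.

Let dI (x : R) : is_derive x 1 I (k x).
Proof.
have xu : x < x + 1 by rewrite ltrDl.
have [] := @continuous_FTC1 R k -oo%O x (x + 1) xu.
- exact: ik.
- by rewrite ltNyr.
- exact: ck.
- by move=> dI_ I'; apply: DeriveDef; [exact: dI_|rewrite -derive1E; exact: I'].
Qed.

Let h (x : R) : R := s ^- 2 * (pdf x)^-1 * I x.
Let h' (x : R) : R := s ^- 2 * (x * h x + ft x).

Let dh (x : R) : is_derive x 1 h (h' x).
Proof.
have dV : is_derive x 1 (fun y => (pdf y)^-1) (- (pdf x) ^- 2 *: (- (x / s ^+ 2) * pdf x)).
  by apply: is_deriveV; try exact: dpdf; rewrite gt_eqF.
have := is_deriveM (is_deriveM (is_derive_cst (s ^- 2) x 1) dV) (dI x).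
move=> H; apply: is_derive_eq; rewrite /h' /h /k /GRing.scale /= !fctE /=.
by field; rewrite s_neq0 gt_eqF.
Qed.

Let ch : continuous h.
Proof.
by move=> x; apply: differentiable_continuous; apply/derivable1_diffP; case: (dh x).
Qed.

Let ch' : continuous h'.
Proof.
move=> x; apply: cvgM; first exact: cvg_cst.
apply: cvgD; last exact: cft.
by apply: cvgM; [exact: cvg_id|exact: ch].
Qed.

Let M2_ge0 : 0 <= M + M. Proof. exact: le_trans (ft_le 0). Qed.

Let cvg_pdf : pdf x @[x --> +oo] --> 0.
Proof.
have -> : pdf = (fun x => normal_peak s * (gauss_fun \o (fun x => x / (s * Num.sqrt 2))) x).
  apply/funext => x; rewrite pdfE; congr (_ * expR _).
  by rewrite /= expr_div_n exprMn sqr_sqrtr//; field.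
rewrite -[X in _ --> X](mulr0 (normal_peak s)).
apply: cvgM; first exact: cvg_cst.
apply: (cvg_comp (fun x : R => x / (s * Num.sqrt 2)) gauss_fun);
  last exact: cvg_gauss_fun.
apply: gt0_cvgMly; last exact: cvg_id.
by rewrite invr_gt0 mulr_gt0 ?sqrtr_gt0.
Qed.

(** Mills' ratio: beyond [x] the weight [t / x] is at least one, and
    [t * pdf t] has the explicit antiderivative [- s ^+ 2 * pdf t]. *)
Let tail_le x : 0 < x -> x * (\int[mu]_(t in `[x, +oo[) pdf t) <= s ^+ 2 * pdf x.
Proof.
move=> x0.
have FTC : (\int[mu]_(t in `[x, +oo[) (t * pdf t)%:E = (0 - - s ^+ 2 * pdf x)%:E)%E.
  rewrite EFinB; apply: (ge0_continuous_FTC2y (F := fun t => - s ^+ 2 * pdf t)).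
  - by move=> t xt; rewrite mulr_ge0 ?(ltW (pdf_gt0 _))// (le_trans (ltW x0)).
  - apply: continuous_subspaceT => t; apply: cvgM; [exact: cvg_id|exact: cpdf].
  - by rewrite -[X in _ --> X](mulr0 (- s ^+ 2)); apply: cvgM;
      [exact: cvg_cst|exact: cvg_pdf].
  - by move=> t _; apply: derivableM => //; case: (dpdf t).
  - apply: cvgM; first exact: cvg_cst.
    by apply: cvg_at_right_filter; exact: cpdf.
  - move=> t _; rewrite derive1E.
    have := is_deriveM (is_derive_cst (- s ^+ 2) t 1) (dpdf t).
    by case=> _ ->; rewrite /GRing.scale /=; field.
rewrite -lee_fin EFinM.
have fi : (\int[mu]_(t in `[x, +oo[) pdf t)%:E =
          (\int[mu]_(t in `[x, +oo[) (pdf t)%:E)%E.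
  by rewrite fineK//; apply: integrable_fin_num => //; exact: ipdf.
rewrite fi -ge0_integralZl//; last 3 first.
- by apply: measurable_funTS; apply/measurable_EFinP; exact: measurable_normal_pdf.
- by move=> t _; rewrite lee_fin ltW.
- by rewrite lee_fin ltW.
rewrite (_ : s ^+ 2 * pdf x = 0 - - s ^+ 2 * pdf x); last by ring.
rewrite -FTC; apply: ge0_le_integral => //.
- by move=> t _; rewrite mule_ge0// lee_fin ltW.
- apply: measurable_funTS; apply: measurable_funeM.
  by apply/measurable_EFinP; exact: measurable_normal_pdf.
- apply: measurable_funTS; apply/measurable_EFinP.
  by apply: measurable_funM => //; exact: measurable_normal_pdf.
- move=> t; rewrite /= in_itv/= andbT => xt.
  by rewrite -EFinM lee_fin ler_wpM2r// ltW.
Qed.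

Let I_tail x : I x = - \int[mu]_(t in `]x, +oo[) k t.
Proof.
apply/eqP; rewrite -addr_eq0 -Rintegral_setU//; last 2 first.
- by apply: ik; exact: measurableU.
- apply/disj_setPS => t /=; rewrite !in_itv/= andbT => -[tx xt].
  by have := lt_le_trans xt tx; rewrite ltxx.
rewrite -itv_bndbnd_setU//.
have [_ k0] := hk.
by rewrite set_itvNyy /Rintegral k0.
Qed.

Let int_le (A : set R) : measurable A ->
  `|\int[mu]_(t in A) k t| <= (M + M) * \int[mu]_(t in A) pdf t.
Proof.
move=> mA; apply: le_trans (le_normr_Rintegral _ _) _ => //; first exact: ik.
rewrite -RintegralZl//; last exact: ipdf.
apply: le_Rintegral => //.
- exact: (integrable_norm (ik mA)).
- exact: integrableS (proj1 (hasEZ (M + M) hpdf)).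
- move=> t _; rewrite /k normrM (gtr0_norm (pdf_gt0 t)) ler_wpM2r// ltW//.
Qed.

Let pdf_opp x : pdf (- x) = pdf x.
Proof. by rewrite !pdfE sqrrN. Qed.

Let xI_le x : `|x * I x| <= (M + M) * s ^+ 2 * pdf x.
Proof.
have [x0|x0|x0] := ltgtP 0 x.
- rewrite I_tail normrM normrN gtr0_norm// -mulrA.
  apply: le_trans (ler_wpM2l (ltW x0) (int_le _)) _ => //.
  rewrite mulrCA ler_wpM2l// Rintegral_itv_obnd_cbnd ?tail_le//.
  exact: ipdf.
- rewrite normrM ltr0_norm// -mulrA.
  apply: le_trans (ler_wpM2l _ (int_le _)) _ => //; first by rewrite oppr_ge0 ltW.
  rewrite mulrCA ler_wpM2l//.
  have -> : \int[mu]_(t in `]-oo, x]) pdf t = \int[mu]_(t in `[- x, +oo[) pdf t.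
    rewrite /Rintegral; congr fine; rewrite -[in LHS](opprK x).
    rewrite ge0_integration_by_substitutionNy; last 2 first.
    + exact: continuous_subspaceT.
    + by move=> t _; rewrite ltW.
    by apply: eq_integral => t _; rewrite /= pdf_opp.
  by rewrite -(pdf_opp x) tail_le// oppr_gt0.
- by rewrite -x0 mul0r normr0 !mulr_ge0 ?sqr_ge0// ltW.
Qed.

Let xh_le x : `|x * h x| <= M + M.
Proof.
have p0 : 0 < s ^+ 2 * pdf x by rewrite mulr_gt0// exprn_gt0.
rewrite (_ : x * h x = (x * I x) / (s ^+ 2 * pdf x)); last first.
  by rewrite /h; field; rewrite s_neq0 gt_eqF.
by rewrite normrM normfV (gtr0_norm p0) ler_pdivrMr// [leRHS]mulrA; exact: xI_le.
Qed.

(** The solution is the integral of [f] minus its mean against the density, up to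
    [x], divided by [s ^+ 2] times the density at [x]. As the total integral vanishes,
    it is also an integral over the tail beyond [x], and Mills' ratio bounds
    [x * h x]; the equation then bounds [h']. *)
Lemma stein_solution : exists h h' : R -> R, exists K, [/\
  forall x : R, is_derive x 1 h (h' x), continuous h',
  forall x, `|h x| <= K, forall x, `|h' x| <= K &
  forall x, s ^+ 2 * h' x - x * h x = f x - \int[normal_prob 0 s]_x f x].
Proof.
have [K1 hK1] : exists K1 : R, forall x : R, `|x| <= 1 -> `|h x| <= K1.
  have [c _ hc] : exists2 c, c \in `[(-1 : R), 1]%R &
      forall t, t \in `[(-1 : R), 1]%R -> `|h t| <= `|h c|.
    apply: EVT_max; first by rewrite (@le_trans _ _ 0)// oppr_le0.
    apply: continuous_subspaceT => t.
    by apply: (cvg_comp h Num.norm); [exact: ch|exact: norm_continuous].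
  by exists `|h c| => x x1; apply: hc; rewrite in_itv/= -ler_norml.
pose K : R := Num.max (Num.max K1 (M + M)) (s ^- 2 * (M + M + (M + M))).
exists h, h', K; split; [exact: dh|exact: ch'| | |].
- move=> x; rewrite /K !le_max.
  case: (leP `|x| 1) => [/hK1 ->//|x1]; apply/orP; left; apply/orP; right.
  apply: le_trans _ (xh_le x).
  by rewrite [leRHS]normrM; exact: ler_peMl (normr_ge0 _) (ltW x1).
- move=> x; rewrite /K !le_max; apply/orP; right.
  rewrite /h' normrM ger0_norm ?invr_ge0 ?sqr_ge0// ler_wpM2l ?invr_ge0 ?sqr_ge0//.
  by rewrite (le_trans (ler_normD _ _))// lerD.
- by move=> x; rewrite /h' mulVKf ?expf_neq0// addrAC subrr add0r.
Qed.

End stein_equation.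

(** * Central limit theorem for sums of centred squares *)

Lemma exp_growth_lin (R : realType) (f : R -> R) (K c : R) :
  (forall x, `|f x| <= K) -> exp_growth (fun x => c * x * f x).
Proof.
move=> fK; apply: exp_growthM; last exact: exp_growth_bounded fK.
by apply: exp_growthM; [exact: exp_growth_cst|exact: exp_growth_id].
Qed.

(** The normalised sum [W] of the [J i ^+ 2 - 1] satisfies Stein's equation up to
    the fluctuation of the empirical second moment: integrating by parts in each
    [J i] turns [W * h W] into [s ^+ 2 * h' W] times the mean of the squares. That
    fluctuation has variance [2 / #|I|], and the free parameter [theta] converts its
    absolute value into its square. The constant depends neither on the probability
    space nor on the number of variables. *)
Lemma chi2_stein (R : realType) (s : R) (f : R -> R) (M : R) :
  0 < s -> continuous f -> (forall x, `|f x| <= M) ->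
  exists K : R, forall d (T : measurableType d) (P : probability T R)
    (I : finType) (J : I -> {RV P >-> R}) (theta : R),
    mutually_independent P J -> (forall i, has_law P (J i) (gaussian 0 1)) ->
    (0 < #|I|)%N -> 0 < theta ->
    `|\int[P]_w f (s / Num.sqrt (2 * #|I|%:R) * \sum_i (J i w ^+ 2 - 1))
      - \int[normal_prob 0 s]_x f x| <=
    K * (theta + 2 / (theta * #|I|%:R)).
Proof.
move=> s0 cf fM.
have [h [h' [K [dh ch' hK h'K steinE]]]] := stein_solution s0 cf fM.
set m := \int[normal_prob 0 s]_x f x in steinE *.
have ch : continuous h.
  by move=> x; apply: differentiable_continuous; apply/derivable1_diffP; case: (dh x).
have mh : measurable_fun setT h by exact: continuous_measurable_fun.
have mh' : measurable_fun setT h' by exact: continuous_measurable_fun.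
have mf : measurable_fun setT f by exact: continuous_measurable_fun.
have K0 : 0 <= K by exact: le_trans (hK 0).
exists (s ^+ 2 * K) => d T P I J theta indepJ lawJ I0 theta0.
set n : R := #|I|%:R; have n0 : 0 < n by rewrite ltr0n.
set c := s / Num.sqrt (2 * n).
have c0 : 0 <= c by rewrite divr_ge0 ?sqrtr_ge0// ltW.
have cc : 2 * c * c = s ^+ 2 / n.
  rewrite -mulrA -expr2 expr_div_n sqr_sqrtr ?mulr_ge0// ?ltW//.
  by field; rewrite gt_eqF.
pose W w := c * \sum_i (J i w ^+ 2 - 1).
have mJ2 i : measurable_fun setT (fun w => J i w ^+ 2) by exact: measurable_funX.
have mW : measurable_fun setT W.
  apply: measurable_funM => //; apply: measurable_sum => i.
  by apply: measurable_funB.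
have m2 : measurable_fun setT (fun x : R => x ^+ 2) by exact: measurable_funX.
have cquad v : continuous (fun y : R => v + c * (y ^+ 2 - 1)).
  move=> x; apply: cvgD; first exact: cvg_cst.
  apply: cvgM; first exact: cvg_cst.
  by apply: cvgB; [exact: exprn_continuous|exact: cvg_cst].
have hJ2 i := hasE_gauss lawJ i m2 (@hasE_normal_sqr R).
(* the coordinate [a] is split off from the sum [V] of the others, independent of it *)
have ibp a : exists e, hasE P (fun w => (J a w ^+ 2 - 1) * h (W w)) e /\
    hasE P (fun w => 2 * c * (J a w ^+ 2 * h' (W w))) e.
  pose fa (i : I) (x : R) := c * (x ^+ 2 - 1).
  have mfa i : measurable_fun setT (fa i).
    by apply: measurable_funM => //; exact: measurable_funB.
  have madd : measurable_fun setT (fun z : R * R => z.1 + z.2) by exact: measurable_funD.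
  pose r := [seq i <- index_enum I | i != a].
  have ar : a \notin r by rewrite mem_filter eqxx.
  have ur : uniq r by rewrite filter_uniq// index_enum_uniq.
  pose V := fold_rv J 0 madd mfa r.
  have WE w : W w = V w + c * (J a w ^+ 2 - 1).
    by rewrite /W (bigD1 a)//= big_filter mulrDr addrC mulr_sumr.
  pose u (z : R * R) := z.1 + c * (z.2 ^+ 2 - 1).
  have mu_ : measurable_fun setT u.
    apply: measurable_funD => //; apply: measurable_funM => //.
    by apply: measurable_funB => //; apply: measurable_funX.
  have m22 : measurable_fun setT (fun z : R * R => z.2 ^+ 2).
    by apply: measurable_funX.
  have Vr : indep_outside J V r by exact: indep_outside_fold.
  have hk : hasE P (fun w => K * (1 + 2 * c) * (1 + J a w ^+ 2))
      (K * (1 + 2 * c) * (1 + 1)).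
    by apply: hasEZ; apply: hasED => //; exact: hasE_cst.
  have [||||||e [h1 h2]] := @hasE_joint _ _ _ P I J indepJ V r a
    (fun z => (z.2 ^+ 2 - 1) * h (u z)) (fun z => 2 * c * (z.2 ^+ 2 * h' (u z)))
    (fun x => K * (1 + 2 * c) * (1 + x ^+ 2)) _ Vr ar _ _ _ _ _ hk.
  - by apply: measurable_funM; [exact: measurable_funB|exact: measurableT_comp].
  - apply: measurable_funM => //.
    by apply: measurable_funM => //; exact: measurableT_comp.
  - by apply: measurable_funM => //; exact: measurable_funD.
  - move=> z; rewrite normrM mulrC.
    apply: ler_pM => //.
      by rewrite (le_trans (hK _))// ler_peMr// lerDl mulr_ge0.
    by rewrite (le_trans (ler_normB _ _))// normr1 ger0_norm ?sqr_ge0// addrC.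
  - move=> z; have c2 : 0 <= 2 * c by rewrite mulr_ge0.
    rewrite normrM (ger0_norm c2) normrM (ger0_norm (sqr_ge0 z.2)).
    apply: (@le_trans _ _ (2 * c * (z.2 ^+ 2 * K))).
      by rewrite ler_wpM2l// ler_wpM2l ?sqr_ge0.
    rewrite -subr_ge0 (_ : _ - _ = K * (1 + z.2 ^+ 2 + 2 * c)); last by ring.
    by rewrite mulr_ge0// !addr_ge0 ?sqr_ge0.
  - move=> v.
    pose F x := h (v + c * (x ^+ 2 - 1)).
    pose F' x := 2 * c * x * h' (v + c * (x ^+ 2 - 1)).
    have [||||e [h1 h2]] := @hermite2_integration_by_parts R F F' K.
    + move=> x; rewrite /F /F'.
      have du : is_derive x 1 (fun y : R => v + c * (y ^+ 2 - 1)) (2 * c * x).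
        by apply: is_derive_eq; rewrite /GRing.scale /=; ring.
      by rewrite [X in is_derive _ _ _ X]mulrC; exact: (is_derive1_comp (f := h)).
    + move=> x; apply: cvgM.
        by apply: cvgM; [exact: cvg_cst|exact: cvg_id].
      exact: (cvg_comp _ h' (cquad v x) (ch' _)).
    + by move=> x; exact: hK.
    + by apply: exp_growth_lin => x; exact: h'K.
    exists e; split.
      apply: (hasE_gauss lawJ (f := fun x => (x ^+ 2 - 1) * F x)) => //.
      apply: measurable_funM; first exact: measurable_funB.
      by apply: (measurableT_comp mh); apply: continuous_measurable_fun; exact: cquad.
    have mF' : measurable_fun setT (fun x : R => x * F' x).
      apply: measurable_funM => //; apply: measurable_funM; first exact: measurable_funM.
      by apply: (measurableT_comp mh'); apply: continuous_measurable_fun; exact: cquad.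
    have := hasE_gauss lawJ a mF' h2.
    by move/hasE_eq; apply=> // w; rewrite /F' /u /=; ring.
  exists e; split.
    by move: h1 => /hasE_eq; apply=> // w; rewrite /u WE.
  by move: h2 => /hasE_eq; apply=> // w; rewrite /u WE.
have hfW : hasE P (fun w => f (W w)) (\int[P]_w f (W w)).
  apply: (@hasE_dominated _ _ _ P _ (fun=> M) M) => //; last exact: hasE_cst.
  exact: measurableT_comp.
have hhW : hasE P (fun w => h' (W w)) (\int[P]_w h' (W w)).
  apply: (@hasE_dominated _ _ _ P _ (fun=> K) K) => //; last exact: hasE_cst.
  exact: measurableT_comp.
have [E ibpE] := boolp.choice ibp.
have hD : hasE P (fun w => s ^+ 2 * (h' (W w) * (1 - n^-1 * \sum_i J i w ^+ 2)))
    (\int[P]_w f (W w) - m).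
  have h1 : hasE P (fun w => W w * h (W w)) (\sum_i c * E i).
    have : hasE P (fun w => \sum_i c * ((J i w ^+ 2 - 1) * h (W w))) (\sum_i c * E i).
      by apply: hasE_sum => i _; apply: hasEZ; exact: (ibpE i).1.
    by move/hasE_eq; apply=> // w; rewrite /W -mulrA mulr_suml mulr_sumr.
  have h2 : hasE P (fun w => s ^+ 2 / n * ((\sum_i J i w ^+ 2) * h' (W w)))
      (\sum_i c * E i).
    have : hasE P (fun w => \sum_i c * (2 * c * (J i w ^+ 2 * h' (W w)))) (\sum_i c * E i).
      by apply: hasE_sum => i _; apply: hasEZ; exact: (ibpE i).2.
    move/hasE_eq; apply=> // w; rewrite mulr_suml mulr_sumr.
    by apply: eq_bigr => i _; rewrite -cc; ring.
  have h3 := hasEB (hasEZ (s ^+ 2) hhW) h1.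
  have h4 : hasE P (fun w => s ^+ 2 * h' (W w) - W w * h (W w)) (\int[P]_w f (W w) - m).
    have := hasEB hfW (hasE_cst P m).
    by move/hasE_eq; apply=> // w; rewrite steinE.
  rewrite (hasE_unique h4 h3).
  have := hasEB (hasEZ (s ^+ 2) hhW) h2.
  move/hasE_eq; apply=> // w; ring.
pose D w := 1 - n^-1 * \sum_i J i w ^+ 2.
have DE w : D w = - n^-1 * \sum_i (J i w ^+ 2 - 1).
  rewrite sumrB sumr_const -[X in _ - X]/n /D; field; by rewrite gt_eqF.
have hDD : hasE P (fun w => D w ^+ 2) (2 / n).
  have := hasEZ (n ^- 2) (hasE_chi2_sqr indepJ lawJ).
  by move/hasE_eq; apply=> [w|]; [rewrite DE exprMn sqrrN exprVn|rewrite -/n; field; rewrite gt_eqF].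
have hB : hasE P (fun w => s ^+ 2 * K * (theta + theta^-1 * D w ^+ 2))
    (s ^+ 2 * K * (theta + theta^-1 * (2 / n))).
  by apply: hasEZ; apply: hasED; [exact: hasE_cst|exact: hasEZ].
have bound w : `|s ^+ 2 * (h' (W w) * D w)| <= s ^+ 2 * K * (theta + theta^-1 * D w ^+ 2).
  rewrite normrM ger0_norm ?sqr_ge0// -mulrA ler_wpM2l ?sqr_ge0// normrM ler_pM//.
  have t2 : theta^-1 * (theta - `|D w|) ^+ 2 >= 0.
    by rewrite mulr_ge0 ?sqr_ge0// invr_ge0 ltW.
  have eqn : theta^-1 * (theta - `|D w|) ^+ 2 = theta + theta^-1 * D w ^+ 2 - `|D w| *+ 2.
    by rewrite -(real_normK (num_real (D w))); field; rewrite gt_eqF.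
  have := normr_ge0 (D w); lra.
rewrite (_ : 2 / (theta * n) = theta^-1 * (2 / n)); last first.
  by field; rewrite !gt_eqF.
rewrite ler_norml; apply/andP; split.
- apply: hasE_le (hasEN hB) hD _ => w; rewrite lerNl.
  by have := bound w; rewrite ler_norml => /andP[+ _]; rewrite lerNl.
- apply: hasE_le hD hB _ => w; exact: le_trans (ler_norm _) (bound w).
Qed.

(** * Spin configurations *)

Section spins.
Context {R : realType}.
Variable N : nat.
Implicit Types (s t : config N) (X : {set 'I_N}).
Local Notation spin := (@spin R N).

Lemma spin_sqr t i : spin t i * spin t i = 1.
Proof. by rewrite /Defs.spin; case: (t i); rewrite ?expr1 ?expr0 ?mulrNN ?mulr1. Qed.

Lemma norm_spin t i : `|spin t i| = 1.
Proof. by rewrite /Defs.spin normrX normrN1 expr1n. Qed.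

(** The configuration of pointwise products, whose magnetisation is the overlap. *)
Definition config_mul s t : config N := [ffun i => s i (+) t i].

Lemma spin_mul s t i : spin (config_mul s t) i = spin s i * spin t i.
Proof. by rewrite /Defs.spin ffunE signr_addb. Qed.

Lemma config_mulK s : involutive (config_mul s).
Proof. by move=> t; apply/ffunP => i; rewrite !ffunE addKb. Qed.

Lemma sum_config_mul (V : nmodType) (F : config N -> V) :
  \sum_s \sum_t F (config_mul s t) = (\sum_t F t) *+ 2 ^ N.
Proof.
transitivity (\sum_(s : config N) \sum_t F t); last first.
  by rewrite sumr_const card_ffun card_bool card_ord.
apply: eq_bigr => s _.
by rewrite [RHS](reindex_inj (can_inj (config_mulK s))).
Qed.

Lemma card_config : #|config N| = (2 ^ N)%N.
Proof. by rewrite card_ffun card_bool card_ord. Qed.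

Lemma sum_config_prod (F : 'I_N -> bool -> R) :
  \sum_(t : config N) \prod_i F i (t i) = \prod_i (F i false + F i true).
Proof.
rewrite (eq_bigr (fun i => \sum_(b : bool) F i b)); last first.
  by move=> i _; rewrite big_bool addrC.
by rewrite bigA_distr_bigA.
Qed.

Definition magnetisation t : R := \sum_i spin t i.

Lemma norm_magnetisation_le t : `|magnetisation t| <= N%:R.
Proof.
apply: le_trans (ler_norm_sum _ _ _) _.
by under eq_bigr do rewrite norm_spin; rewrite sumr_const card_ord.
Qed.

Lemma norm_magnetisation_nat t : exists2 k : nat, (k <= N)%N & `|magnetisation t| = k%:R.
Proof.
pose z : int := \sum_i (-1) ^+ t i.
have zE : magnetisation t = z%:~R.
  rewrite /magnetisation /z rmorph_sum /=; apply: eq_bigr => i _.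
  by rewrite rmorphXn /= rmorphN1.
have zn : `|magnetisation t| = (`|z|%N)%:R by rewrite zE -intr_norm natr_absz.
exists `|z|%N => //.
by have := norm_magnetisation_le t; rewrite zn ler_nat.
Qed.

Lemma sum_expR_magnetisation (a : R) :
  \sum_(t : config N) expR (a * magnetisation t) = (expR a + expR (- a)) ^+ N.
Proof.
rewrite (eq_bigr (fun t : config N => \prod_i expR (a * (-1) ^+ t i))).
  rewrite (sum_config_prod (fun i b => expR (a * (-1) ^+ b))).
  by rewrite /= expr0 expr1 mulr1 mulrN1 prodr_const card_ord.
by move=> t _; rewrite /magnetisation mulr_sumr expR_sum.
Qed.

(** ** Multi-indices as subsets *)

Variable p : nat.
Implicit Types A B : multi_index N p.

Definition support A : {set 'I_N} := [set i in (val (val A) : seq 'I_N)]%SET.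

Let uniq_index A : uniq (val (val A) : seq 'I_N).
Proof.
rewrite -(map_inj_uniq val_inj); apply: (sorted_uniq ltn_trans ltnn).
exact: (valP A).
Qed.

Lemma card_support A : #|support A| = p.
Proof.
rewrite /support cardsE (card_uniqP (uniq_index A)).
exact: size_tuple.
Qed.

Lemma support_inj : injective support.
Proof.
move=> A B AB; apply/val_inj/val_inj; apply: (inj_map val_inj).
apply: (irr_sorted_eq ltn_trans ltnn (valP A) (valP B)) => k.
have mem x : (x \in val (val A)) = (x \in val (val B)).
  by have := congr1 (fun X : {set 'I_N} => x \in X) AB; rewrite /= !inE.
by apply/mapP/mapP => -[x xA ->]; exists x => //; rewrite ?mem // -mem.
Qed.

Lemma support_surj X : #|X| = p -> exists A, support A = X.
Proof.
move=> Xp; have sX : size (enum X) == p by rewrite -cardE Xp.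
have sortedX : sorted ltn (map val (Tuple sX)).
  have : sorted ltn (map val (enum 'I_N)) by rewrite val_enum_ord iota_ltn_sorted.
  rewrite /= !sorted_map {1}/(enum _) /= => h; rewrite /enum_mem.
  apply: sorted_filter; first by move=> x y z; exact: ltn_trans.
  exact: h.
exists (Sub (Tuple sX) sortedX); apply/setP => i.
by rewrite !inE /= mem_enum.
Qed.

Lemma card_multi_index : #|multi_index N p| = 'C(N, p).
Proof.
rewrite -[N in 'C(N, p)]card_ord -cardsT -card_draws.
rewrite -(card_imset _ support_inj); apply: eq_card => X; rewrite inE.
apply/imsetP/eqP => [[A _ ->]|/support_surj[A <-]]; first exact: card_support.
by exists A.
Qed.

Lemma spin_prodE t A : spin_prod t A = \prod_(i in support A) spin t i :> R.
Proof.
rewrite /spin_prod -(big_tuple _ _ (val A) xpredT (spin t)).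
rewrite big_uniq ?uniq_index//; apply: eq_bigl => i.
by rewrite inE.
Qed.

Lemma spin_prod_mul s t A : spin_prod (config_mul s t) A = spin_prod s A * spin_prod t A :> R.
Proof.
by rewrite /spin_prod -big_split; apply: eq_bigr => k _; rewrite /= spin_mul.
Qed.

Lemma spin_prod_sqr t A : spin_prod t A * spin_prod t A = 1 :> R.
Proof.
by rewrite /spin_prod -big_split big1// => k _; rewrite /= spin_sqr.
Qed.

(** If [A] and [B] differ, a site in the support of only one of them averages to zero. *)
Lemma sum_spin_prodM A B :
  \sum_(t : config N) spin_prod t A * spin_prod t B = (if A == B then 2 ^+ N else 0 : R).
Proof.
case: eqP => [<-|AB].
  rewrite (eq_bigr (fun=> 1)); last by move=> t _; rewrite spin_prod_sqr.
  by rewrite sumr_const card_config natrX.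
have [i iAB] : exists i, (i \in support A) != (i \in support B).
  apply/existsP; rewrite -negb_forall; apply/negP => /forallP H.
  by apply/AB/support_inj/setP => i; exact/eqP.
pose F j (b : bool) : R := (if j \in support A then (-1) ^+ b else 1) *
                           (if j \in support B then (-1) ^+ b else 1).
rewrite (eq_bigr (fun t : config N => \prod_j F j (t j))); last first.
  by move=> t _; rewrite !spin_prodE big_mkcond [X in _ * X]big_mkcond -big_split.
rewrite sum_config_prod (bigD1 i)//= /F.
by move: iAB; do 2 case: ifP => _; rewrite // expr1 expr0 ?mulr1 ?mul1r subrr mul0r.
Qed.

Lemma sum_spin_prod A : (0 < p)%N -> \sum_(t : config N) spin_prod t A = 0 :> R.
Proof.
move=> p0.
have [i iA] : exists i, i \in support A.
  by apply/set0Pn; rewrite -card_gt0 card_support.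
pose F j (b : bool) : R := if j \in support A then (-1) ^+ b else 1.
rewrite (eq_bigr (fun t : config N => \prod_j F j (t j))); last first.
  by move=> t _; rewrite spin_prodE big_mkcond.
by rewrite sum_config_prod (bigD1 i)//= /F iA expr0 expr1 subrr mul0r.
Qed.

End spins.

(** ** Elementary symmetric functions of a configuration *)

Section elementary_symmetric.
Context {R : realType}.
Variable N : nat.
Implicit Types (t : config N) (k : nat).
Local Notation spin := (@spin R N).
Local Notation S t := (@magnetisation R N t).

Let genfun t (r : seq 'I_N) : {poly R} := \prod_(i <- r) (1 + spin t i *: 'X).

(** Defined through the generating function, whose differential equation yields
    Newton's identities. *)
Definition elem_sym t k : R := (genfun t (index_enum _))`_k.

Lemma elem_symE t p : elem_sym t p = \sum_(A : multi_index N p) spin_prod t A.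
Proof.
rewrite /elem_sym /genfun.
rewrite (eq_bigr (fun i => spin t i *: 'X + 1)); last by move=> i _; rewrite addrC.
rewrite bigA_distr coef_sum.
rewrite (eq_bigr (fun X : {set 'I_N} => if #|X| == p then \prod_(i in X) spin t i else 0)).
  rewrite -big_mkcond /=.
  rewrite (eq_bigl [in @support N p @: [set: multi_index N p]%SET]); last first.
    move=> X /=; apply/eqP/imsetP => [/support_surj[A <-]|[A _ ->]].
      by exists A => //; rewrite finset.in_setT.
    exact: card_support.
  rewrite big_imset /=; last by move=> A B _ _; exact: support_inj.
  by rewrite (eq_bigl xpredT) => [|A]; [apply: eq_bigr => A _; rewrite spin_prodE|rewrite inE].
move=> X _.
rewrite (bigID [in X]) /= (eq_bigr (fun i => spin t i *: 'X)); last by move=> i ->.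
rewrite [X in _ * X]big1 ?mulr1; last by move=> i /negPf ->.
rewrite scaler_prod prodr_const coefZ coefXn eq_sym.
by case: eqP => _; rewrite ?mulr1 ?mulr0.
Qed.

Let deriv_genfun t r : (genfun t r)^`() * (1 - 'X^2) =
  ((\sum_(i <- r) spin t i)%:P - (size r)%:R%:P * 'X) * genfun t r.
Proof.
elim: r => [|i r IH]; first by rewrite /genfun !big_nil derivC !mul0r subrr mul0r.
rewrite /genfun !big_cons -/(genfun t r) derivM derivD derivC derivZ derivX add0r.
have s2 : (spin t i)%:P * (spin t i)%:P = 1 :> {poly R} by rewrite -polyCM spin_sqr.
rewrite /= -natr1 !polyCD polyC1 -!mul_polyC.
move: IH; set A := (spin t i)%:P; set L := (\sum_(_ <- _) _)%:P; set G := genfun t r.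
set n := (_)%:P => IH.
apply/eqP; rewrite -subr_eq0; apply/eqP.
transitivity ((1 - A * A) * 'X * G + (1 + A * 'X) * (G^`() * (1 - 'X^2) - (L - n * 'X) * G)).
  by ring.
by rewrite IH s2 !subrr !mul0r mulr0 addr0.
Qed.

Lemma elem_sym0 t : elem_sym t 0 = 1.
Proof.
rewrite /elem_sym /genfun -horner_coef0 horner_prod big1// => i _.
by rewrite hornerD hornerZ hornerX mulr0 addr0 hornerC.
Qed.

Let elem_sym_rec0 t k : k.+1%:R * elem_sym t k.+1 =
  S t * elem_sym t k - (if k is k'.+1 then (N%:R - k'%:R) * elem_sym t k' else 0).
Proof.
have := congr1 (fun q : {poly R} => q`_k) (deriv_genfun t (index_enum _)).
rewrite -/(S t) mulrBr mulr1 coefB coefMXn !coef_deriv.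
have -> : size (index_enum 'I_N) = N.
  by rewrite -[RHS](card_ord N) cardT enumT.
rewrite mulrBl coefB coefCM -mulrA coefCM [_ * genfun _ _]mulrC coefMX.
rewrite -/(elem_sym t k) -/(elem_sym t k.+1) -(mulr_natl (elem_sym t k.+1)).
case: k => [|k] /=; first by rewrite subr0 mulr0 !subr0.
rewrite -/(elem_sym t k) subSS; case: k => [|k] /=; first by rewrite !subr0.
rewrite subSS subn0 -/(elem_sym t k.+1) -(mulr_natl (elem_sym t k.+1)) => /eqP.
by rewrite subr_eq => /eqP ->; ring.
Qed.

Lemma elem_sym1 t : elem_sym t 1 = S t.
Proof. by have := elem_sym_rec0 t 0; rewrite elem_sym0 mul1r mulr1 subr0. Qed.

(** Since the squares of the spins are all equal to one, Newton's identities reduce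
    to a two-term recursion. *)
Lemma elem_sym_rec t k :
  k.+2%:R * elem_sym t k.+2 = S t * elem_sym t k.+1 - (N%:R - k%:R) * elem_sym t k.
Proof. exact: elem_sym_rec0. Qed.

(** By induction along [elem_sym_rec]: both terms on its right-hand side are at most
    [M ^+ k.+2]. *)
Lemma norm_elem_sym_le t k (M : R) : 0 <= M -> `|S t| <= M -> N%:R <= M ^+ 2 ->
  (k <= N)%N -> `|elem_sym t k| <= M ^+ k.
Proof.
move=> M0 SM NM.
suff H : forall k, ((k <= N)%N -> `|elem_sym t k| <= M ^+ k) /\
                   ((k.+1 <= N)%N -> `|elem_sym t k.+1| <= M ^+ k.+1).
  exact: (H k).1.
elim=> [|{}k [IH0 IH1]].
  by rewrite elem_sym0 elem_sym1 normr1 expr0 expr1; split => // _.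
split => // kN; rewrite -(ler_pM2l (ltr0Sn R k.+1)).
rewrite -{1}(normr_nat R k.+2) -normrM.
rewrite elem_sym_rec.
have kN1 : (k.+1 <= N)%N by exact: ltnW.
have kN0 : (k <= N)%N by exact: ltnW.
apply: le_trans (ler_normB _ _) _; rewrite !normrM.
apply: (@le_trans _ _ (M * M ^+ k.+1 + M ^+ 2 * M ^+ k)).
  apply: lerD; first by rewrite ler_pM// IH1.
  apply: ler_pM => //; last exact: IH0.
  by rewrite ger0_norm ?subr_ge0 ?ler_nat// (le_trans _ NM)// gerBl.
rewrite -!exprS -exprD add2n -mulr2n -[in leLHS]mulr_natl.
by rewrite ler_wpM2r ?exprn_ge0// ler_nat.
Qed.

End elementary_symmetric.

(** To leading order in [N], the elementary symmetric function is the power of the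
    magnetisation, as if the factors were drawn with replacement. *)
Lemma elem_sym_magnetisation {R : realType} k : exists2 K : R, 0 <= K &
  forall N (t : config N), (k <= N)%N ->
  N%:R * `|k`!%:R * elem_sym t k - magnetisation t ^+ k| <= K * N%:R ^+ k.
Proof.
suff [K [K' [K0 K0' H]]] : exists K K' : R, [/\ 0 <= K, 0 <= K' &
    forall N (t : config N),
    ((k <= N)%N -> N%:R * `|k`!%:R * elem_sym t k - magnetisation t ^+ k| <= K * N%:R ^+ k) /\
    ((k.+1 <= N)%N ->
      N%:R * `|(k.+1)`!%:R * elem_sym t k.+1 - magnetisation t ^+ k.+1| <= K' * N%:R ^+ k.+1)].
  by exists K => // N t; exact: (H N t).1.
elim: k => [|k [K [K' [K0 K0' H]]]].
  exists 0, 0; split => // N t; rewrite elem_sym0 elem_sym1 expr0 expr1 !mulr1 !mul1r !subrr.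
  by rewrite normr0 mulr0 !mul0r.
exists K', (K' + k.+1%:R * (1 + K)); split => //.
  by rewrite addr_ge0// mulr_ge0// addr_ge0.
move=> N t; have [H0 H1] := H N t; split => // kN.
have {}H0 := H0 (ltnW (ltnW kN)); have {}H1 := H1 (ltnW kN).
have N0 : 0 < N%:R :> R by rewrite ltr0n (leq_trans _ kN).
have SN := norm_magnetisation_le (R := R) t.
have N1 : 1 <= N%:R :> R by rewrite ler1n (leq_trans _ kN).
set a0 := k`!%:R * elem_sym t k in H0 *; set a1 := (k.+1)`!%:R * elem_sym t k.+1 in H1 *.
have -> : (k.+2)`!%:R * elem_sym t k.+2 - magnetisation t ^+ k.+2 =
    magnetisation t * (a1 - magnetisation t ^+ k.+1) - k.+1%:R * (N%:R - k%:R) * a0.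
  rewrite factS natrM mulrAC elem_sym_rec /a1 /a0 factS natrM exprS; ring.
have a0_le : `|a0| <= (1 + K) * N%:R ^+ k.
  have {}H0 : `|a0 - magnetisation t ^+ k| <= K * N%:R ^+ k.
    by apply: le_trans H0; rewrite ler_peMl.
  rewrite -(subrK (magnetisation t ^+ k) a0) (le_trans (ler_normD _ _))// mulrDl mul1r addrC lerD//.
  by rewrite normrX lerXn2r ?nnegrE.
have Nk : 0 <= N%:R - k%:R :> R by rewrite subr_ge0 ler_nat (leq_trans _ kN)// ltnW.
apply: le_trans (ler_wpM2l (ltW N0) (ler_normB _ _)) _.
rewrite mulrDr [leRHS]mulrDl; apply: lerD.
  rewrite normrM (mulrCA N%:R) [in leRHS]exprS (mulrCA K').
  by apply: ler_pM => //; rewrite mulr_ge0.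
rewrite normrM ger0_norm ?mulr_ge0//.
apply: (@le_trans _ _ (N%:R * (k.+1%:R * N%:R * ((1 + K) * N%:R ^+ k)))).
  rewrite ler_wpM2l//; apply: ler_pM => //; first by rewrite mulr_ge0.
  by rewrite ler_wpM2l// gerBl.
by rewrite !exprS le_eqVlt; apply/orP; left; apply/eqP; ring.
Qed.

(** * Exponential moments of the magnetisation *)

Section magnetisation_moments.
Context {R : realType}.
Local Notation S t := (@magnetisation R _ t).

Lemma expR_le_inv (y : R) : y < 1 -> expR y <= (1 - y)^-1.
Proof.
move=> y1; rewrite -[y in leLHS]opprK expRN lef_pV2 ?posrE ?expR_gt0 ?subr_gt0//.
exact: expR_ge1Dx.
Qed.

Lemma cosh_le_gauss (y : R) : expR y + expR (- y) <= 2 * expR (2 * y ^+ 2).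
Proof.
have [y2|y2] := leP (y ^+ 2) (2^-1).
  have y1 : -1 < y < 1.
    rewrite -ltr_norml -(@ltr_pXn2r _ 2)// ?nnegrE// real_normK ?num_real//.
    by rewrite expr1n (le_lt_trans y2)// invf_lt1// ltr1n.
  case/andP: y1 => yN1 y1.
  apply: (@le_trans _ _ (2 * (1 - y ^+ 2)^-1)).
    apply: le_trans (lerD (expR_le_inv y1) (expR_le_inv (y := - y) _)) _.
      by rewrite ltrNl.
    rewrite opprK le_eqVlt; apply/orP; left; apply/eqP.
    have h1 : 1 - y != 0 by rewrite subr_eq0 gt_eqF.
    have h2 : 1 + y != 0 by rewrite addrC -(opprK 1) subr_eq0 gt_eqF.
    have h3 : 1 - y ^+ 2 != 0 by rewrite (_ : _ - _ = (1 - y) * (1 + y)) ?mulf_neq0//; ring.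
    by field; rewrite h1 h2 h3.
  rewrite ler_pM2l//; apply: le_trans (expR_ge1Dx _).
  have h : 0 < 1 - y ^+ 2 by rewrite subr_gt0 (le_lt_trans y2)// invf_lt1// ltr1n.
  rewrite -[leLHS]mul1r ler_pdivrMr//.
  have := sqr_ge0 y; nra.
have y_le : `|y| <= 2 * y ^+ 2.
  rewrite -(real_normK (num_real y)).
  have n0 := normr_ge0 y.
  have : 2^-1 < `|y| ^+ 2 by rewrite real_normK ?num_real.
  nra.
rewrite mulr_natl mulr2n; apply: lerD; rewrite ler_expR (le_trans _ y_le)//.
  exact: ler_norm.
by rewrite -normrN ler_norm.
Qed.

Definition config_cons n (b : bool) (t : config n) : config n.+1 :=
  [ffun i => if unlift ord0 i is Some j then t j else b].

Lemma sum_config_cons n (F : config n.+1 -> R) :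
  \sum_t F t = \sum_(t : config n) (F (config_cons false t) + F (config_cons true t)).
Proof.
rewrite (reindex (fun bt : bool * config n => config_cons bt.1 bt.2)) /=; last first.
  exists (fun t : config n.+1 => (t ord0, [ffun j => t (lift ord0 j)])).
    move=> [b t] _ /=; congr pair; first by rewrite ffunE unlift_none.
    by apply/ffunP => j; rewrite !ffunE liftK.
  move=> t _; apply/ffunP => i; rewrite ffunE /=.
  by case: unliftP => [j ->|->] //; rewrite ffunE.
transitivity (\sum_(b : bool) \sum_(t : config n) F (config_cons b t)).
  by rewrite pair_bigA.
by rewrite big_bool /= addrC big_split.
Qed.

Lemma magnetisation_cons n b (t : config n) :
  S (config_cons b t) = (-1) ^+ b + S t.
Proof.
rewrite /magnetisation big_ord_recl; congr (_ + _).
  by rewrite /spin ffunE unlift_none.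
by apply: eq_bigr => j _; rewrite /spin ffunE liftK.
Qed.

(** Averaging over one spin replaces the weight [a] of the square by at most
    [a + 8 * a ^+ 2 <= a / (1 - 8 * a)], that is, lowers [a^-1] by eight; hence the weight
    [a / (1 - 8 * n * a)] after [n] spins. *)
Let sum_expR_sqr_shift n (a x : R) : 0 <= a -> 8 * n%:R * a < 1 ->
  \sum_(t : config n) expR (a * (x + S t) ^+ 2) <=
  2 ^+ n * expR (n%:R * a / (1 - 8 * n%:R * a)) * expR (a / (1 - 8 * n%:R * a) * x ^+ 2).
Proof.
elim: n x => [|n IH] x a0 na.
  rewrite (big_pred1 ([ffun i : 'I_0 => false] : config 0)); last first.
    by move=> t; apply/esym/eqP/ffunP => -[].
  rewrite /magnetisation big_ord0 addr0 expr0 !mul0r mulr0 mul0r expR0 !mul1r.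
  by rewrite subr0 invr1 mulr1.
have na' : 8 * n%:R * a < 1.
  by apply: le_lt_trans na; rewrite ler_wpM2r// ler_wpM2l// ler_nat.
have d0 : 0 < 1 - 8 * n%:R * a by rewrite subr_gt0.
have d1 : 0 < 1 - 8 * n.+1%:R * a by rewrite subr_gt0.
set b := a / (1 - 8 * n%:R * a).
have b0 : 0 <= b by rewrite divr_ge0// ltW.
rewrite sum_config_cons.
rewrite (eq_bigr (fun t => expR (a * ((x + 1) + S t) ^+ 2) + expR (a * ((x - 1) + S t) ^+ 2))); last first.
  by move=> t _; rewrite !magnetisation_cons expr0 expr1 !addrA.
rewrite big_split /=.
apply: le_trans (lerD (IH (x + 1) a0 na') (IH (x - 1) a0 na')) _.
set b' := a / (1 - 8 * n.+1%:R * a).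
have b_le : b + 8 * b ^+ 2 <= b'.
  rewrite -subr_ge0 (_ : _ - _ =
      64 * a ^+ 3 / ((1 - 8 * n%:R * a) ^+ 2 * (1 - 8 * n.+1%:R * a))); last first.
    have e1 : 1 - 8 * n.+1%:R * a = (1 - 8 * n%:R * a) - 8 * a by rewrite -natr1; ring.
    have d1' := d1; rewrite /b /b' e1 in d1' *; move: d0 d1'.
    by set D := 1 - _ => d0 d1'; field; rewrite !gt_eqF.
  by rewrite divr_ge0// ?mulr_ge0 ?exprn_ge0// ltW.
have -> : n%:R * a / (1 - 8 * n%:R * a) = n%:R * b by rewrite /b mulrA.
have -> : n.+1%:R * a / (1 - 8 * n.+1%:R * a) = n.+1%:R * b' by rewrite /b' mulrA.
have -> : a / (1 - 8 * n%:R * a) = b by [].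
clearbody b b'; rewrite -mulrDr (exprSr 2 n) -!mulrA ler_wpM2l ?exprn_ge0//.
have -> : expR (b * (x + 1) ^+ 2) + expR (b * (x - 1) ^+ 2) =
    expR (b * x ^+ 2 + b) * (expR (2 * b * x) + expR (- (2 * b * x))).
  by rewrite mulrDr -!expRD; congr (expR _ + expR _); ring.
apply: (@le_trans _ _ (expR (n%:R * b) * (expR (b * x ^+ 2 + b) *
    (2 * expR (2 * (2 * b * x) ^+ 2))))).
  by do 2 (rewrite ler_wpM2l ?expR_ge0//); exact: cosh_le_gauss.
rewrite (_ : _ * (_ * (2 * _)) = 2 * (expR (n%:R * b) * (expR (b * x ^+ 2 + b) *
  expR (2 * (2 * b * x) ^+ 2)))); last by ring.
rewrite ler_wpM2l// -!expRD ler_expR.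
have b2 := sqr_ge0 b; have x2 := sqr_ge0 x.
have bb' : b <= b' by lra.
rewrite (_ : n%:R * b + _ = n.+1%:R * b + (b + 8 * b ^+ 2) * x ^+ 2); last first.
  by rewrite -natr1; ring.
by apply: lerD; [rewrite ler_wpM2l|rewrite ler_wpM2r].
Qed.

Lemma sum_expR_sqr_magnetisation N : (0 < N)%N ->
  \sum_(t : config N) expR (S t ^+ 2 / (16 * N%:R)) <= 2 ^+ N * expR (8^-1).
Proof.
move=> N0; have N0' : N%:R != 0 :> R by rewrite pnatr_eq0 -lt0n.
have := @sum_expR_sqr_shift N (16 * N%:R)^-1 0.
have -> : 8 * N%:R * (16 * N%:R)^-1 = 2^-1 :> R by field.
have -> : N%:R * (16 * N%:R)^-1 / (1 - 2^-1) = 8^-1 :> R by field.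
rewrite expr0n mulr0 expR0 mulr1 invr_ge0 mulr_ge0// invf_lt1// ltr1n => /(_ isT isT).
by under eq_bigr do rewrite add0r mulrC.
Qed.

End magnetisation_moments.

(** * Large deviations of the magnetisation *)

Section large_deviations.
Context {R : realType}.
Local Notation S t := (@magnetisation R _ t).
Local Notation phi := (@phi R).
Local Notation ch a := ((expR a + expR (- a)) / 2).

Let ch_gt0 (a : R) : 0 < ch a.
Proof. by rewrite divr_gt0// addr_gt0 ?expR_gt0. Qed.

Definition artanh (x : R) : R := (ln (1 + x) - ln (1 - x)) / 2.

(** [phi] is the Legendre transform of the logarithm of [cosh]; the optimal
    parameter is the inverse hyperbolic tangent of [x]. *)
Lemma phi_legendre (x : R) : 0 < x -> x < 1 ->
  0 <= artanh x /\ expR (phi x) * ch (artanh x) = expR (artanh x * x).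
Proof.
move=> x0 x1; set a := artanh x.
have p1 : 0 < 1 + x by rewrite addr_gt0.
have m1 : 0 < 1 - x by rewrite subr_gt0.
split.
  rewrite /a divr_ge0// subr_ge0 ler_ln ?posrE//.
  by rewrite lerD2l (le_trans _ (ltW x0))// oppr_le0 ltW.
have chE : ch a = expR (- a - ln (1 - x)).
  rewrite expRD [expR (- ln _)]expRN lnK ?posrE//.
  have -> : expR a + expR (- a) = expR (- a) * (expR (a + a) + 1).
    by rewrite mulrDr mulr1 -expRD; congr (expR _ + _); ring.
  have -> : expR (a + a) = (1 + x) / (1 - x).
    rewrite (_ : a + a = ln (1 + x) - ln (1 - x)); last by rewrite /a /artanh; field.
    by rewrite expRB !lnK ?posrE.
  by field; rewrite gt_eqF.
by rewrite chE -expRD; congr expR; rewrite /a /artanh /Defs.phi; field.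
Qed.

(** For each of the [N.+1] possible values [j] of the absolute magnetisation, the
    exponential weights of parameter [artanh (k * j / N)], normalised by the power of
    [cosh], have total mass [2 * 2 ^+ N], and by [phi_legendre] they dominate the summand at
    the configurations with that value. The factor [k < 1] keeps the argument of
    [artanh] away from one. *)
Lemma sum_expR_phi N (k : R) : 0 < k -> k < 1 ->
  \sum_(t : config N | 0 < `|S t|) expR (N%:R * phi (k * `|S t| / N%:R)) <=
  2 ^+ N * (2 * N.+1%:R).
Proof.
move=> k0 k1.
have [N0|N0] := posnP N.
  rewrite big1 ?mulr_ge0 ?exprn_ge0// => t.
  have := norm_magnetisation_le (R := R) t; subst N.
  by rewrite normr_le0 => /eqP ->; rewrite normr0 ltxx.
have NR : 0 < N%:R :> R by rewrite ltr0n.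
pose x (j : nat) := k * j%:R / N%:R.
pose a j := artanh (x j).
have aP j : (0 < j <= N)%N ->
    0 <= a j /\ expR (phi (x j)) * ch (a j) = expR (a j * x j).
  move=> /andP[j0 jN].
  have x0 : 0 < x j by rewrite divr_gt0// mulr_gt0// ltr0n.
  have x1 : x j < 1.
    rewrite ltr_pdivrMr// mul1r (lt_le_trans (y := j%:R))// ?ler_nat//.
    by rewrite gtr_pMl// ltr0n.
  exact: phi_legendre.
pose L j (t : config N) := (expR (a j * S t) + expR (- a j * S t)) / ch (a j) ^+ N.
have L0 j t : 0 <= L j t.
  by rewrite divr_ge0 ?exprn_ge0 ?addr_ge0 ?expR_ge0// ltW.
have sumL j : \sum_t L j t = 2 ^+ N * 2.
  rewrite -mulr_suml big_split /= !sum_expR_magnetisation opprK.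
  have c0 := ch_gt0 (a j); rewrite (addrC (expR (- a j))).
  rewrite expr_div_n; field.
  by rewrite !expf_neq0// gt_eqF// addr_gt0 ?expR_gt0.
apply: (@le_trans _ _ (\sum_t \sum_(j < N.+1) L j t)); last first.
  rewrite exchange_big /= (eq_bigr (fun=> 2 ^+ N * 2)) => [|j _]; last exact: sumL.
  by rewrite sumr_const card_ord -[leLHS]mulr_natr mulrA.
apply: (@le_trans _ _ (\sum_(t : config N | 0 < `|S t|) \sum_(j < N.+1) L j t)); last first.
  rewrite [leRHS](bigID (fun t : config N => 0 < `|S t|)) /= lerDl.
  by apply: sumr_ge0 => t _; apply: sumr_ge0 => j _; exact: L0.
apply: ler_sum => t St0.
have [j jN Sj] := norm_magnetisation_nat (R := R) t.
rewrite Sj; have j0 : (0 < j)%N by rewrite -(ltr0n R) -Sj.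
have [a0 aE] : 0 <= a j /\ expR (phi (x j)) * ch (a j) = expR (a j * x j).
  by apply: aP; rewrite j0.
rewrite (bigD1 (Ordinal (jN : (j < N.+1)%N)))//=.
apply: (@le_trans _ _ (L j t)); last by rewrite lerDl; apply: sumr_ge0.
rewrite /L ler_pdivlMr ?exprn_gt0//.
rewrite -/(x j) expRM_natl -exprMn aE -expRM_natl.
rewrite (_ : N%:R * (a j * x j) = k * (a j * j%:R)); last first.
  by rewrite /x; field; rewrite gt_eqF.
apply: (@le_trans _ _ (expR (a j * `|S t|))).
  rewrite ler_expR Sj -[leRHS]mul1r; apply: ler_wpM2r; last exact: ltW.
  by rewrite mulr_ge0.
have [s0|s0] := leP 0 (S t).
  by rewrite ger0_norm// lerDl expR_ge0.
by rewrite ltr0_norm// mulrN mulNr lerDr expR_ge0.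
Qed.

End large_deviations.

(** * Elementary estimates *)

Section elementary_estimates.
Context {R : realType}.
Implicit Types x y : R.

Let ndecr0 (f f' : R -> R) :
  (forall x : R, is_derive x 1 f (f' x)) -> (forall x, 0 <= x -> 0 <= f' x) ->
  forall x, 0 <= x -> f 0 <= f x.
Proof.
move=> df f'0 x x0; have [->//|xn0] := eqVneq x 0.
have xp : 0 < x by rewrite lt_neqAle eq_sym xn0.
have cf : {within `[0, x], continuous f}.
  apply: continuous_subspaceT => y; apply: differentiable_continuous.
  by apply/derivable1_diffP; case: (df y).
have [c] := MVT xp (fun y _ => df y) cf.
rewrite in_itv/= => /andP[c0 _] /eqP; rewrite subr_eq => /eqP ->.
by rewrite lerDr mulr_ge0 ?subr0// f'0// ltW.
Qed.

Let expR_le1 x : expR x <= 1 + x * expR x.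
Proof.
have := expR_ge1Dx (- x); rewrite expRN => h.
have e := expR_gt0 x.
have : (1 - x) * expR x <= 1 by rewrite -[leRHS](@mulVf _ (expR x)) ?gt_eqF// ler_wpM2r// ltW.
by rewrite mulrBl mul1r lerBlDr.
Qed.

Let expR_le2 x : 0 <= x -> expR x <= 1 + x + x ^+ 2 * expR x.
Proof.
move=> x0; rewrite -subr_ge0.
pose f y : R := 1 + y + y ^+ 2 * expR y - expR y.
have := @ndecr0 f (fun y => 1 + 2 * y * expR y + y ^+ 2 * expR y - expR y) _ _ x x0.
have -> : f 0 = 0 by rewrite /f expR0 expr0n mul0r !addr0 subrr.
apply.
- by move=> y; apply: is_derive_eq; rewrite /GRing.scale /=; ring.
- move=> y y0; rewrite subr_ge0 (le_trans (expR_le1 y))// -addrA lerD2l.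
  have e0 := expR_ge0 y; rewrite -subr_ge0.
  rewrite (_ : _ - _ = y * expR y + y ^+ 2 * expR y); last by ring.
  by rewrite addr_ge0// mulr_ge0// exprn_ge0.
Qed.

Lemma expR_taylor2 x : expR x <= 1 + x + x ^+ 2 / 2 + `|x| ^+ 3 * expR `|x|.
Proof.
have [x0|x0] := leP 0 x.
  rewrite ger0_norm// -subr_ge0.
  pose f y : R := 1 + y + y ^+ 2 / 2 + y ^+ 3 * expR y - expR y.
  have := @ndecr0 f (fun y => 1 + y + 3 * y ^+ 2 * expR y + y ^+ 3 * expR y - expR y) _ _ x x0.
  have -> : f 0 = 0 by rewrite /f expR0 !expr0n !mul0r !addr0 subrr.
  apply.
  - by move=> y; apply: is_derive_eq; rewrite /GRing.scale /=; field.
  - move=> y y0; rewrite subr_ge0 (le_trans (expR_le2 y0))// -subr_ge0.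
    rewrite (_ : _ - _ = 2 * y ^+ 2 * expR y + y ^+ 3 * expR y); last by ring.
    by rewrite addr_ge0// !mulr_ge0 ?expR_ge0 ?exprn_ge0.
apply: (@le_trans _ _ (1 + x + x ^+ 2 / 2)); last first.
  by rewrite lerDl mulr_ge0 ?expR_ge0 ?exprn_ge0.
rewrite -subr_ge0.
pose f y : R := 1 - y + y ^+ 2 / 2 - expR (- y).
have y0 : 0 <= - x by rewrite oppr_ge0 ltW.
have := @ndecr0 f (fun y => - 1 + y + expR (- y)) _ _ (- x) y0.
have -> : f 0 = 0 by rewrite /f oppr0 expR0 expr0n mul0r !addr0 subrr.
rewrite /f !opprK sqrrN; apply.
- move=> y.
  have de : is_derive y 1 (fun z : R => expR (- z)) (expR (- y) * - 1).
    exact: (is_derive1_comp (f := expR)).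
  have dp : is_derive y 1 (fun z : R => 1 - z + z ^+ 2 / 2) (- 1 + y).
    by apply: is_derive_eq; rewrite /GRing.scale /=; field.
  have := is_deriveB dp de.
  by move=> h; apply: is_derive_eq; ring.
- by move=> y _; have := expR_ge1Dx (- y); lra.
Qed.

Lemma exprn_le_expR n x : 0 <= x -> x ^+ n <= n`!%:R * expR x.
Proof.
move=> x0; elim: n x x0 => [|n IH] x x0.
  by rewrite expr0 mul1r -expR0 ler_expR.
rewrite -subr_ge0.
pose f y : R := (n.+1)`!%:R * expR y - y ^+ n.+1.
have := @ndecr0 f (fun y => (n.+1)`!%:R * expR y - n.+1%:R * y ^+ n) _ _ x x0.
have -> : f 0 = (n.+1)`!%:R by rewrite /f expR0 expr0n mulr1 subr0.
move=> h; apply: le_trans (h _ _).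
- by rewrite ler0n.
- move=> y.
  have dX : is_derive y 1 (fun z : R => z ^+ n.+1) (n.+1%:R * y ^+ n).
    have := is_deriveX n.+1 (is_derive_id y (1 : R)).
    rewrite /GRing.scale /= mulr1 (_ : id ^+ n.+1 = (fun z : R => z ^+ n.+1))//.
    by apply/funext => z; rewrite exprfctE.
  have dE : is_derive y 1 (fun z : R => (n.+1)`!%:R * expR z) ((n.+1)`!%:R * expR y).
    by apply: is_derive_eq; rewrite /GRing.scale /=; ring.
  exact: is_deriveB dE dX.
- by move=> y y0; rewrite factS natrM -mulrA subr_ge0 ler_wpM2l// IH.
Qed.

Lemma cvg_ffact p : (N%:R ^+ p / (N ^_ p)%:R : R) @[N --> \oo] --> (1 : R).
Proof.
elim: p => [|p IH].
  under eq_fun do rewrite expr0 ffactn0 divr1; exact: cvg_cst.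
have h : (N%:R / (N - p)%N%:R : R) @[N --> \oo] --> (1 : R).
  rewrite -(cvg_shiftn p).
  have -> : (fun n => (n + p)%:R / (n + p - p)%N%:R : R) =
            (fun n => (n + p)%:R / n%:R : R).
    by apply/funext => n; rewrite addnK.
  have : (1 + p%:R * n%:R^-1 : R) @[n --> \oo] --> (1 + p%:R * 0 : R).
    apply: cvgD; first exact: cvg_cst.
    by apply: cvgM; [exact: cvg_cst|rewrite -cvg_shiftS; exact: cvg_harmonic].
  rewrite mulr0 addr0; apply: cvg_trans; apply: near_eq_cvg; near=> n.
  have n0 : (0 < n)%N by near: n; exact: nbhs_infty_gt.
  by rewrite /= natrD mulrDl divff ?pnatr_eq0 -?lt0n.
have H : (N%:R ^+ p / (N ^_ p)%:R * (N%:R / (N - p)%N%:R) : R) @[N --> \oo] --> (1 * 1 : R).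
  exact: cvgM IH h.
rewrite mulr1 in H; apply: cvg_trans H; apply: near_eq_cvg; near=> n.
by rewrite exprSr ffactnSr natrM /= mulrACA -invfM.
Unshelve. all: by end_near.
Qed.

(** Below [critical_beta], the energy gain [beta ^+ 2 * x ^+ p / (1 + x ^+ p)] of
    a pair with overlap [x] stays below its entropic cost [phi x], with room to
    replace [beta ^+ 2] by a larger constant. *)
Lemma critical_beta_lt p (beta : R) : 0 < beta -> beta < critical_beta p ->
  exists2 b2 : R, beta ^+ 2 < b2 &
    forall x, 0 < x -> x < 1 -> b2 * (x ^+ p / (1 + x ^+ p)) <= phi x.
Proof.
rewrite /critical_beta; set E := [set _ | _ in _] => beta0 beta_lt.
have infE : beta ^+ 2 < inf E.
  have i0 : 0 < inf E by rewrite -sqrtr_gt0 (lt_trans beta0).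
  by rewrite -(@sqr_sqrtr _ (inf E)) ?(ltW i0)// ltr_pXn2r// nnegrE ltW// (lt_trans beta0).
exists (inf E) => // x x0 x1.
have x_p : 0 < x ^+ p by rewrite exprn_gt0.
have lbE : has_lbound E.
  apply: contrapT => nlb; have : inf E = 0.
    rewrite /inf sup_out ?oppr0// => -[_ [M hM]]; apply: nlb; exists (- M) => y Ey.
    by rewrite lerNl; apply: hM; exists y.
  by move=> i0; move: infE; rewrite i0 ltNge sqr_ge0.
have : inf E <= (1 + x ^- p) * phi x.
  by apply: inf_lbound => //; exists x => //=; rewrite in_itv/= x0 x1.
move=> h; rewrite -(ler_pM2r (x := (1 + x ^- p))); last first.
  by rewrite addr_gt0// invr_gt0.
rewrite [leRHS]mulrC (_ : _ * _ = inf E)//.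
by field; rewrite !gt_eqF// addr_gt0.
Qed.

End elementary_estimates.

(** * The truncated second moment *)

Section overlap.
Context {R : realType}.
Variables (p : nat) (beta : R).
Hypothesis hp : (3 <= p)%N.
Hypothesis beta0 : 0 < beta.
Local Notation S t := (@magnetisation R _ t).
Local Notation phi := (@phi R).
Local Notation binom N := ('C(N, p)%:R : R).

(** Covariance of the field at two configurations with pointwise product [t]. *)
Definition cov N (t : config N) : R := elem_sym t p / binom N.

Lemma sum_cov N : (p <= N)%N -> \sum_(t : config N) cov t = 0.
Proof.
move=> pN; rewrite -mulr_suml; under eq_bigr do rewrite elem_symE.
rewrite exchange_big /= big1 ?mul0r// => A _.
by rewrite sum_spin_prod// (leq_trans _ hp).
Qed.

Lemma sum_cov_sqr N : (p <= N)%N -> \sum_(t : config N) cov t ^+ 2 = 2 ^+ N / binom N.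
Proof.
move=> pN; have b0 : binom N != 0 by rewrite pnatr_eq0 -lt0n bin_gt0.
rewrite (eq_bigr (fun t => binom N ^- 2 * \sum_(A : multi_index N p)
    \sum_(B : multi_index N p) spin_prod t A * spin_prod t B)); last first.
  move=> t _; rewrite /cov elem_symE expr_div_n expr2 mulrC; congr (_ * _).
  by rewrite mulr_suml; apply: eq_bigr => A _; rewrite mulr_sumr.
rewrite -mulr_sumr exchange_big /=.
rewrite (eq_bigr (fun=> 2 ^+ N)); last first.
  move=> A _; rewrite exchange_big /= (bigD1 A)//= sum_spin_prodM eqxx.
  by rewrite big1 ?addr0// => B BA; rewrite sum_spin_prodM eq_sym (negPf BA).
by rewrite sumr_const card_multi_index -mulr_natr; field.
Qed.

(** [eps] opens the truncation level, [dlt] separates small from large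
    overlaps. *)
Variables (eps dlt : R).

Definition large N (t : config N) : bool := dlt * N%:R < `|S t|.

(** Weight of the exponential Chebyshev inequality that handles the truncation of
    a pair of configurations: it only helps at large positive correlation, where
    it is chosen to minimise the resulting exponent at [eps = 0]. *)
Definition tilt N (t : config N) : R :=
  if large t && (0 < cov t) then beta * cov t / (1 + cov t) else 0.

Definition pair_exponent N (t : config N) : R :=
  (beta - tilt t) ^+ 2 * (1 + cov t) + 2 * tilt t * (beta + eps) - beta ^+ 2.

Lemma tilt_ge0 N (t : config N) : 0 <= tilt t.
Proof.
rewrite /tilt; case: ifP => // /andP[_ c0].
by apply: divr_ge0; [rewrite mulr_ge0// ltW|rewrite addr_ge0// ltW].
Qed.

Lemma pair_exponent_small N (t : config N) : ~~ (large t && (0 < cov t)) ->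
  pair_exponent t = beta ^+ 2 * cov t.
Proof. by rewrite /pair_exponent /tilt => /negPf ->; ring. Qed.

Lemma pair_exponent_large N (t : config N) : large t && (0 < cov t) ->
  pair_exponent t = (beta ^+ 2 + 2 * beta * eps) * (cov t / (1 + cov t)).
Proof.
move=> h; have /andP[_ c0] := h; rewrite /pair_exponent /tilt h.
by field; rewrite gt_eqF// addr_gt0.
Qed.

Definition cov_scale : R := 2 * p`!%:R * beta ^+ 2.
Local Notation D := cov_scale.

Let D0 : 0 < D. Proof. by rewrite !mulr_gt0 ?exprn_gt0// ltr0n fact_gt0. Qed.

(* The two smallness conditions on [dlt] make [N * beta ^+ 2 * cov t] at most a
   thirty-second of [S t ^+ 2 / N + 1] at small overlap. *)
Hypothesis dlt0 : 0 < dlt.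
Hypothesis dlt_small : 2 * dlt ^+ 2 * (32 * D) ^+ 2 <= 1.
Hypothesis dlt_half : 2 * dlt ^+ 2 <= 1.

Definition small_const : R := D ^+ 3 * ((2 * p)`!%:R * 32 ^+ (2 * p)) * expR (16^-1) * expR (8^-1).

Let ffactE N : (N ^_ p)%:R = binom N * p`!%:R :> R.
Proof. by rewrite -bin_ffact natrM. Qed.

Let sqr_cov_le N (t : config N) : (p <= N)%N -> (0 < N)%N ->
  N%:R ^+ p <= 2 * (N ^_ p)%:R :> R ->
  (N%:R * (beta ^+ 2 * cov t)) ^+ 2 <=
    D ^+ 2 * (S t ^+ 2 / N%:R + 1) ^+ p / N%:R ^+ (p - 2).
Proof.
move=> pN N0 Nff; set n : R := N%:R; set q := S t ^+ 2 / n + 1.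
have n0 : 0 < n by rewrite ltr0n.
have b0 : 0 < binom N by rewrite ltr0n bin_gt0.
have e2 : elem_sym t p ^+ 2 <= (n * q) ^+ p.
  have nq : n * q = S t ^+ 2 + n by rewrite /q; field; rewrite gt_eqF.
  have nq0 : 0 <= n * q by rewrite nq addr_ge0 ?sqr_ge0// ltW.
  have := @norm_elem_sym_le R N t p (Num.sqrt (n * q)) (sqrtr_ge0 _) _ _ pN.
  rewrite sqr_sqrtr// nq lerDr sqr_ge0 => /(_ _ isT) h.
  rewrite -(real_normK (num_real (elem_sym t p))) -nq.
  apply: (@le_trans _ _ ((Num.sqrt (n * q) ^+ p) ^+ 2)).
    rewrite ler_pXn2r ?nnegrE ?exprn_ge0 ?sqrtr_ge0// nq h//.
    by rewrite -sqrtr_sqr ler_wsqrtr// lerDl ltW.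
  by rewrite exprAC sqr_sqrtr.
have bge : n ^+ p <= 2 * p`!%:R * binom N.
  by rewrite -mulrA [p`!%:R * _]mulrC -ffactE.
have np0 : 0 < n ^+ p by rewrite exprn_gt0.
rewrite /cov exprMn [(beta ^+ 2 * _) ^+ 2]exprMn expr_div_n.
have q0 : 0 <= q by rewrite addr_ge0// divr_ge0 ?sqr_ge0// ltW.
apply: (@le_trans _ _ (n ^+ 2 * ((beta ^+ 2) ^+ 2 * ((n * q) ^+ p *
    (2 * p`!%:R / n ^+ p) ^+ 2)))).
  rewrite ler_wpM2l ?sqr_ge0// ler_wpM2l ?sqr_ge0//.
  apply: ler_pM; rewrite ?sqr_ge0 ?invr_ge0 ?exprn_ge0// ?(ltW b0)//.
  rewrite -exprVn ler_pXn2r ?nnegrE ?invr_ge0 ?divr_ge0 ?mulr_ge0 ?(ltW b0) ?(ltW np0)//.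
  by rewrite -[leLHS]mul1r ler_pdivrMr// mulrAC ler_pdivlMr// mul1r.
rewrite le_eqVlt; apply/orP; left; apply/eqP.
have np : n ^+ p = n ^+ (p - 2) * n ^+ 2 by rewrite -exprD subnK// ltnW.
rewrite (exprMn _ n q) np /cov_scale; set A := n ^+ (p - 2); set qp := q ^+ p.
have A0 : A != 0 by rewrite expf_neq0// gt_eqF.
by field; rewrite A0 gt_eqF.
Qed.

Let near_ffact : \forall N \near \oo, N%:R ^+ p <= 2 * (N ^_ p)%:R :> R.
Proof.
have h := @cvg_ffact R p.
have lt12 : (1 : R) < 2 by rewrite ltr1n.
near=> N.
have f0 : 0 < (N ^_ p)%:R :> R.
  by rewrite ltr0n ffact_gt0; near: N; exact: nbhs_infty_ge.
rewrite -ler_pdivrMr// ltW//.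
by near: N; exact: (cvgr_lt _ h).
Unshelve. all: by end_near.
Qed.

(** Small overlaps: the quadratic Taylor expansion is exact enough, because the
    covariance is [O((S ^+ 2 / N + 1) ^ (p / 2) * N ^ (- p / 2))] and [S ^+ 2 / N] has
    exponential moments. *)
Lemma sum_small : \forall N \near \oo,
  \sum_(t : config N | ~~ large t) expR (N%:R * (beta ^+ 2 * cov t)) <=
  2 ^+ N * (1 + beta ^+ 4 * N%:R ^+ 2 / (2 * binom N) +
            small_const / (N%:R ^+ (p - 2) * Num.sqrt N%:R)).
Proof.
near=> N.
have pN : (p <= N)%N by near: N; exact: nbhs_infty_ge.
have N0 : (0 < N)%N by near: N; exact: nbhs_infty_gt.
have Nff : N%:R ^+ p <= 2 * (N ^_ p)%:R :> R by near: N; exact: near_ffact.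
set n : R := N%:R.
have n0 : 0 < n by rewrite ltr0n.
have nd : 1 <= dlt ^+ 2 * n.
  rewrite mulrC -ler_pdivrMr ?exprn_gt0// mul1r.
  by rewrite /n; near: N; exact: nbhs_infty_ger.
have n1 : 1 <= n by rewrite ler1n.
have b0 : 0 < binom N by rewrite ltr0n bin_gt0.
pose x (t : config N) := n * (beta ^+ 2 * cov t).
pose q (t : config N) := S t ^+ 2 / n + 1.
pose Rn := (D ^+ 3 * ((2 * p)`!%:R * 32 ^+ (2 * p))) * expR (16^-1) / (n ^+ (p - 2) * Num.sqrt n).
have sn0 : 0 < Num.sqrt n by rewrite sqrtr_gt0.
have Rn0 : 0 <= Rn.
  apply: divr_ge0; last by rewrite mulr_ge0 ?exprn_ge0// ltW.
  apply: mulr_ge0; last exact: expR_ge0.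
  apply: mulr_ge0; last by rewrite mulr_ge0// exprn_ge0.
  by rewrite exprn_ge0// ltW.
have rem t : ~~ large t ->
    `|x t| ^+ 3 * expR `|x t| <= Rn * expR (S t ^+ 2 / (16 * n)).
  rewrite /large -leNgt => St.
  have x2 := sqr_cov_le t pN N0 Nff; rewrite -/(x t) -/(q t) in x2.
  have q1 : 1 <= q t by rewrite lerDr divr_ge0 ?sqr_ge0// ltW.
  have q0 : 0 <= q t by exact: le_trans q1.
  have qn : q t / n <= 2 * dlt ^+ 2.
    rewrite ler_pdivrMr// /q mulr2n mulrDl mulrDl mul1r lerD//.
    rewrite ler_pdivrMr// -(real_normK (num_real (S t))) -mulrA -expr2 -exprMn.
    by rewrite ler_pXn2r ?nnegrE ?mulr_ge0 ?(ltW dlt0) ?(ltW n0).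
  have qn0 : 0 <= q t / n by rewrite divr_ge0// ltW.
  have qn1 : q t / n <= 1 by exact: le_trans dlt_half.
  have p2 : q t ^+ p / n ^+ (p - 2) = (q t / n) ^+ (p - 2) * q t ^+ 2.
    have -> : q t ^+ p = q t ^+ (p - 2) * q t ^+ 2 by rewrite -exprD subnK// ltnW.
    by rewrite expr_div_n; ring.
  have qnp : (q t / n) ^+ (p - 2) <= q t / n.
    rewrite (_ : (p - 2 = (p - 3).+1)%N); last by rewrite -subSn.
    by rewrite exprS ler_piMr// exprn_ile1.
  have x_q : `|x t| <= q t / 32.
    rewrite -(@ler_pXn2r _ 2)// ?nnegrE ?divr_ge0// real_normK ?num_real//.
    apply: (le_trans x2); rewrite -mulrA p2.
    apply: (@le_trans _ _ (D ^+ 2 * (2 * dlt ^+ 2 * q t ^+ 2))).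
      rewrite ler_wpM2l ?sqr_ge0// ler_wpM2r ?sqr_ge0//.
      exact: le_trans qn.
    rewrite expr_div_n ler_pdivlMr ?exprn_gt0//.
    rewrite [leLHS](_ : _ = (2 * dlt ^+ 2 * (32 * D) ^+ 2) * q t ^+ 2); last by ring.
    by rewrite ler_piMl ?sqr_ge0.
  have x_s : `|x t| <= D * q t ^+ p / Num.sqrt n.
    have Ds : 0 <= D * q t ^+ p / Num.sqrt n.
      apply: divr_ge0; last exact: ltW.
      by apply: mulr_ge0; [exact: ltW|exact: exprn_ge0].
    rewrite -(@ler_pXn2r _ 2)//.
    rewrite real_normK ?num_real//; apply: (le_trans x2).
    rewrite expr_div_n (exprMn _ D) sqr_sqrtr ?(ltW n0)//.
    apply: ler_pM.
    - by rewrite mulr_ge0 ?sqr_ge0// exprn_ge0.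
    - by rewrite invr_ge0 exprn_ge0// ltW.
    - by rewrite ler_wpM2l ?sqr_ge0// -exprM ler_weXn2l// leq_pmulr.
    rewrite lef_pV2 ?posrE ?exprn_gt0// -[leLHS]expr1 ler_weXn2l//.
    by rewrite subn_gt0.
  have q2p : q t ^+ (2 * p) <= (2 * p)`!%:R * 32 ^+ (2 * p) * expR (q t / 32).
    have h := exprn_le_expR (2 * p) (divr_ge0 q0 (ler0n R 32)).
    rewrite expr_div_n ler_pdivrMr ?exprn_gt0// in h.
    by rewrite mulrAC.
  have e_q : expR `|x t| <= expR (q t / 32) by rewrite ler_expR.
  have x3 : `|x t| ^+ 3 <= D ^+ 3 * q t ^+ (2 * p) / (n ^+ (p - 2) * Num.sqrt n).
    rewrite exprS real_normK ?num_real//.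
    apply: le_trans (ler_pM _ _ x_s x2) _; rewrite ?sqr_ge0//.
    rewrite le_eqVlt; apply/orP; left; apply/eqP.
    rewrite mul2n -addnn exprD; field.
    by rewrite expf_neq0 gt_eqF// gt_eqF.
  apply: (le_trans (ler_pM _ _ x3 e_q)); rewrite ?exprn_ge0 ?expR_ge0//.
  have d0 : 0 < n ^+ (p - 2) * Num.sqrt n by rewrite mulr_gt0// exprn_gt0.
  rewrite mulrAC ler_pdivrMr// /Rn.
  rewrite [leRHS](_ : _ = D ^+ 3 * ((2 * p)`!%:R * 32 ^+ (2 * p) * expR (q t / 32)) * expR (q t / 32)).
    rewrite ler_wpM2r ?expR_ge0// ler_wpM2l// exprn_ge0//; exact: ltW.
  have -> : expR (S t ^+ 2 / (16 * n)) = expR (q t / 32) * expR (q t / 32) / expR (16^-1).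
    by rewrite -expRD -expRB; congr expR; rewrite /q; field; rewrite gt_eqF.
  have np_neq0 : n ^+ (p - 2) != 0 by rewrite expf_neq0// gt_eqF.
  by field; rewrite np_neq0 (gt_eqF sn0) (gt_eqF (expR_gt0 _)).
apply: (@le_trans _ _ (\sum_(t : config N) (1 + x t + x t ^+ 2 / 2 +
    Rn * expR (S t ^+ 2 / (16 * n))))).
  rewrite [leRHS](bigID (fun t => ~~ large t)) /= -[leLHS]addr0 lerD//.
    apply: ler_sum => t St; apply: le_trans (expR_taylor2 _) _.
    by rewrite lerD2l rem.
  apply: sumr_ge0 => t _; apply: addr_ge0; last by apply: mulr_ge0 => //; exact: expR_ge0.
  by have := sqr_ge0 (1 + x t); rewrite sqrrD expr1n mul1r; have := sqr_ge0 (x t); lra.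
rewrite !big_split /= sumr_const card_config -!mulr_suml -!mulr_sumr sum_cov//.
rewrite (eq_bigr (fun t => n ^+ 2 * beta ^+ 4 * cov t ^+ 2)); last first.
  by move=> t _; rewrite /x; ring.
have -> : \sum_(t : config N) n ^+ 2 * beta ^+ 4 * cov t ^+ 2 =
    n ^+ 2 * beta ^+ 4 * (2 ^+ N / binom N) by rewrite -mulr_sumr sum_cov_sqr.
rewrite !mulr0 addr0 natrX mulrDr mulrDr mulr1; apply: lerD; first apply: lerD => //.
  by rewrite le_eqVlt; apply/orP; left; apply/eqP; field; rewrite gt_eqF.
apply: le_trans (ler_wpM2l Rn0 (sum_expR_sqr_magnetisation N0)) _.
rewrite le_eqVlt; apply/orP; left; apply/eqP; rewrite /Rn /small_const; field.
by rewrite gt_eqF// gt_eqF// exprn_gt0.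
Unshelve. all: by end_near.
Qed.

(** Large overlaps: the correlation is at most [(1 + eta) * x ^+ p], with [x] slightly
    below the overlap, so that the entropy wins strictly. *)
Lemma sum_large (b2 eta k : R) : 0 < k -> k < 1 -> 0 < eta ->
  1 < (1 + eta) * k ^+ p ->
  0 < eps -> (beta ^+ 2 + 2 * beta * eps) * (1 + eta) < b2 ->
  (forall x, 0 < x -> x < 1 -> b2 * (x ^+ p / (1 + x ^+ p)) <= phi x) ->
  exists2 c, 0 < c & \forall N \near \oo,
  \sum_(t : config N | large t) expR (N%:R * pair_exponent t) <=
  2 ^+ N * (2 * N.+1%:R) * expR (- c * N%:R).
Proof.
move=> k0 k1 eta0 etak eps0 B_lt phi_ge.
set B := beta ^+ 2 + 2 * beta * eps in B_lt.
have B0 : 0 < B by rewrite addr_gt0 ?exprn_gt0// !mulr_gt0.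
have BB : 0 < b2 - B * (1 + eta) by rewrite subr_gt0.
have kd0 : 0 < (k * dlt) ^+ p by rewrite exprn_gt0 ?mulr_gt0.
exists ((b2 - B * (1 + eta)) * ((k * dlt) ^+ p / 2)); first by rewrite mulr_gt0// divr_gt0.
set c := _ * (_ / 2).
have [K K0 esymK] := @elem_sym_magnetisation R p.
have cvg1 : (N%:R ^+ p / (N ^_ p)%:R * (1 + K / dlt ^+ p * N%:R^-1) : R)
    @[N --> \oo] --> (1 * (1 + K / dlt ^+ p * 0) : R).
  apply: cvgM; first exact: cvg_ffact.
  apply: cvgD; first exact: cvg_cst.
  by apply: cvgM; [exact: cvg_cst|rewrite -cvg_shiftS; exact: cvg_harmonic].
rewrite mulr0 addr0 mulr1 in cvg1.
near=> N.
have pN : (p <= N)%N by near: N; exact: nbhs_infty_ge.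
have N0 : (0 < N)%N by near: N; exact: nbhs_infty_gt.
have ratio : N%:R ^+ p / (N ^_ p)%:R * (1 + K / dlt ^+ p * N%:R^-1) <= (1 + eta) * k ^+ p.
  by apply: ltW; near: N; exact: (cvgr_lt _ cvg1).
set n : R := N%:R in ratio *.
have n0 : 0 < n by rewrite ltr0n.
have b0 : 0 < binom N by rewrite ltr0n bin_gt0.
have f0 : 0 < (N ^_ p)%:R :> R by rewrite ltr0n ffact_gt0.
have expo (t : config N) : large t -> pair_exponent t <= phi (k * `|S t| / n) - c.
  move=> lt; have St : dlt * n < `|S t| by [].
  have S0 : 0 < `|S t| by rewrite (le_lt_trans _ St)// mulr_ge0 ?ltW.
  pose m := `|S t| / n.
  have m0 : 0 < m by rewrite divr_gt0.
  have m1 : m <= 1 by rewrite ler_pdivrMr// mul1r norm_magnetisation_le.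
  have md : dlt <= m by rewrite ler_pdivlMr// ltW.
  rewrite -mulrA -/m; set x := k * m.
  have x0 : 0 < x by rewrite mulr_gt0.
  have x1 : x < 1 by rewrite (le_lt_trans _ k1)// ler_piMr// ltW.
  set y := x ^+ p.
  have y0 : 0 < y by rewrite exprn_gt0.
  have y1 : y <= 1 by rewrite exprn_ile1// ltW.
  have y1' : 0 < 1 + y by rewrite addr_gt0.
  have yd : (k * dlt) ^+ p <= y.
    rewrite /y; apply: lerXn2r; rewrite ?nnegrE ?(ltW x0)//.
      by rewrite mulr_ge0// ltW.
    by rewrite /x ler_wpM2l// ltW.
  have yy : (k * dlt) ^+ p / 2 <= y / (1 + y).
    apply: ler_pM => //; first exact: ltW.
    by rewrite lef_pV2 ?posrE// lerD2l.
  have c_le : c <= (b2 - B * (1 + eta)) * (y / (1 + y)) by rewrite ler_wpM2l// ltW.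
  have := phi_ge x x0 x1; rewrite -/y => phi_y.
  have r_le : cov t <= (1 + eta) * y.
    have h := esymK N t pN.
    have h' : p`!%:R * elem_sym t p <= `|S t| ^+ p + K * n ^+ p / n.
      rewrite -lerBlDl ler_pdivlMr// mulrC.
      apply: le_trans h; rewrite ler_wpM2l ?(ltW n0)//.
      apply: (@le_trans _ _ (p`!%:R * elem_sym t p - S t ^+ p)); last exact: ler_norm.
      by rewrite lerD2l lerN2 (le_trans (ler_norm _))// normrX.
    have -> : cov t = p`!%:R * elem_sym t p / (N ^_ p)%:R.
      rewrite ffactE /cov; field.
      by rewrite (gt_eqF b0) pnatr_eq0 -lt0n fact_gt0.
    rewrite ler_pdivrMr//; apply: (le_trans h').
    have Sm : `|S t| = m * n by rewrite /m mulfVK// gt_eqF.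
    have Kd : K / n <= K / dlt ^+ p / n * m ^+ p.
      rewrite -[leLHS]mulr1 -!mulrA ler_wpM2l// mulrCA ler_wpM2l ?invr_ge0 ?(ltW n0)//.
      rewrite mulrC ler_pdivlMr ?exprn_gt0// mul1r.
      by rewrite lerXn2r ?nnegrE ?(ltW dlt0) ?(ltW m0).
    apply: (@le_trans _ _ (n ^+ p * (m ^+ p * (1 + K / dlt ^+ p * n^-1)))).
      rewrite Sm (exprMn _ m n) mulrC mulrAC [K / n * _]mulrC -mulrDr.
      rewrite ler_wpM2l ?exprn_ge0 ?(ltW n0)// mulrDr mulr1 lerD2l.
      by rewrite [leRHS]mulrC.
    rewrite /y /x (exprMn _ k m).
    rewrite (_ : n ^+ p * _ = n ^+ p / (N ^_ p)%:R * (1 + K / dlt ^+ p * n^-1) *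
       (m ^+ p * (N ^_ p)%:R)); last by field; rewrite !gt_eqF// exprn_gt0.
    rewrite [leRHS](_ : _ = (1 + eta) * k ^+ p * (m ^+ p * (N ^_ p)%:R)); last by ring.
    by rewrite ler_wpM2r// mulr_ge0 ?exprn_ge0 ?(ltW m0) ?(ltW f0).
  rewrite lerBrDr; apply: (le_trans _ phi_y).
  have yp : 0 <= y / (1 + y) by rewrite divr_ge0 ?ltW.
  have [/andP[_ r0]|nr] := boolP (large t && (0 < cov t)); last first.
    rewrite pair_exponent_small//; rewrite lt /= -leNgt in nr.
    have h1 : beta ^+ 2 * cov t <= 0 by rewrite mulr_ge0_le0 ?sqr_ge0.
    have h2 : 0 <= B * (1 + eta) * (y / (1 + y)).
      apply: mulr_ge0 => //; apply: mulr_ge0; first exact: ltW.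
      by rewrite addr_ge0// ltW.
    move: c_le; rewrite mulrBl; lra.
  rewrite pair_exponent_large ?lt//.
  have r1 : 0 < 1 + cov t by rewrite addr_gt0.
  have rr : cov t / (1 + cov t) <= (1 + eta) * (y / (1 + y)).
    rewrite mulrA ler_pdivrMr// mulrAC ler_pdivlMr//.
    rewrite mulrDr mulr1 mulrDr mulr1 lerD// [leRHS]mulrC ler_wpM2l ?(ltW r0)//.
    by rewrite ler_peMl ?(ltW y0)// lerDl ltW.
  have : B * (cov t / (1 + cov t)) <= B * ((1 + eta) * (y / (1 + y))).
    by rewrite ler_wpM2l// ltW.
  by move: c_le; rewrite mulrBl mulrA; lra.
apply: (@le_trans _ _ (\sum_(t : config N | large t)
    expR (n * phi (k * `|S t| / n)) * expR (- c * n))).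
  apply: ler_sum => t lt; rewrite -expRD ler_expR.
  rewrite (_ : _ + _ = n * (phi (k * `|S t| / n) - c)); last by ring.
  by rewrite ler_wpM2l ?(ltW n0)// expo.
rewrite -mulr_suml ler_wpM2r ?expR_ge0//.
apply: le_trans (sum_expR_phi N k0 k1).
rewrite [leRHS](bigID (fun t : config N => large t)) /=.
rewrite -[leLHS]addr0 lerD//; last by apply: sumr_ge0 => t _; exact: expR_ge0.
rewrite le_eqVlt; apply/orP; left; apply/eqP/eq_bigl => t.
case: (boolP (large t)) => // lt; last by rewrite andbF.
by rewrite andbT (le_lt_trans _ lt)// mulr_ge0 ?ltW.
Unshelve. all: by end_near.
Qed.

End overlap.

(** The left-hand side is an upper bound for the normalised second moment of the
    truncated partition function. Beyond the variance of the leading fluctuation,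
    small overlaps contribute a relative error [N ^ (- 1 / 2)] and large overlaps an
    exponentially small one. *)
Lemma truncated_second_moment {R : realType} (p : nat) (beta : R) : (3 <= p)%N ->
  0 < beta -> beta < critical_beta p ->
  exists eps dlt K c : R, [/\ 0 < eps, 0 < c & \forall N \near \oo,
    2 ^- N * \sum_(t : config N) expR (N%:R * pair_exponent p beta eps dlt t) <=
    1 + beta ^+ 4 * N%:R ^+ 2 / (2 * 'C(N, p)%:R) +
    K / (N%:R ^+ (p - 2) * Num.sqrt N%:R) + 2 * N.+1%:R * expR (- c * N%:R)].
Proof.
move=> hp beta0 /(critical_beta_lt beta0)[b2 b2_gt phi_ge].
pose d := b2 - beta ^+ 2; have d0 : 0 < d by rewrite subr_gt0.
have bb0 : 0 < beta ^+ 2 by rewrite exprn_gt0.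
pose eps := d / (8 * beta); have eps0 : 0 < eps by rewrite divr_gt0// mulr_gt0.
pose eta := d / (4 * (beta ^+ 2 + d)).
have eta0 : 0 < eta by rewrite divr_gt0// mulr_gt0// addr_gt0.
have B_lt : (beta ^+ 2 + 2 * beta * eps) * (1 + eta) < b2.
  have -> : 2 * beta * eps = d / 4 by rewrite /eps; field; rewrite gt_eqF.
  have etaE : (beta ^+ 2 + d) * eta = d / 4.
    by rewrite /eta; field; rewrite gt_eqF// addr_gt0.
  have : (beta ^+ 2 + d / 4) * eta <= (beta ^+ 2 + d) * eta.
    by rewrite ler_wpM2r ?(ltW eta0)// lerD2l; lra.
  rewrite etaE (_ : b2 = beta ^+ 2 + d); last by rewrite /d; ring.
  by rewrite mulrDr mulr1; lra.
pose k : R := expR (- (ln (1 + eta) / (2 * p%:R))).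
have p0 : 0 < p%:R :> R by rewrite ltr0n (leq_trans _ hp).
have l0 : 0 < ln (1 + eta) by rewrite ln_gt0// ltrDl.
have k0 : 0 < k by exact: expR_gt0.
have k1 : k < 1 by rewrite -expR0 ltr_expR oppr_lt0 divr_gt0// mulr_gt0.
have etak : 1 < (1 + eta) * k ^+ p.
  have -> : (1 + eta) * k ^+ p = expR (ln (1 + eta) / 2).
    rewrite /k -expRM_natl -{1}(@lnK R (1 + eta)) ?posrE ?addr_gt0// -expRD.
    by congr expR; field; rewrite gt_eqF.
  by rewrite -[X in X < _]expR0 ltr_expR divr_gt0.
pose D := cov_scale p beta.
have D0 : 0 < D by rewrite /D /cov_scale !mulr_gt0// ltr0n fact_gt0.
pose dlt : R := (2 * (1 + 32 * D))^-1.
have e1 : 0 < 1 + 32 * D by rewrite addr_gt0// mulr_gt0.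
have dlt0 : 0 < dlt by rewrite invr_gt0 mulr_gt0.
have d2 : 2 * dlt ^+ 2 * (1 + 32 * D) ^+ 2 = 2^-1.
  by rewrite /dlt; field; rewrite gt_eqF.
have dlt_half : 2 * dlt ^+ 2 <= 1.
  have q1 : 1 <= (1 + 32 * D) ^+ 2 by apply: exprn_ege1; rewrite lerDl mulr_ge0// ltW.
  rewrite (le_trans (y := 2^-1)) ?invf_le1 ?ler1n// -d2.
  by rewrite (ler_peMr _ q1) // mulr_ge0 ?sqr_ge0.
have dlt_small : 2 * dlt ^+ 2 * (32 * D) ^+ 2 <= 1.
  have D32 : 0 <= 32 * D by rewrite mulr_ge0// ltW.
  have q1 : (32 * D) ^+ 2 <= (1 + 32 * D) ^+ 2.
    by rewrite ler_pXn2r ?nnegrE ?addr_ge0// lerDr.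
  rewrite (le_trans (y := 2^-1)) ?invf_le1 ?ler1n// -d2.
  by apply: ler_wpM2l q1; rewrite mulr_ge0 ?sqr_ge0.
have [c c0 large_le] := sum_large beta0 dlt0 k0 k1 eta0 etak eps0 B_lt phi_ge.
exists eps, dlt, (small_const p beta), c; split => //.
near=> N.
rewrite -ler_pdivlMl ?invr_gt0 ?exprn_gt0// invrK.
rewrite (bigID (fun t : config N => large dlt t)) /= addrC [leRHS]mulrDr.
apply: lerD.
  rewrite (eq_bigr (fun t => expR (N%:R * (beta ^+ 2 * cov p t)))); last first.
    by move=> t nl; rewrite pair_exponent_small// (negPf nl).
  by near: N; exact: (sum_small hp beta0 dlt0 dlt_small dlt_half).
by rewrite [leRHS]mulrA; near: N; exact: large_le.
Unshelve. all: by end_near.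
Qed.

Lemma cvg_expn_expR {R : realType} (k : nat) (c : R) : 0 < c ->
  (N%:R ^+ k * expR (- c * N%:R) : R) @[N --> \oo] --> (0 : R).
Proof.
move=> c0; pose K : R := (k.+1)`!%:R / c ^+ k.+1.
have uK : (K * N%:R^-1 : R) @[N --> \oo] --> (K * 0 : R).
  by apply: cvgM; [exact: cvg_cst|rewrite -cvg_shiftS; exact: cvg_harmonic].
rewrite mulr0 in uK.
apply: (@squeeze_cvgr _ _ _ _ (fun=> 0) (fun N => K * N%:R^-1)) => //; last exact: cvg_cst.
near=> N.
have N0 : 0 < N%:R :> R by rewrite ltr0n; near: N; exact: nbhs_infty_gt.
rewrite mulr_ge0 ?exprn_ge0 ?expR_ge0 ?(ltW N0)//=.
have h := exprn_le_expR k.+1 (mulr_ge0 (ltW c0) (ltW N0)).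
rewrite ler_pdivlMr// mulrAC -exprSr mulNr expRN ler_pdivrMr ?expR_gt0//.
by rewrite /K mulrAC ler_pdivlMr ?exprn_gt0// mulrC -exprMn.
Unshelve. all: by end_near.
Qed.

(** * Moments of the partition function *)

Section partition_moments.
Context d (T : measurableType d) (R : realType) (P : probability T R).
Variables (N p : nat) (J : multi_index N p -> {RV P >-> R}).
Hypothesis J_indep : mutually_independent P J.
Hypothesis J_law : forall A, has_law P (J A) (gaussian 0 1).
Hypothesis N_gt0 : (0 < N)%N.
Hypothesis pN : (p <= N)%N.
Local Notation n := (N%:R : R).
Local Notation C := ('C(N, p)%:R : R).

Let C_gt0 : 0 < C. Proof. by rewrite ltr0n bin_gt0. Qed.
Let C_neq0 : C != 0. Proof. by rewrite gt_eqF. Qed.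
Let n_gt0 : 0 < n. Proof. by rewrite ltr0n. Qed.
Let n_neq0 : n != 0. Proof. by rewrite gt_eqF. Qed.

(** The opposite of the Hamiltonian. *)
Definition energy s w : R := Num.sqrt n * gauss_field J s w.

Let r : R := Num.sqrt n / Num.sqrt C.

Let r_sqr : r ^+ 2 = n / C.
Proof. by rewrite /r expr_div_n !sqr_sqrtr// ltW. Qed.

Let energyE u s w : u * energy s w = \sum_A (u * r * spin_prod s A) * J A w.
Proof.
rewrite /energy /gauss_field !mulrA mulr_sumr; apply: eq_bigr => A _.
by rewrite /r; ring.
Qed.

Let sum_cst (c : R) : \sum_(A : multi_index N p) c = c * C.
Proof. by rewrite sumr_const card_multi_index mulr_natr. Qed.

Let coef_sqr u s (A : multi_index N p) : (u * r * spin_prod s A) ^+ 2 = u ^+ 2 * n / C.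
Proof.
rewrite (_ : _ ^+ 2 = u ^+ 2 * r ^+ 2 * (spin_prod s A * spin_prod s A)); last by ring.
by rewrite r_sqr spin_prod_sqr mulr1 mulrA.
Qed.

Lemma hasE_energy u s : hasE P (fun w => expR (u * energy s w)) (expR (u ^+ 2 * n / 2)).
Proof.
have := hasE_expR_sum J_indep J_law (fun A => u * r * spin_prod s A).
move/hasE_eq; apply=> [w|]; first by rewrite energyE.
under eq_bigr do rewrite coef_sqr.
by rewrite sum_cst; congr expR; field.
Qed.

Lemma hasE_energy_sqr u s A : hasE P (fun w => expR (u * energy s w) * J A w ^+ 2)
  (expR (u ^+ 2 * n / 2) * (1 + u ^+ 2 * n / C)).
Proof.
have := hasE_expR_sum_sqr J_indep J_law (fun A => u * r * spin_prod s A) A.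
move/hasE_eq; apply=> [w|]; first by rewrite energyE.
under eq_bigr do rewrite coef_sqr.
by rewrite coef_sqr sum_cst; congr (expR _ * _); field.
Qed.

Lemma hasE_energy_pair u s s' : hasE P (fun w => expR (u * (energy s w + energy s' w)))
  (expR (u ^+ 2 * n * (1 + cov p (config_mul s s')))).
Proof.
have := hasE_expR_sum J_indep J_law (fun A => u * r * (spin_prod s A + spin_prod s' A)).
move/hasE_eq; apply=> [w|].
  rewrite mulrDr !energyE -big_split /=; congr expR; apply: eq_bigr => A _; ring.
rewrite (eq_bigr (fun A => u ^+ 2 * n / C * (1 + spin_prod (config_mul s s') A))); last first.
  move=> A _; rewrite spin_prod_mul (_ : _ / 2 = u ^+ 2 * r ^+ 2 *
    ((spin_prod s A * spin_prod s A + spin_prod s' A * spin_prod s' A) / 2 +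
     spin_prod s A * spin_prod s' A)); last by field.
  by rewrite r_sqr !spin_prod_sqr; field.
rewrite -mulr_sumr big_split /= sum_cst -elem_symE /cov; congr expR; field.
by rewrite C_neq0.
Qed.

Let avg (F : config N -> R) : R := 2 ^- N * \sum_s F s.

Let avg_cst c : avg (fun=> c) = c.
Proof.
rewrite /avg sumr_const card_config -(mulr_natr c) natrX mulrCA mulVf ?mulr1//.
Qed.

Let le_avg F G : (forall s, F s <= G s) -> avg F <= avg G.
Proof. by move=> FG; rewrite ler_wpM2l ?invr_ge0 ?exprn_ge0// ler_sum. Qed.

Let avgB F G : avg F - avg G = avg (fun s => F s - G s).
Proof. by rewrite /avg sumrB mulrBr. Qed.

Let avgMr F c : avg F * c = avg (fun s => F s * c).
Proof. by rewrite /avg -mulrA mulr_suml. Qed.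

Let hasE_avg (F : config N -> T -> R) e : (forall s, hasE P (F s) (e s)) ->
  hasE P (fun w => avg (F^~ w)) (avg e).
Proof. by move=> h; apply: hasEZ; apply: hasE_sum => s _; exact: h. Qed.

Variables (beta eps dlt : R).

(** Partition function divided by its mean. *)
Definition norm_partition w : R := 2 ^- N * \sum_s expR (beta * energy s w - n * beta ^+ 2 / 2).

(** Projection of the normalised partition function on the second Hermite
    polynomials of the couplings: its only part that fluctuates at leading order. *)
Definition chi2_part w : R := beta ^+ 2 * n / 2 / C * \sum_A (J A w ^+ 2 - 1).

(** At once the variance of this projection and its covariance with the normalised
    partition function. *)
Definition chi2_var : R := beta ^+ 4 * n ^+ 2 / (2 * C).

Local Notation U := norm_partition.
Local Notation Q := chi2_part.
Local Notation v := chi2_var.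
Local Notation k := (beta ^+ 2 * n / 2 / C).

(** Configurations of atypically high energy are removed: they contribute little to
    the first moment but dominate the second one when [beta] is large. *)
Definition trunc_partition w : R := 2 ^- N *
  \sum_s (if energy s w <= (beta + eps) * n then expR (beta * energy s w - n * beta ^+ 2 / 2)
          else 0).

(** Exponential Chebyshev bound for the removed part. *)
Definition tail_bound w : R :=
  2 ^- N * \sum_s expR ((beta + eps) * energy s w - eps * (beta + eps) * n - n * beta ^+ 2 / 2).

(** Bound for the removed part times [1 + chi2_part]. *)
Definition tail_sqr_bound w : R := tail_bound w * (1 + k * \sum_A J A w ^+ 2).

(** Exponential Chebyshev bound for the square of the truncated partition function,
    with a weight that depends on the pair of configurations. *)
Definition pair_bound w : R := 2 ^- N * \sum_s 2 ^- N * \sum_s'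
  let l := tilt p beta dlt (config_mul s s') in
  expR ((beta - l) * (energy s w + energy s' w) + 2 * l * (beta + eps) * n - n * beta ^+ 2).

(** Bound for the squared distance from the truncated partition function to
    [1 + chi2_part]. The cross term involves the untruncated partition function, which
    makes its mean explicit; [tail_sqr_bound] pays for the difference. *)
Definition trunc_sqr_bound w : R :=
  pair_bound w - 2 * (U w * (1 + Q w)) + 2 * tail_sqr_bound w + (1 + Q w) ^+ 2.

Lemma hasE_norm_partition : hasE P U 1.
Proof.
rewrite -[1](@avg_cst 1); apply: hasE_avg => s.
have := hasEZ (expR (- (n * beta ^+ 2 / 2))) (hasE_energy beta s).
move/hasE_eq; apply=> [w|]; first by rewrite addrC expRD.
by rewrite -expRD (_ : _ + _ = 0) ?expR0//; ring.
Qed.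

Lemma hasE_chi2_part : hasE P Q 0.
Proof.
rewrite -(mulr0 k); apply: hasEZ.
have h A : hasE P (fun w => J A w ^+ 2 - 1) 0.
  have h2 := hasE_gauss J_law A (measurable_funX 2 (@measurable_id _ R setT)) (@hasE_normal_sqr R).
  by have := hasEB h2 (hasE_cst P 1); move/hasE_eq; apply=> [w|]//; rewrite subrr.
have := @hasE_sum _ _ _ P _ (index_enum (multi_index N p)) xpredT _ _ (fun A _ => h A).
by move/hasE_eq; apply=> [w|]//; rewrite big1.
Qed.

Lemma hasE_chi2_part_sqr : hasE P (fun w => Q w ^+ 2) v.
Proof.
have := hasEZ (k ^+ 2) (hasE_chi2_sqr J_indep J_law).
move/hasE_eq; apply=> [w|]; first by rewrite /chi2_part (exprMn _ k).
by rewrite card_multi_index /chi2_var; field.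
Qed.

Lemma hasE_partition_chi2 : hasE P (fun w => U w * Q w) v.
Proof.
have h s : hasE P (fun w => expR (- (n * beta ^+ 2 / 2)) * (k * \sum_A
   (expR (beta * energy s w) * J A w ^+ 2 - expR (beta * energy s w)))) v.
  have := hasEZ (expR (- (n * beta ^+ 2 / 2))) (hasEZ k
    (@hasE_sum _ _ _ P _ (index_enum (multi_index N p)) xpredT _ _
    (fun A _ => hasEB (hasE_energy_sqr beta s A) (hasE_energy beta s)))).
  move/hasE_eq; apply=> [w|]//.
  rewrite sum_cst mulrDr mulr1 addrAC subrr add0r.
  rewrite (_ : n * beta ^+ 2 / 2 = beta ^+ 2 * n / 2); last by ring.
  rewrite expRN /chi2_var; field.
  by rewrite C_neq0 gt_eqF ?expR_gt0.
have := hasE_avg h; move/hasE_eq; apply=> [w|]; last by rewrite avg_cst.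
rewrite [LHS](avgMr _ (Q w)); congr (_ * _); apply: eq_bigr => s _.
rewrite /chi2_part expRD [in RHS](eq_bigr (fun A => expR (beta * energy s w) * (J A w ^+ 2 - 1))).
  by rewrite -mulr_sumr; ring.
by move=> A _; ring.
Qed.

Lemma hasE_tail_bound : hasE P tail_bound (expR (- (eps ^+ 2 * n / 2))).
Proof.
rewrite -[expR _]avg_cst; apply: hasE_avg => s.
have := hasEZ (expR (- (eps * (beta + eps) * n) - n * beta ^+ 2 / 2)) (hasE_energy (beta + eps) s).
move/hasE_eq; by apply=> [w|]; rewrite -expRD; congr expR; field.
Qed.

Lemma hasE_tail_sqr_bound : hasE P tail_sqr_bound (expR (- (eps ^+ 2 * n / 2)) *
  (1 + beta ^+ 2 * n / 2 * (1 + (beta + eps) ^+ 2 * n / C))).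
Proof.
pose c := expR (- (eps * (beta + eps) * n) - n * beta ^+ 2 / 2).
pose e := expR ((beta + eps) ^+ 2 * n / 2).
have ce : c * e = expR (- (eps ^+ 2 * n / 2)) by rewrite -expRD; congr expR; field.
rewrite -ce -[X in hasE _ _ X]avg_cst.
have h s := hasEZ c (hasED (hasE_energy (beta + eps) s) (hasEZ k
   (@hasE_sum _ _ _ P _ (index_enum (multi_index N p)) xpredT _ _
    (fun A _ => hasE_energy_sqr (beta + eps) s A)))).
have := hasE_avg h; move/hasE_eq; apply=> [w|]; last first.
  by congr (2 ^- N * _); apply: eq_bigr => s _; rewrite sum_cst; rewrite -/e; field.
rewrite /tail_sqr_bound [LHS](avgMr _ _); congr (_ * _); apply: eq_bigr => s _.
rewrite -mulr_sumr.
rewrite (_ : (beta + eps) * energy s w - eps * (beta + eps) * n - n * beta ^+ 2 / 2 =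
  - (eps * (beta + eps) * n) - n * beta ^+ 2 / 2 + (beta + eps) * energy s w); last by ring.
by rewrite expRD -/c; ring.
Qed.

Lemma hasE_pair_bound : hasE P pair_bound
  (2 ^- N * \sum_(t : config N) expR (n * pair_exponent p beta eps dlt t)).
Proof.
pose e (t : config N) := expR (n * pair_exponent p beta eps dlt t).
have -> : 2 ^- N * \sum_t e t = avg (fun s => avg (fun s' => e (config_mul s s'))).
  rewrite /avg -mulr_sumr (sum_config_mul e) -(mulr_natr (\sum_t e t)) natrX.
  by congr (_ * _); rewrite mulrCA mulVf ?mulr1.
apply: hasE_avg => s; apply: hasE_avg => s' /=.
set l := tilt _ _ _ _.
have := hasEZ (expR (2 * l * (beta + eps) * n - n * beta ^+ 2)) (hasE_energy_pair (beta - l) s s').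
move/hasE_eq; apply=> [w|]; rewrite -expRD; congr expR; first by ring.
by rewrite /pair_exponent -/l; ring.
Qed.

Lemma hasE_trunc_sqr_bound : hasE P trunc_sqr_bound
  (2 ^- N * \sum_(t : config N) expR (n * pair_exponent p beta eps dlt t) - 1 - v +
   2 * (expR (- (eps ^+ 2 * n / 2)) *
     (1 + beta ^+ 2 * n / 2 * (1 + (beta + eps) ^+ 2 * n / C)))).
Proof.
have hUQ := hasED hasE_norm_partition hasE_partition_chi2.
have hQQ := hasED (hasED (hasE_cst P 1) (hasEZ 2 hasE_chi2_part)) hasE_chi2_part_sqr.
have := hasED (hasED (hasEB hasE_pair_bound (hasEZ 2 hUQ)) (hasEZ 2 hasE_tail_sqr_bound)) hQQ.
by move/hasE_eq; apply=> [w|]; rewrite ?/trunc_sqr_bound; ring.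
Qed.

Lemma trunc_partition_le w : trunc_partition w <= U w.
Proof. by apply: le_avg => s; case: ifP => // _; exact: expR_ge0. Qed.

Lemma norm_partition_gt0 w : 0 < U w.
Proof.
rewrite mulr_gt0 ?invr_gt0 ?exprn_gt0//.
rewrite (bigD1 [ffun=> false])//= ltr_pwDl ?expR_gt0//.
by rewrite sumr_ge0// => s _; exact: expR_ge0.
Qed.

Lemma sub_trunc_partition_le w : 0 <= eps -> U w - trunc_partition w <= tail_bound w.
Proof.
move=> e0; rewrite [leLHS](avgB _ _); apply: le_avg => s /=.
case: ifPn => [_|]; first by rewrite subrr expR_ge0.
rewrite -ltNge subr0 ler_expR => h.
rewrite -subr_ge0 (_ : _ - _ = eps * (energy s w - (beta + eps) * n)); last by ring.
by rewrite mulr_ge0// subr_ge0 ltW.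
Qed.

Lemma trunc_partition_sqr_le w : 0 < beta -> trunc_partition w ^+ 2 <= pair_bound w.
Proof.
move=> b0; rewrite expr2 [leLHS](avgMr _ _); apply: le_avg => s.
rewrite mulrC [leLHS](avgMr _ _); apply: le_avg => s' /=.
set l := tilt _ _ _ _.
have l0 : 0 <= l by exact: tilt_ge0.
case: ifPn => h'; last by rewrite mul0r expR_ge0.
case: ifPn => h; last by rewrite mulr0 expR_ge0.
rewrite -expRD ler_expR -subr_ge0.
rewrite (_ : _ - _ = l * ((beta + eps) * n - energy s w + ((beta + eps) * n - energy s' w))).
  by rewrite mulr_ge0// addr_ge0// subr_ge0.
by field.
Qed.

Lemma trunc_sqr_le w : 0 < beta -> 0 <= eps ->
  (trunc_partition w - 1 - Q w) ^+ 2 <= trunc_sqr_bound w.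
Proof.
move=> b0 e0.
have h1 := trunc_partition_sqr_le w b0.
have h2 := sub_trunc_partition_le w e0.
have h3 := trunc_partition_le w.
pose G := 1 + k * \sum_A J A w ^+ 2.
have k0 : 0 <= k by rewrite divr_ge0 ?divr_ge0 ?mulr_ge0 ?exprn_ge0 ?ltW.
have G0 : 0 <= G by rewrite addr_ge0// mulr_ge0// sumr_ge0// => A _; exact: sqr_ge0.
have QG : 1 + Q w <= G.
  rewrite lerD2l /chi2_part ler_wpM2l// ler_sum// => A _.
  by rewrite gerBl.
have h4 : (U w - trunc_partition w) * (1 + Q w) <= tail_sqr_bound w.
  apply: (le_trans (y := (U w - trunc_partition w) * G)).
    by rewrite ler_wpM2l// subr_ge0.
  by rewrite /tail_sqr_bound ler_wpM2r.
rewrite /trunc_sqr_bound; move: h1 h4.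
move: (trunc_partition w) (pair_bound w) (tail_sqr_bound w) (U w) (Q w) => a b c u q.
nra.
Qed.

Lemma scaled_fluctuation_ln w : scaled_fluctuation J beta w =
  n `^ (p%:R / 2) / n * ln (U w).
Proof.
have Z0 : partition_function J beta w = expR (n * beta ^+ 2 / 2) * U w.
  rewrite /partition_function /norm_partition mulrCA; congr (_ * _).
  rewrite mulr_sumr; apply: eq_bigr => s _; rewrite -expRD; congr expR.
  by rewrite /hamiltonian /energy; ring.
rewrite /scaled_fluctuation /free_energy Z0 lnM ?posrE ?expR_gt0 ?norm_partition_gt0//.
by rewrite expRK; field.
Qed.

End partition_moments.

(** * From the second moment to the law of the free energy *)

Section test_function.
Context {R : realType}.
Variables (f : R -> R) (M : R).
Hypothesis cf : continuous f.
Hypothesis f_le : forall x, `|f x| <= M.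

Lemma unif_continuous_segment (B eta : R) : 0 < eta ->
  exists2 rho, 0 < rho <= 1 &
    forall x y, `|y| <= B -> `|x - y| <= rho -> `|f x - f y| <= eta.
Proof.
move=> eta0.
pose Q (r y : R) := forall x : R, `|x - y| <= r -> `|f x - f y| <= eta.
have [y0 _|e /= e0 he] := (@compact_near_coveringP R `[- B, B]).1 (@segment_compact R (- B) B) R (0^'+) Q _.
  have /cvgrPdist_lt /(_ (eta / 2)) := @cf y0.
  rewrite divr_gt0// => /(_ isT) /nbhs_ballP[e /= e0 he].
  exists (ball y0 (e / 2), [set r : R | r < e / 2]) => /=.
    split; first by apply: nbhsx_ballx; rewrite divr_gt0.
    by apply: nbhs_right_lt; rewrite divr_gt0.
  move=> [y r] /= [yy0 re] x xy.
  have yb : ball y0 e y by apply: le_ball yy0; rewrite ler_pdivrMr// ler_peMr ?ler1n// ltW.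
  have xb : ball y0 e x.
    rewrite /ball /= in yy0 *.
    have := ler_distD y y0 x; rewrite [`|y - x|]distrC; lra.
  have := he _ yb; have := he _ xb => /= h1 h2.
  have := ler_distD (f y0) (f x) (f y); rewrite [`|f x - f y0|]distrC; lra.
pose rho := Num.min (e / 2) 1.
have rho0 : 0 < rho by rewrite lt_min divr_gt0/=.
exists rho; first by rewrite rho0 ge_min lexx orbT.
move=> x y yB xy; apply: (he rho) => //=.
  rewrite sub0r normrN gtr0_norm// gt_min; apply/orP; left.
  by rewrite ltr_pdivrMr// ltr_pMr// ltr1n.
by rewrite in_itv/= -ler_norml.
Qed.

Lemma ln1D_approx (z : R) : `|z| <= 2^-1 -> `|ln (1 + z) - z| <= 2 * z ^+ 2.
Proof.
move=> zh; have zl : - 2^-1 <= z by move: zh; rewrite ler_norml => /andP[].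
have z1 : 0 < 1 + z by lra.
have h1 : ln (1 + z) <= z by apply: le_ln1Dx; lra.
have h2 : - ln (1 + z) <= - z / (1 + z).
  rewrite -lnV ?posrE//.
  rewrite [X in ln X](_ : _ = 1 + - z / (1 + z)); last by field; rewrite gt_eqF.
  apply: le_ln1Dx; rewrite ltr_pdivlMr//; lra.
rewrite ler0_norm ?subr_le0// opprB.
have h3 : z - z / (1 + z) <= 2 * z ^+ 2.
  have -> : z - z / (1 + z) = z ^+ 2 / (1 + z) by field; rewrite gt_eqF.
  rewrite mulrC ler_wpM2r ?sqr_ge0// invf_ple ?posrE//; lra.
have h4 : - z / (1 + z) = - (z / (1 + z)) by rewrite mulNr.
lra.
Qed.

(** If [`|W|] is at most [B] and the two error terms, after scaling, are at most [delta],
    then [ln U] is close to [U - 1], which is close to [q], and the two arguments of [f]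
    are within [4 * delta]. Otherwise one of the three fractions on the right exceeds
    one, and the trivial bound [2 * M] suffices. Unlike the left-hand side, the right-hand
    side only involves quantities whose means are explicit. *)
Lemma test_function_le (B eta delta a kap U V L H q W : R) :
  0 < B -> 0 < delta -> 4 * delta <= 1 ->
  (forall x y, `|y| <= B -> `|x - y| <= 4 * delta -> `|f x - f y| <= eta) ->
  2 * (B + 1) <= a -> 2 * (B + 1) ^+ 2 <= delta * a -> `|kap - 1| * B <= delta ->
  a * q = kap * W -> V <= U -> U - V <= L -> (V - 1 - q) ^+ 2 <= H ->
  `|f (a * ln U) - f W| <=
    eta + 2 * M * (W ^+ 2 / B ^+ 2 + a ^+ 2 * H / delta ^+ 2 + a * L / delta).
Proof.
move=> B0 d0 d1 fu a1 a2 kB aq VU UL VH.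
have a0 : 0 < a by lra.
have M0 : 0 <= M by exact: le_trans (f_le 0).
have eta0 : 0 <= eta by have := fu 0 0; rewrite !subrr normr0; apply; lra.
have H0 : 0 <= H by exact: le_trans (sqr_ge0 _) VH.
have L0 : 0 <= L by lra.
have t1 : 0 <= W ^+ 2 / B ^+ 2 by rewrite divr_ge0 ?sqr_ge0.
have t2 : 0 <= a ^+ 2 * H / delta ^+ 2 by apply: divr_ge0; [apply: mulr_ge0 => //|]; exact: sqr_ge0.
have t3 : 0 <= a * L / delta by apply: divr_ge0; [apply: mulr_ge0 => //|]; exact: ltW.
have big (t : R) : 1 <= t -> `|f (a * ln U) - f W| <= eta + 2 * M * t.
  move=> t1'; have := ler_normB (f (a * ln U)) (f W).
  have := f_le (a * ln U); have := f_le W.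
  have : M * 1 <= M * t by rewrite ler_wpM2l.
  lra.
have [BW|WB] := ltP B `|W|.
  apply: big; rewrite -addrA ler_wpDr ?addr_ge0// ler_pdivlMr ?exprn_gt0// mul1r.
  by rewrite -[W ^+ 2]real_normK ?num_real// ler_pXn2r ?nnegrE// ltW.
have [dH|Hd] := ltP (delta ^+ 2) (a ^+ 2 * H).
  apply: big; rewrite addrAC ler_wpDl ?addr_ge0// ler_pdivlMr ?exprn_gt0// mul1r.
  exact: ltW.
have [dL|Ld] := ltP delta (a * L).
  apply: big; rewrite ler_wpDl ?addr_ge0// ler_pdivlMr// mul1r.
  exact: ltW.
apply: (le_trans (fu _ _ WB _)); last first.
  by rewrite lerDl !mulr_ge0// !addr_ge0.
pose z := U - 1.
have e1 : `|a * (V - 1 - q)| <= delta.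
  rewrite -(ler_pXn2r (n := 2))// ?nnegrE ?(ltW d0)// real_normK ?num_real//.
  by rewrite (exprMn _ a) (le_trans _ Hd)// ler_wpM2l ?sqr_ge0.
have e2 : 0 <= a * (U - V) <= delta.
  apply/andP; split; first by apply: mulr_ge0; [exact: ltW|rewrite subr_ge0].
  by apply: le_trans Ld; rewrite ler_wpM2l// ltW.
have e3 : `|(kap - 1) * W| <= delta.
  by rewrite normrM (le_trans _ kB)// ler_wpM2l.
have az : a * z = a * (V - 1 - q) + a * (U - V) + (kap - 1) * W + W.
  by rewrite mulrBl mul1r -aq /z; ring.
have zB : a * `|z| <= B + 1.
  rewrite -[a in a * _]gtr0_norm// -normrM az.
  move: e1 e3 WB; rewrite !ler_norml; case/andP: e2; lra.
have az2 : a * (2 * z ^+ 2) <= delta.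
  rewrite -(ler_pM2l a0).
  have : (a * `|z|) ^+ 2 <= (B + 1) ^+ 2 by rewrite ler_pXn2r ?nnegrE ?mulr_ge0// ltW; lra.
  rewrite (exprMn _ a) real_normK ?num_real//; nra.
have z2 : `|z| <= 2^-1.
  by rewrite -(ler_pM2l a0); lra.
have := ln1D_approx z2; rewrite (_ : 1 + z = U); last by rewrite /z; ring.
move=> lnz; have e4 : `|a * (ln U - z)| <= delta.
  by rewrite normrM gtr0_norm// (le_trans _ az2)// ler_wpM2l// ltW.
rewrite (_ : a * ln U - W = a * (ln U - z) + (a * z - W)); last by ring.
rewrite az addrK; move: e1 e3 e4; rewrite !ler_norml; case/andP: e2; lra.
Qed.

End test_function.

Section fluctuation.
Context {R : realType}.
Variables (p : nat) (beta : R).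
Hypothesis hp : (3 <= p)%N.
Hypothesis beta0 : 0 < beta.

(** Factor between the scaled fluctuation and the logarithm of the normalised
    partition function. *)
Definition fluct_scale N : R := N%:R `^ (p%:R / 2) / N%:R.

(** The scaled [chi2_part] is [chi2_ratio] times the normalised sum of centred squares
    of standard deviation [limit_std]. *)
Definition chi2_ratio N : R := N%:R `^ (p%:R / 2) / Num.sqrt ('C(N, p)%:R * p`!%:R).

Definition limit_std : R := Num.sqrt (beta ^+ 4 * p`!%:R / 2).

Local Notation a := fluct_scale.
Local Notation kap := chi2_ratio.
Local Notation sd := limit_std.

Lemma limit_std_gt0 : 0 < sd.
Proof. by rewrite sqrtr_gt0 divr_gt0// mulr_gt0 ?exprn_gt0// ltr0n fact_gt0. Qed.

Let powR_half_sqr N : (N%:R `^ (p%:R / 2)) ^+ 2 = N%:R ^+ p :> R.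
Proof.
rewrite -powR_mulrn ?powR_ge0// -powRrM -powR_mulrn ?ler0n//.
by congr (_ `^ _); field.
Qed.

Lemma fluct_scale_sqr N : (0 < N)%N -> a N ^+ 2 = N%:R ^+ (p - 2).
Proof.
move=> N0; have n0 : N%:R != 0 :> R by rewrite pnatr_eq0 -lt0n.
rewrite /fluct_scale expr_div_n powR_half_sqr; apply: (mulIf (expf_neq0 2 n0)).
by rewrite divfK ?expf_neq0// -exprD subnK// ltnW.
Qed.

Lemma fluct_scale_ge0 N : 0 <= a N.
Proof. by rewrite divr_ge0 ?powR_ge0. Qed.

Lemma fluct_scale_ge (K : R) : \forall N \near \oo, K <= a N.
Proof.
have [K0|K0] := leP K 0.
  by near=> N; apply: le_trans K0 _; exact: fluct_scale_ge0.
near=> N.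
have N0 : (0 < N)%N by near: N; exact: nbhs_infty_gt.
rewrite -(ler_pXn2r (n := 2))// ?nnegrE ?(ltW K0) ?fluct_scale_ge0// fluct_scale_sqr//.
apply: (le_trans (y := N%:R ^+ 1)).
  by rewrite expr1; near: N; exact: nbhs_infty_ger.
by rewrite ler_weXn2l ?ler1n// subn_gt0.
Unshelve. all: by end_near.
Qed.

Lemma chi2_ratio_sqr N : (p <= N)%N -> kap N ^+ 2 = N%:R ^+ p / (N ^_ p)%:R.
Proof.
move=> pN; rewrite /chi2_ratio expr_div_n powR_half_sqr sqr_sqrtr ?mulr_ge0//.
by rewrite -natrM bin_ffact.
Qed.

Lemma cvg_chi2_ratio (e : R) : 0 < e -> \forall N \near \oo, `|kap N - 1| <= e.
Proof.
move=> e0; have /cvgrPdist_le /(_ e e0) h := @cvg_ffact R p.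
near=> N.
have pN : (p <= N)%N by near: N; exact: nbhs_infty_ge.
have : `|1 - kap N ^+ 2| <= e by rewrite chi2_ratio_sqr//; near: N.
apply: le_trans.
have k0 : 0 <= kap N by rewrite divr_ge0 ?powR_ge0 ?sqrtr_ge0.
rewrite distrC (_ : 1 - kap N ^+ 2 = (1 - kap N) * (1 + kap N)); last by ring.
by rewrite normrM ler_peMr// ger0_norm ?addr_ge0// lerDl.
Unshelve. all: by end_near.
Qed.

Lemma chi2_ratioE N : (0 < N)%N -> (p <= N)%N ->
  a N * (beta ^+ 2 * N%:R / 2 / 'C(N, p)%:R) = kap N * (sd / Num.sqrt (2 * 'C(N, p)%:R)).
Proof.
move=> N0 pN.
have n0 : N%:R != 0 :> R by rewrite pnatr_eq0 -lt0n.
set C : R := 'C(N, p)%:R.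
have C0 : 0 < C by rewrite ltr0n bin_gt0.
set r1 := Num.sqrt (C * p`!%:R); set r2 := Num.sqrt (2 * C).
have f0 : 0 < p`!%:R :> R by rewrite ltr0n fact_gt0.
have r10 : 0 < r1 by rewrite sqrtr_gt0 mulr_gt0.
have r20 : 0 < r2 by rewrite sqrtr_gt0 mulr_gt0.
have r1E : r1 ^+ 2 = C * p`!%:R by rewrite sqr_sqrtr// mulr_ge0// ltW.
have r2E : r2 ^+ 2 = 2 * C by rewrite sqr_sqrtr// mulr_ge0// ltW.
have -> : sd = beta ^+ 2 * r1 * r2 / (2 * C).
  rewrite /limit_std -[RHS]ger0_norm; last first.
    apply: divr_ge0; last by rewrite mulr_ge0// ltW.
    by rewrite !mulr_ge0// ?sqr_ge0// ltW.
  rewrite -sqrtr_sqr; congr Num.sqrt.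
  rewrite (_ : (_ / (2 * C)) ^+ 2 = beta ^+ 4 * (r1 ^+ 2 * r2 ^+ 2) / (4 * C ^+ 2)).
    by rewrite r1E r2E; field; rewrite gt_eqF.
  by field; rewrite gt_eqF.
rewrite /fluct_scale /chi2_ratio -/C -/r1; field.
by rewrite (gt_eqF r20) (gt_eqF r10) n0 -/C gt_eqF.
Qed.

Variables (eps c K : R).
Hypothesis eps0 : 0 < eps.
Hypothesis c0 : 0 < c.

(** Bound for the mean of [trunc_sqr_bound], in which [truncated_second_moment] has
    cancelled the variance of the leading fluctuation. *)
Definition trunc_sqr_error N : R :=
  K / (N%:R ^+ (p - 2) * Num.sqrt N%:R) + 2 * N.+1%:R * expR (- c * N%:R) +
  2 * (expR (- (eps ^+ 2 * N%:R / 2)) *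
     (1 + beta ^+ 2 * N%:R / 2 * (1 + (beta + eps) ^+ 2 * N%:R / 'C(N, p)%:R))).

Definition tail_error N : R := expR (- (eps ^+ 2 * N%:R / 2)).

Lemma cvg_invr_sqrt : (Num.sqrt N%:R)^-1 @[N --> \oo] --> (0 : R).
Proof.
apply/cvgr0Pnorm_le => e e0; near=> N.
have N1 : e ^- 2 <= N%:R by near: N; exact: nbhs_infty_ger.
have N0 : 0 < N%:R :> R by apply: lt_le_trans N1; rewrite invr_gt0 exprn_gt0.
rewrite ger0_norm ?invr_ge0 ?sqrtr_ge0// invf_ple ?posrE ?sqrtr_gt0//.
by rewrite -[leLHS]ger0_norm ?invr_ge0 ?(ltW e0)// -sqrtr_sqr ler_wsqrtr// exprVn.
Unshelve. all: by end_near.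
Qed.

Lemma cvg_tail_error : a N * tail_error N @[N --> \oo] --> (0 : R).
Proof.
have q0 : 0 < eps ^+ 2 / 2 by rewrite divr_gt0 ?exprn_gt0.
apply: (@squeeze_cvgr _ _ _ _ (fun=> 0)
  (fun N => N%:R ^+ (p - 2) * expR (- (eps ^+ 2 / 2) * N%:R))).
- near=> N.
  have N0 : (0 < N)%N by near: N; exact: nbhs_infty_gt.
  have a1 : 1 <= a N by near: N; exact: fluct_scale_ge.
  rewrite mulr_ge0 ?fluct_scale_ge0 ?expR_ge0//= /tail_error.
  rewrite (_ : - (eps ^+ 2 / 2) * N%:R = - (eps ^+ 2 * N%:R / 2)); last by ring.
  rewrite ler_wpM2r ?expR_ge0// -fluct_scale_sqr// expr2 ler_peMr//.
  exact: fluct_scale_ge0.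
- exact: cvg_cst.
- exact: cvg_expn_expR.
Unshelve. all: by end_near.
Qed.

Lemma trunc_sqr_error_le e : 0 < e -> \forall N \near \oo,
  a N ^+ 2 * trunc_sqr_error N <= e.
Proof.
move=> e0; pose K2 : R := 2 * (1 + beta ^+ 2 * (1 + (beta + eps) ^+ 2)).
have u : K * (Num.sqrt N%:R)^-1 + 4 * (N%:R ^+ (p - 2).+1 * expR (- c * N%:R)) +
  K2 * (N%:R ^+ (p - 2).+2 * expR (- (eps ^+ 2 / 2) * N%:R)) @[N --> \oo] --> (K * 0 + 4 * 0 + K2 * 0 : R).
  have q0 : 0 < eps ^+ 2 / 2 by rewrite divr_gt0 ?exprn_gt0.
  apply: cvgD; first apply: cvgD.
  - by apply: cvgM; [exact: cvg_cst|exact: cvg_invr_sqrt].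
  - by apply: cvgM; [exact: cvg_cst|exact: cvg_expn_expR].
  - by apply: cvgM; [exact: cvg_cst|exact: cvg_expn_expR].
rewrite !mulr0 !addr0 in u.
have /cvgr0Pnorm_le /(_ e e0) ue := u.
near=> N.
have N0 : (0 < N)%N by near: N; exact: nbhs_infty_gt.
have pN : (p <= N)%N by near: N; exact: nbhs_infty_ge.
have : `|K * (Num.sqrt N%:R)^-1 + 4 * (N%:R ^+ (p - 2).+1 * expR (- c * N%:R)) +
  K2 * (N%:R ^+ (p - 2).+2 * expR (- (eps ^+ 2 / 2) * N%:R))| <= e by near: N.
move=> h; apply: le_trans (le_trans (ler_norm _) h).
rewrite fluct_scale_sqr// /trunc_sqr_error mulrDr mulrDr.
set n : R := N%:R.
have n1 : 1 <= n by rewrite /n ler1n.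
have n0 : 0 < n by lra.
have m0 : 0 < n ^+ (p - 2) by rewrite exprn_gt0.
apply: lerD; first apply: lerD.
- rewrite le_eqVlt; apply/orP; left; apply/eqP; field.
  by rewrite !gt_eqF// sqrtr_gt0.
- set E := expR _; have E0 : 0 <= E by exact: expR_ge0.
  rewrite exprSr -natr1 -/n.
  rewrite (_ : _ * _ = n ^+ (p - 2) * E * (2 * (n + 1))); last by ring.
  rewrite (_ : 4 * _ = n ^+ (p - 2) * E * (4 * n)); last by ring.
  by rewrite ler_wpM2l ?mulr_ge0 ?(ltW m0)//; lra.
- rewrite (_ : - (eps ^+ 2 / 2) * n = - (eps ^+ 2 * n / 2)); last by ring.
  set E := expR _; have E0 : 0 <= E by exact: expR_ge0.
  rewrite !(exprSr n); set b := (beta + eps) ^+ 2.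
  have b0 : 0 <= b by exact: sqr_ge0.
  have y_le : b * n / 'C(N, p)%:R <= b * n.
    rewrite ler_pdivrMr ?ltr0n ?bin_gt0// ler_peMr ?ler1n ?bin_gt0//.
    by rewrite mulr_ge0// ltW.
  rewrite [leLHS](_ : _ = n ^+ (p - 2) * E *
    (2 * (1 + beta ^+ 2 * n / 2 * (1 + b * n / 'C(N, p)%:R)))); last by ring.
  rewrite [leRHS](_ : _ = n ^+ (p - 2) * E *
    (2 * ((1 + beta ^+ 2 * (1 + b)) * (n * n)))); last by rewrite /K2 -/b; ring.
  rewrite ler_wpM2l ?mulr_ge0 ?(ltW m0)// ler_wpM2l//.
  have bb : 0 <= beta ^+ 2 by exact: sqr_ge0.
  have nn : n <= n * n by rewrite ler_peMr// ltW.
  rewrite mulrDl mul1r lerD//; first by lra.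
  set y := b * n / _ in y_le *.
  rewrite (_ : _ * (1 + y) = beta ^+ 2 * (n / 2 * (1 + y))); last by ring.
  rewrite -(mulrA (beta ^+ 2)) ler_wpM2l//.
  apply: (le_trans (y := n / 2 * (1 + b * n))).
    by apply: ler_wpM2l; [rewrite divr_ge0// ltW|rewrite lerD2l].
  have : b * n <= b * (n * n) by rewrite ler_wpM2l.
  nra.
Unshelve. all: by end_near.
Qed.

End fluctuation.

(** Integrated form of [test_function_le]: every term of its right-hand side has an
    explicit mean. *)
Lemma fluctuation_expectation_le {R : realType} (p N : nat) (beta eps dlt : R)
    d (T : measurableType d) (P : probability T R) (J : multi_index N p -> {RV P >-> R})
    (f : R -> R) (M B eta delta : R) : (0 < N)%N -> (p <= N)%N -> 0 < beta -> 0 <= eps ->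
  mutually_independent P J -> (forall A, has_law P (J A) (gaussian 0 1)) ->
  continuous f -> (forall x, `|f x| <= M) -> 0 < B -> 0 < delta -> 4 * delta <= 1 ->
  (forall x y, `|y| <= B -> `|x - y| <= 4 * delta -> `|f x - f y| <= eta) ->
  2 * (B + 1) <= fluct_scale p N -> 2 * (B + 1) ^+ 2 <= delta * fluct_scale p N ->
  `|chi2_ratio p N - 1| * B <= delta ->
  `|\int[P]_w f (scaled_fluctuation J beta w) -
    \int[P]_w f (limit_std p beta / Num.sqrt (2 * 'C(N, p)%:R) * \sum_A (J A w ^+ 2 - 1))| <=
  eta + 2 * M * (limit_std p beta ^+ 2 / B ^+ 2 +
    fluct_scale p N ^+ 2 *
      (2 ^- N * \sum_(t : config N) expR (N%:R * pair_exponent p beta eps dlt t) - 1 -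
       chi2_var N p beta +
       2 * (expR (- (eps ^+ 2 * N%:R / 2)) *
        (1 + beta ^+ 2 * N%:R / 2 * (1 + (beta + eps) ^+ 2 * N%:R / 'C(N, p)%:R)))) /
      delta ^+ 2 +
    fluct_scale p N * tail_error eps N / delta).
Proof.
move=> N0 pN b0 e0 indep law cf f_le B0 d0 d1 fu a1 a2 kB.
set a := fluct_scale p N; set s := limit_std p beta.
set C : R := 'C(N, p)%:R; have C0 : 0 < C by rewrite ltr0n bin_gt0.
pose W w := s / Num.sqrt (2 * C) * \sum_A (J A w ^+ 2 - 1).
have mf : measurable_fun setT f by exact: continuous_measurable_fun.
have mX : measurable_fun setT (scaled_fluctuation J beta).
  exact: measurable_scaled_fluctuation.
have hW2 : hasE P (fun w => W w ^+ 2) (s ^+ 2).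
  have := hasEZ ((s / Num.sqrt (2 * C)) ^+ 2) (hasE_chi2_sqr indep law).
  move/hasE_eq; apply=> [w|]; first by rewrite /W (exprMn _ (s / _)).
  have r2 : Num.sqrt (2 * C) ^+ 2 = 2 * C by rewrite sqr_sqrtr// mulr_ge0// ltW.
  by rewrite card_multi_index expr_div_n r2 divfK// gt_eqF// mulr_gt0.
have mW : measurable_fun setT W.
  apply: measurable_funM; first exact: measurable_cst.
  apply: measurable_sum => A; apply: measurable_funB; last exact: measurable_cst.
  by apply: measurable_funX; exact: measurable_funPT.
have bnd (X : T -> R) : measurable_fun setT X ->
    hasE P (fun w => f (X w)) (\int[P]_w f (X w)).
  move=> mX'; apply: (@hasE_dominated _ _ _ P _ (fun=> M) M) => //; last exact: hasE_cst.
  exact: measurableT_comp.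
have hD := hasEB (bnd _ mX) (bnd _ mW).
have hH := hasE_trunc_sqr_bound indep law pN beta eps dlt.
have hL := hasE_tail_bound indep law pN beta eps.
have hB := hasED (hasE_cst P eta) (hasEZ (2 * M) (hasED (hasED
  (hasEZ (B ^- 2) hW2) (hasEZ (a ^+ 2 / delta ^+ 2) hH)) (hasEZ (a / delta) hL))).
set bound := (X in _ <= X).
have {}hB := hasE_eq hB (fun=> erefl) (_ : bound = _).
have {hB}hB : hasE P (fun w => eta + 2 * M * (B ^- 2 * W w ^+ 2 +
    a ^+ 2 / delta ^+ 2 * trunc_sqr_bound J beta eps dlt w +
    a / delta * tail_bound J beta eps w)) bound.
  by apply: hB; rewrite /bound /tail_error; ring.
have le w : `|f (scaled_fluctuation J beta w) - f (W w)| <= eta + 2 * M * (B ^- 2 * W w ^+ 2 +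
    a ^+ 2 / delta ^+ 2 * trunc_sqr_bound J beta eps dlt w +
    a / delta * tail_bound J beta eps w).
  rewrite scaled_fluctuation_ln// -/(fluct_scale p N) -/a.
  have aq : a * chi2_part J beta w = chi2_ratio p N * W w.
    by rewrite /chi2_part /W mulrA [a * _]chi2_ratioE// -mulrA.
  have := test_function_le f_le B0 d0 d1 fu a1 a2 kB aq (trunc_partition_le J beta eps w)
    (sub_trunc_partition_le J beta w e0) (trunc_sqr_le J N0 pN dlt w b0 e0).
  by move/le_trans; apply; rewrite -/a le_eqVlt; apply/orP; left; apply/eqP; ring.
rewrite ler_norml; apply/andP; split.
- apply: (hasE_le (hasEN hB) hD) => w.
  by have := le w; rewrite ler_norml => /andP[].
- apply: (hasE_le hD hB) => w.
  by have := le w; rewrite ler_norml => /andP[].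
Qed.

(** * The fluctuations of the free energy *)

Theorem theorem1p1 (R : realType) (p : nat) (beta : R)
  (d : nat -> measure_display) (T : forall N, measurableType (d N))
  (P : forall N, probability (T N) R)
  (J : forall N, multi_index N p -> {RV (P N) >-> R})
  (hp : (3 <= p)%N)
  (hbeta0 : 0 < beta)
  (hbeta : beta < critical_beta p)
  (hindep : forall N, (p <= N)%N -> mutually_independent (P N) (J N))
  (hlaw : forall N, (p <= N)%N -> forall A, has_law (P N) (J N A) (gaussian 0 1)) :
  cvg_in_distribution P (fun N => scaled_fluctuation (J N) beta)
    (gaussian 0 (beta ^+ 4 * p`!%:R / 2)).
Proof.
move=> f cf [M f_le].
have M0 : 0 <= M by exact: le_trans (f_le 0).
have mf : measurable_fun setT f by exact: continuous_measurable_fun.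
pose s := limit_std p beta.
have s0 : 0 < s by exact: limit_std_gt0.
have hG : hasE (normal_prob (0 : R) s) f (\int[normal_prob 0 s]_x f x).
  by apply: (@hasE_dominated _ _ _ _ _ (fun=> M) M) => //; exact: hasE_cst.
have hX N : hasE (P N) (fun w => f (scaled_fluctuation (J N) beta w))
    (\int[P N]_w f (scaled_fluctuation (J N) beta w)).
  apply: (@hasE_dominated _ _ _ _ _ (fun=> M) M) => //; last exact: hasE_cst.
  by apply: measurableT_comp => //; exact: measurable_scaled_fluctuation.
rewrite /gaussian -/s hG.2.
rewrite (_ : (fun N => 'E_(P N)[_]%E) =
    fun N => (\int[P N]_w f (scaled_fluctuation (J N) beta w))%:E); last first.
  by apply/funext => N; rewrite unlock (hX N).2.
apply: cvg_EFin; first by near=> N.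
apply/cvgrPdist_le => e e0 /=.
have [eps [dlt [K [c [eps0 c0 pairs_le]]]]] := truncated_second_moment hp hbeta0 hbeta.
have [K' stein] := chi2_stein s0 cf f_le.
pose K1 := `|K'| + 1; have K10 : 0 < K1 by rewrite ltr_wpDl.
pose theta := e / 10 / K1; have theta0 : 0 < theta by rewrite !divr_gt0.
pose eta := e / 5; have eta0 : 0 < eta by rewrite divr_gt0.
pose M1 := M + 1; have M10 : 0 < M1 by rewrite ltr_wpDl.
pose B := Num.sqrt (2 * M1 * s ^+ 2 / eta).
have B2E : B ^+ 2 = 2 * M1 * s ^+ 2 / eta.
  by rewrite sqr_sqrtr// divr_ge0 ?mulr_ge0 ?sqr_ge0// ltW.
have B0 : 0 < B by rewrite sqrtr_gt0 divr_gt0 ?mulr_gt0 ?exprn_gt0.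
have [rho /andP[rho0 rho1] fu] := unif_continuous_segment cf B eta0.
pose delta := rho / 4; have d0 : 0 < delta by rewrite divr_gt0.
have d4 : 4 * delta = rho by rewrite /delta; field.
pose e1 := e / 10 / (2 * M1) * delta ^+ 2.
have e10 : 0 < e1 by rewrite mulr_gt0 ?exprn_gt0 ?divr_gt0// mulr_gt0.
pose e2 := e / 10 / (2 * M1) * delta.
have e20 : 0 < e2 by rewrite mulr_gt0 ?divr_gt0// mulr_gt0.
have fin : e / 5 + (eta + (eta + e / 5)) <= e by rewrite /eta; lra.
have two_le (x : R) : x <= theta -> theta + x <= 2 * theta by clear; lra.
have cancel_le (x y z t u : R) : x <= 1 + y + z + t -> x - 1 - y + u <= z + t + u by lra.
near=> N.
have N0 : (0 < N)%N by near: N; exact: nbhs_infty_gt.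
have pN : (p <= N)%N by near: N; exact: nbhs_infty_ge.
have a1 : 2 * (B + 1) <= fluct_scale p N by near: N; exact: fluct_scale_ge.
have a2 : 2 * (B + 1) ^+ 2 <= delta * fluct_scale p N.
  by rewrite -ler_pdivrMl//; near: N; exact: fluct_scale_ge.
have kB : `|chi2_ratio p N - 1| * B <= delta.
  by rewrite -ler_pdivlMr//; near: N; apply: cvg_chi2_ratio => //; rewrite divr_gt0.
have d1 : 4 * delta <= 1 by rewrite d4.
have fu' : forall x y, `|y| <= B -> `|x - y| <= 4 * delta -> `|f x - f y| <= eta.
  by rewrite d4.
have main := fluctuation_expectation_le dlt N0 pN hbeta0 (ltW eps0) (hindep N pN)
  (hlaw N pN) cf f_le B0 d0 d1 fu' a1 a2 kB.
have cardI : (0 < #|multi_index N p|)%N by rewrite card_multi_index bin_gt0.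
have := stein _ _ _ _ _ theta (hindep N pN) (hlaw N pN) cardI theta0.
rewrite card_multi_index => stein_le.
have err1 : fluct_scale p N ^+ 2 * trunc_sqr_error p beta eps c K N <= e1.
  by near: N; exact: trunc_sqr_error_le.
have err2 : fluct_scale p N * tail_error eps N <= e2.
  near: N; have /cvgr0Pnorm_le /(_ e2 e20) := cvg_tail_error hp eps0.
  by apply: filterS => N; exact/le_trans/ler_norm.
have C0 : 0 < 'C(N, p)%:R :> R by rewrite ltr0n bin_gt0.
have tC : 0 < theta * 'C(N, p)%:R by rewrite mulr_gt0.
have err3 : 2 / (theta * 'C(N, p)%:R) <= theta.
  have f0 : 0 < p`!%:R :> R by rewrite ltr0n fact_gt0.
  have CN : N%:R <= 'C(N, p)%:R * p`!%:R :> R.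
    rewrite -natrM ler_nat bin_ffact -(prednK (ltnW (ltnW hp))) ffactnS leq_pmulr// ffact_gt0.
    by rewrite -!subn1 leq_sub2r.
  have : 2 * p`!%:R / theta ^+ 2 <= N%:R by near: N; exact: nbhs_infty_ger.
  move=> /le_trans /(_ CN); rewrite ler_pdivrMr ?exprn_gt0// mulrAC ler_pM2r// => h.
  rewrite (ler_pdivrMr _ _ tC) [leRHS](_ : _ = 'C(N, p)%:R * theta ^+ 2)//.
  by clear; ring.
have pairs : 2 ^- N * \sum_(t : config N) expR (N%:R * pair_exponent p beta eps dlt t) <=
    1 + beta ^+ 4 * N%:R ^+ 2 / (2 * 'C(N, p)%:R) +
    K / (N%:R ^+ (p - 2) * Num.sqrt N%:R) + 2 * N.+1%:R * expR (- c * N%:R) by near: N.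
move: main; set EH := (X in _ * X / delta ^+ 2); set EX := \int[P N]_w _; set EW := \int[P N]_w _.
move=> main.
have EH_le : fluct_scale p N ^+ 2 * EH <= e1.
  apply: le_trans err1; rewrite ler_wpM2l ?sqr_ge0//.
  by apply: cancel_le; exact: pairs.
have main' : `|EX - EW| <= eta + 2 * M1 * (s ^+ 2 / B ^+ 2 + e1 / delta ^+ 2 + e2 / delta).
  apply: le_trans main _; rewrite lerD2l.
  apply: (le_trans (y := 2 * M * (s ^+ 2 / B ^+ 2 + e1 / delta ^+ 2 + e2 / delta))).
    rewrite ler_wpM2l ?mulr_ge0// lerD// ?lerD2l//.
    - by rewrite ler_wpM2r// invr_ge0 sqr_ge0.
    - by rewrite ler_wpM2r// invr_ge0 ltW.
  rewrite ler_wpM2r ?ler_wpM2l ?lerDl// !addr_ge0// ?divr_ge0 ?sqr_ge0// ltW//.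
have bound : 2 * M1 * (s ^+ 2 / B ^+ 2 + e1 / delta ^+ 2 + e2 / delta) = eta + e / 5.
  rewrite B2E /e1 /e2; field.
  by rewrite !gt_eqF.
have stein' : `|EW - \int[normal_prob 0 s]_x f x| <= e / 5.
  apply: le_trans stein_le _.
  have t0 : 0 <= theta + 2 / (theta * 'C(N, p)%:R).
    apply: addr_ge0; first exact: ltW.
    by apply: divr_ge0 => //; exact: ltW.
  have t1 : theta + 2 / (theta * 'C(N, p)%:R) <= 2 * theta by exact: two_le.
  apply: (le_trans (y := K1 * (2 * theta))).
    apply: le_trans (ler_wpM2l (ltW K10) t1).
    by rewrite ler_wpM2r// (le_trans (ler_norm _))// lerDl.
  by rewrite /theta le_eqVlt; apply/orP; left; apply/eqP; field; rewrite gt_eqF.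
have := ler_distD EW (\int[normal_prob 0 s]_x f x) EX.
move=> h; apply: le_trans h _; rewrite [X in X + _]distrC [X in _ + X]distrC.
by apply: le_trans (lerD stein' main') _; rewrite bound.
Unshelve. all: by end_near.
Qed.
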